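(* Let $\mathbb{K}$ be a principal ideal domain and let $\mathcal{P}=(A,B)$ and $\mathcal{P}'=(A',B')$ be two path pairs of modules over $\mathbb{K}$ such that (i) $A_n$ and $A'_n$ are free modules for every $n\ge0$; (ii) $\overline{B}_n$ and $\overline{B}'_n$ are direct summands of $\mathsf{N}_nA$ and $\mathsf{N}_nA'$ respectively, for every $n\geq 0$. Then the Eilenberg–Zilber map $\varepsilon:\mathsf{N}A\otimes\mathsf{N}A'\to\mathsf{N}(A\otimes A')$ and the Alexander–Whitney map $\alpha:\mathsf{N}(A\otimes A')\to\mathsf{N}A\otimes\mathsf{N}A'$ induce mutually inverse isomorphisms of chain complexes $$\Omega\mathcal{P}\otimes\Omega\mathcal{P}'\cong\Omega(\mathcal{P}\square\mathcal{P}').$$ Moreover, for every $n$ there is a short exact sequence $$0\to\bigoplus_{i+j=n}H_i\mathcal{P}\otimes H_j\mathcal{P}'\to H_n(\mathcal{P}\square\mathcal{P}')\to\bigoplus_{i+j=n-1}\mathsf{Tor}_1^{\mathbb{K}}(H_i\mathcal{P},H_j\mathcal{P}')\to0.$$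
   Context: All modules, complexes and tensor products are over $\mathbb{K}$. For a non-negatively graded chain complex $C$ with differential $\partial$ and a graded submodule $D\subseteq C$ (not necessarily a subcomplex), $\omega(C,D)$ is the subcomplex of $C$ with $\omega(C,D)_n=D_n\cap\partial^{-1}(D_{n-1})$. For a simplicial module $A$, $\mathsf{C}A$ is the complex with components $A_n$ and differential $\sum_i(-1)^id_i$; $\mathsf{N}A$ is the subcomplex $\mathsf{N}_nA=\bigcap_{i\ne0}\ker(d_i:A_n\to A_{n-1})$; $\mathsf{D}A$ is the subcomplex $\mathsf{D}_nA=\sum_i s_i(A_{n-1})$. One has $\mathsf{C}A=\mathsf{N}A\oplus\mathsf{D}A$, and $\rho:\mathsf{C}A\to\mathsf{N}A$ denotes the projection along $\mathsf{D}A$. A path pair of modules is $\mathcal{P}=(A,B)$ where $A$ is a simplicial module and $B=(B_n\subseteq A_n)_{n\ge0}$ is a sequence of submodules closed under all degeneracy maps $s_i$ and under the exterior face maps $d_0,d_n:A_n\to A_{n-1}$. Put $\overline{B}_n=\rho(B_n)\subseteq\mathsf{N}_nA$, $\Omega\mathcal{P}=\omega(\mathsf{N}A,\overline{B})$ and $H_n\mathcal{P}=H_n(\Omega\mathcal{P})$. For submodules $N\subseteq M$, $N'\subseteq M'$ let $N\bar\otimes N'$ be the image of $N\otimes N'\to M\otimes M'$. A $(k,l)$-shuffle is a pair $(\mu,\nu)$ of strictly increasing sequences $\mu=(\mu_0,\dots,\mu_{k-1})$, $\nu=(\nu_0,\dots,\nu_{l-1})$ with $\{\mu_i\}\cup\{\nu_j\}=\{0,\dots,k+l-1\}$;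 $\mathsf{Sh}(k,l)$ is the set of these, and $\mathsf{sgn}(\mu,\nu)$ is the sign of the permutation $(\mu_0,\dots,\mu_{k-1},\nu_0,\dots,\nu_{l-1})$. Write $s_\nu=s_{\nu_{l-1}}\cdots s_{\nu_0}$ and $s_\mu=s_{\mu_{k-1}}\cdots s_{\mu_0}$. The box product is $(A,B)\square(A',B')=(A\otimes A',B\diamond B')$, where $(A\otimes A')_n=A_n\otimes A'_n$ and $$(B\diamond B')_n=\sum_{k+l=n}\ \sum_{(\mu,\nu)\in\mathsf{Sh}(k,l)}s_\nu(B_k)\,\bar\otimes\,s_\mu(B'_l);$$ it is again a path pair. The maps $\mathcal{E}:\mathsf{C}A\otimes\mathsf{C}A'\to\mathsf{C}(A\otimes A')$ and $\mathcal{A}:\mathsf{C}(A\otimes A')\to\mathsf{C}A\otimes\mathsf{C}A'$ are $$\mathcal{E}(a\otimes a')=\sum_{(\mu,\nu)\in\mathsf{Sh}(k,l)}\mathsf{sgn}(\mu,\nu)\,s_\nu a\otimes s_\mu a'\quad(a\in A_k,\ a'\in A'_l),\qquad \mathcal{A}(a\otimes a')=\sum_{k+l=n}h^la\otimes t^ka'\quad (a\in A_n,\ a'\in A'_n),$$ where $t=d_0$ and $h$ is the last face map ($h=d_m$ on degree $m$). The Eilenberg–Zilber and Alexander–Whitney maps on Moore complexes are $\varepsilon(x)=\rho\,\mathcal{E}(x)$ and $\alpha(x)=(\rho\otimes\rho)\mathcal{A}(x)$. Under the hypotheses of the theorem the natural map $\Omega\mathcal{P}\otimes\Omega\mathcal{P}'\to\mathsf{N}A\otimes\mathsf{N}A'$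 is injective, and $\Omega\mathcal{P}\otimes\Omega\mathcal{P}'$ is identified with its image; ''induce'' means that $\varepsilon$ and $\alpha$ restrict to the subcomplexes $\Omega\mathcal{P}\otimes\Omega\mathcal{P}'$ and $\Omega(\mathcal{P}\square\mathcal{P}')$. *)

(* Defs.v *)
From HB Require Import structures.
From mathcomp Require Import all_boot all_fingroup all_algebra.
From mathcomp Require Import boolp freeg generic_quotient zify.

Set Implicit Arguments.
Unset Strict Implicit.
Unset Printing Implicit Defensive.

Import GRing.Theory.
Local Open Scope ring_scope.

Section Submodules.
Variable K : comNzRingType.
Implicit Types U V W : lmodType K.

Definition submod_prop V (P : V -> Prop) : Prop :=
  P 0 /\ forall a u v, P u -> P v -> P (a *: u + v).

Section SubmodOf.
Variables (V : lmodType K) (P : V -> Prop) (hP : submod_prop P).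

Fact submod_of_closed : submod_closed (fun x : V => `[< P x >]).
Proof.
case: hP => P0 PL; split; first exact/asboolP.
by move=> a u v /asboolP Pu /asboolP Pv; apply/asboolP/PL.
Qed.

Definition submod_of : submodClosed V :=
  HB.pack (fun x : V => `[< P x >])
    (GRing.isSubmodClosed.Build K V (fun x : V => `[< P x >]) submod_of_closed).

Lemma in_submod_of x : (x \in submod_of) <-> P x.
Proof. by split => [/asboolP|h]; last exact/asboolP. Qed.
End SubmodOf.

Lemma submodL V (S : submodClosed V) a u v :
  u \in S -> v \in S -> a *: u + v \in S.
Proof. by move=> uS vS; rewrite rpredD ?rpredZ. Qed.

Lemma submodN V (S : submodClosed V) u : u \in S -> - u \in S.
Proof. by move=> uS; rewrite -scaleN1r rpredZ. Qed.

Lemma submodB V (S : submodClosed V) u v : u \in S -> v \in S -> u - v \in S.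
Proof. by move=> uS vS; rewrite rpredD ?submodN. Qed.

Record subm V (S : submodClosed V) := Subm { subm_val : V; _ : subm_val \in S }.
HB.instance Definition _ V (S : submodClosed V) := [isSub for @subm_val V S].
HB.instance Definition _ V (S : submodClosed V) := [Choice of subm S by <:].
HB.instance Definition _ V (S : submodClosed V) :=
  [SubChoice_isSubLmodule of subm S by <:].

Section Quotient.
Variables (V : lmodType K) (S : submodClosed V).

Lemma submod_zmod_closed : zmod_closed (S : {pred V}).
Proof. by split=> [|x y]; [exact: rpred0 | exact: submodB]. Qed.

Definition zmod_of_submod : zmodClosed V :=
  HB.pack (S : {pred V})
    (GRing.isZmodClosed.Build V (S : {pred V}) submod_zmod_closed).

Definition quotm := Quotient.quot zmod_of_submod.
HB.instance Definition _ := GRing.Zmodule.on quotm.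

Definition qproj (x : V) : quotm := \pi_(Quotient.quot zmod_of_submod)%qT x.

Lemma qproj_eq x y : (qproj x = qproj y) <-> (x - y \in S).
Proof.
rewrite /qproj; split=> [e|h].
  by have := Quotient.idealrBE zmod_of_submod x y; rewrite e eqxx.
by apply/eqP; rewrite -(Quotient.idealrBE zmod_of_submod).
Qed.

Lemma qprojB : {morph qproj : x y / x - y}.
Proof. by move=> x y; rewrite /qproj; apply: raddfB. Qed.

Lemma qprojD : {morph qproj : x y / x + y}.
Proof. by move=> x y; rewrite /qproj; apply: raddfD. Qed.

Lemma qproj_surj (q : quotm) : exists x, qproj x = q.
Proof. by exists (repr q); rewrite /qproj reprK. Qed.

Definition qscale (a : K) (q : quotm) : quotm := qproj (a *: repr q).

Lemma qscaleE a x : qscale a (qproj x) = qproj (a *: x).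
Proof.
apply/qproj_eq; rewrite -scalerBr rpredZ //.
by apply/qproj_eq; rewrite /qproj reprK.
Qed.

Lemma qscaleA a b q : qscale a (qscale b q) = qscale (a * b) q.
Proof. by have [x <-] := qproj_surj q; rewrite !qscaleE scalerA. Qed.
Lemma qscale1 q : qscale 1 q = q.
Proof. by have [x <-] := qproj_surj q; rewrite !qscaleE scale1r. Qed.
Lemma qscaleDr a p q : qscale a (p + q) = qscale a p + qscale a q.
Proof.
have [x <-] := qproj_surj p; have [y <-] := qproj_surj q.
by rewrite -qprojD !qscaleE scalerDr qprojD.
Qed.
Lemma qscaleDl q a b : qscale (a + b) q = qscale a q + qscale b q.
Proof.
by have [x <-] := qproj_surj q; rewrite !qscaleE scalerDl qprojD.
Qed.
HB.instance Definition _ :=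
  GRing.Zmodule_isLmodule.Build K quotm qscaleA qscale1 qscaleDr qscaleDl.

Lemma qproj_linear : linear qproj.
Proof. by move=> a x y; rewrite qprojD -qscaleE. Qed.
HB.instance Definition _ := GRing.isLinear.Build K V quotm *:%R qproj qproj_linear.

Section Lift.
Variables (W : lmodType K) (f : {linear V -> W}).
Hypothesis fS : forall x, x \in S -> f x = 0.

Definition qlift_fun (q : quotm) : W := f (repr q).

Lemma qlift_funE x : qlift_fun (qproj x) = f x.
Proof.
apply/eqP; rewrite -subr_eq0 -linearB; apply/eqP/fS.
by apply/qproj_eq; rewrite /qproj reprK.
Qed.

Lemma qlift_linear : linear qlift_fun.
Proof.
move=> a p q; have [x <-] := qproj_surj p; have [y <-] := qproj_surj q.
by rewrite -linearP !qlift_funE linearP.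
Qed.
HB.instance Definition _ :=
  GRing.isLinear.Build K quotm W *:%R qlift_fun qlift_linear.
Definition qlift : {linear quotm -> W} := qlift_fun.
End Lift.
End Quotient.

Fact imsub_prop V W (f : {linear V -> W}) (S : submodClosed V) :
  submod_prop (fun y => exists2 x, x \in S & y = f x).
Proof.
split; first by exists 0; rewrite ?rpred0 ?linear0.
move=> a u v [x xS ->] [y yS ->].
by exists (a *: x + y); [exact: submodL | rewrite linearP].
Qed.
Definition imsub V W (f : {linear V -> W}) (S : submodClosed V) :=
  submod_of (imsub_prop f S).

Fact kersub_prop V W (f : {linear V -> W}) : submod_prop (fun x => f x = 0).
Proof.
by split=> [|a u v fu fv]; rewrite ?linear0 // linearP fu fv scaler0 addr0.
Qed.
Definition kersub V W (f : {linear V -> W}) := submod_of (kersub_prop f).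

Fact zerosub_prop V : submod_prop (fun x : V => x = 0).
Proof. by split=> // a u v -> ->; rewrite scaler0 addr0. Qed.
Definition zerosub V := submod_of (@zerosub_prop V).

Fact rangesub_prop V W (f : {linear V -> W}) :
  submod_prop (fun y => exists x, y = f x).
Proof.
split; first by exists 0; rewrite linear0.
by move=> a u v [x ->] [y ->]; exists (a *: x + y); rewrite linearP.
Qed.
Definition rangesub V W (f : {linear V -> W}) := submod_of (rangesub_prop f).

Fact presub_prop V W (f : {linear V -> W}) (T : submodClosed W) :
  submod_prop (fun x => f x \in T).
Proof.
by split=> [|a u v hu hv]; rewrite ?linear0 ?linearP ?rpred0 ?submodL.
Qed.
Definition presub V W (f : {linear V -> W}) (T : submodClosed W) :=
  submod_of (presub_prop f T).

Fact sumsub_prop V (I : finType) (P : pred I) (S : I -> submodClosed V) :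
  submod_prop (fun x => exists2 f : I -> V,
    (forall i, P i -> f i \in S i) & x = \sum_(i | P i) f i).
Proof.
split; first by exists (fun=> 0) => [i _|]; [exact: rpred0 | rewrite big1].
move=> a u v [f fS ->] [g gS ->]; exists (fun i => a *: f i + g i).
  by move=> i Pi; rewrite submodL ?fS ?gS.
by rewrite scaler_sumr big_split.
Qed.
Definition sumsub V (I : finType) (P : pred I) (S : I -> submodClosed V) :=
  submod_of (sumsub_prop P S).

Fact spansub_prop V (G : V -> Prop) :
  submod_prop (fun x => forall S : submodClosed V,
    (forall y, G y -> y \in S) -> x \in S).
Proof.
split=> [S _|a u v hu hv S GS]; first exact: rpred0.
by rewrite submodL ?hu ?hv.
Qed.
Definition spansub V (G : V -> Prop) := submod_of (spansub_prop G).

Definition direct_summand V (S : submodClosed V) : Prop :=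
  exists T : submodClosed V,
    (forall x, x \in S -> x \in T -> x = 0) /\
    (forall x, exists s t, [/\ s \in S, t \in T & x = s + t]).

Section Restriction.
Variables (V W : lmodType K) (S : submodClosed V) (T : submodClosed W).
Variables (f : {linear V -> W}) (fST : forall x, x \in S -> f x \in T).

Definition restr_fun (x : subm S) : subm T := Subm (fST (valP x)).

Fact restr_linear : linear restr_fun.
Proof. by move=> a x y; apply/val_inj; rewrite /= !linearP. Qed.

HB.instance Definition _ := GRing.isLinear.Build _ _ _ _ restr_fun restr_linear.
Definition restr : {linear subm S -> subm T} := restr_fun.
End Restriction.

End Submodules.

Section Free.
Variable K : comNzRingType.

Section FreeLift.
Variables (I : choiceType) (M : lmodType K) (f : I -> M).

Lemma fglift_linear : linear (fglift f : {freeg I / K} -> M).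
Proof.
have add (x y : {freeg I / K}) : fglift f (x + y) = fglift f x + fglift f y.
  have B := @lift_is_additive K I M f.
  have B0 : fglift f 0 = 0 by rewrite -(subrr 0) B subrr.
  have -> : x + y = x - (0 - y) by rewrite sub0r opprK.
  by rewrite !B B0 sub0r opprK.
have sc a (x : {freeg I / K}) : fglift f (a *: x) = a *: fglift f x.
  have add0 : fglift f 0 = 0.
    by apply: (addrI (fglift f 0)); rewrite -add !addr0.
  rewrite -[x]freeg_sumE scaler_sumr.
  rewrite !(big_morph (fglift f) add add0) scaler_sumr.
  apply: eq_bigr => i _.
  have -> : a *: << coeff i x *g i >> = << a * coeff i x *g i >>.
    by apply/eqP/freeg_eqP => j; rewrite coeffZ !coeffU mulrA.
  by rewrite !liftU scalerA.
by move=> a x y; rewrite add sc.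
Qed.

Definition freelift : {linear {freeg I / K} -> M} :=
  HB.pack (fglift f : {freeg I / K} -> M)
    (GRing.isLinear.Build _ _ _ _ (fglift f : {freeg I / K} -> M) fglift_linear).

Lemma freeliftE i : freelift << i >> = f i.
Proof. by rewrite /= liftU scale1r. Qed.
End FreeLift.

Lemma freeg_lin_ext (I : choiceType) (M : lmodType K)
    (f g : {linear {freeg I / K} -> M}) :
  (forall i, f << i >> = g << i >>) -> f =1 g.
Proof.
move=> h x; rewrite -[x]freeg_sumE !linear_sum; apply: eq_bigr => i _.
have -> : << coeff i x *g i >> = coeff i x *: (<< i >> : {freeg I / K}).
  by apply/eqP/freeg_eqP => j; rewrite coeffZ !coeffU mul1r.
by rewrite (linearZ_LR f) (linearZ_LR g) h.
Qed.

(* Free of arbitrary, possibly infinite, rank. *)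
Definition free_module (M : lmodType K) : Prop :=
  exists (I : choiceType) (f : {linear {freeg I / K} -> M}), bijective f.

End Free.

Section Tensor.
Variable K : comNzRingType.
Implicit Types M N P : lmodType K.

Inductive bilin_rel M N : {freeg (M * N)%type / K} -> Prop :=
| BilinL a u v y :
    bilin_rel (<< (a *: u + v, y) >> - (a *: << (u, y) >> + << (v, y) >>))
| BilinR a x u v :
    bilin_rel (<< (x, a *: u + v) >> - (a *: << (x, u) >> + << (x, v) >>)).

Definition tens M N : lmodType K := quotm (spansub (@bilin_rel M N)).

Definition tpure M N (x : M) (y : N) : tens M N :=
  qproj (spansub (@bilin_rel M N)) << (x, y) >>.

Lemma spansub_gen (V : lmodType K) (G : V -> Prop) x : G x -> x \in spansub G.
Proof. by move=> Gx; apply/in_submod_of => S; apply. Qed.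

Lemma tpure_linl M N (y : N) : linear (fun x : M => tpure x y).
Proof.
move=> a u v; rewrite /tpure -linearP; apply/qproj_eq/spansub_gen.
exact: BilinL.
Qed.

Lemma tpure_linr M N (x : M) : linear (fun y : N => tpure x y).
Proof.
move=> a u v; rewrite /tpure -linearP; apply/qproj_eq/spansub_gen.
exact: BilinR.
Qed.

Section TensorLift.
Variables (M N P : lmodType K) (f : M -> N -> P).
Hypothesis f_linl : forall y, linear (f^~ y).
Hypothesis f_linr : forall x, linear (f x).

Fact tlift_subproof x : x \in spansub (@bilin_rel M N) ->
  freelift (fun z : M * N => f z.1 z.2) x = 0.
Proof.
set F := freelift _.
move/in_submod_of=> /(_ (kersub F)) h.
apply/(in_submod_of (kersub_prop F))/h => y hy; apply/in_submod_of.
by case: hy => *; rewrite linearB linearP !freeliftE /= ?f_linl ?f_linr subrr.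
Qed.

Definition tlift : {linear tens M N -> P} := qlift tlift_subproof.

Lemma tliftE x y : tlift (tpure x y) = f x y.
Proof. exact: etrans (qlift_funE tlift_subproof _) (freeliftE _ _). Qed.
End TensorLift.

Lemma tens_ext M N P (f g : {linear tens M N -> P}) :
  (forall x y, f (tpure x y) = g (tpure x y)) -> f =1 g.
Proof.
move=> h z; have [w <-] := qproj_surj z.
pose pi : {linear _ -> tens M N} := qproj (spansub (@bilin_rel M N)).
have /= := @freeg_lin_ext _ _ _ (f \o pi) (g \o pi).
by apply=> -[x y]; apply: h.
Qed.

Section TensorMap.
Variables (M N M' N' : lmodType K).
Variables (f : {linear M -> M'}) (g : {linear N -> N'}).

Fact tmap_linl y : linear (fun x => tpure (f x) (g y)).
Proof. by move=> a u v; rewrite linearP tpure_linl. Qed.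
Fact tmap_linr x : linear (fun y => tpure (f x) (g y)).
Proof. by move=> a u v; rewrite linearP tpure_linr. Qed.

Definition tmap : {linear tens M N -> tens M' N'} := tlift tmap_linl tmap_linr.

Lemma tmapE x y : tmap (tpure x y) = tpure (f x) (g y).
Proof. exact: tliftE. Qed.
End TensorMap.

Lemma tmap_comp M1 M2 M3 N1 N2 N3
    (f : {linear M1 -> M2}) (f' : {linear M2 -> M3})
    (g : {linear N1 -> N2}) (g' : {linear N2 -> N3}) z :
  tmap f' g' (tmap f g z) = tmap (f' \o f) (g' \o g) z.
Proof.
rewrite -[LHS]/((tmap f' g' \o tmap f g) z); apply: tens_ext => x y.
by transitivity (tmap f' g' (tmap f g (tpure x y))) => //; rewrite !tmapE.
Qed.

Lemma eq_tmap M1 M2 N1 N2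
    (f f' : {linear M1 -> M2}) (g g' : {linear N1 -> N2}) :
  f =1 f' -> g =1 g' -> tmap f g =1 tmap f' g'.
Proof. by move=> ff gg; apply: tens_ext => x y; rewrite !tmapE ff gg. Qed.

Lemma tmap_id M N (z : tens M N) : tmap idfun idfun z = z.
Proof.
rewrite -[RHS]/((idfun : {linear _ -> _}) z).
by apply: tens_ext => x y; rewrite tmapE.
Qed.

Lemma tpure0l M N (y : N) : tpure (0 : M) y = 0.
Proof.
by have := tpure_linl y (-1) (0 : M) 0; rewrite scaler0 addr0 scaleN1r addNr.
Qed.

Lemma tpure0r M N (x : M) : tpure x (0 : N) = 0.
Proof.
by have := tpure_linr x (-1) (0 : N) 0; rewrite scaler0 addr0 scaleN1r addNr.
Qed.

Lemma tmap_0l M1 M2 N1 N2 (f : {linear M1 -> M2}) (g : {linear N1 -> N2}) z :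
  (forall x, f x = 0) -> tmap f g z = 0.
Proof.
move=> h; rewrite -[RHS]/((\0 : {linear _ -> _}) z); apply: tens_ext => x y.
by rewrite tmapE h tpure0l.
Qed.

Lemma tmap_0r M1 M2 N1 N2 (f : {linear M1 -> M2}) (g : {linear N1 -> N2}) z :
  (forall y, g y = 0) -> tmap f g z = 0.
Proof.
move=> h; rewrite -[RHS]/((\0 : {linear _ -> _}) z); apply: tens_ext => x y.
by rewrite tmapE h tpure0r.
Qed.

(* The image of S (x) T in M (x) N. *)
Definition tsub M N (S : submodClosed M) (T : submodClosed N) :
    submodClosed (tens M N) :=
  rangesub (tmap (\val : {linear subm S -> M}) (\val : {linear subm T -> N})).

End Tensor.

Section DirectSum.
Variable K : comNzRingType.
Variable M : nat -> nat -> lmodType K.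

Definition bifamily := forall k l, M k l.
HB.instance Definition _ := gen_eqMixin bifamily.
HB.instance Definition _ := gen_choiceMixin bifamily.

Definition fam_zero : bifamily := fun k l => 0.
Definition fam_opp (x : bifamily) : bifamily := fun k l => - x k l.
Definition fam_add (x y : bifamily) : bifamily := fun k l => x k l + y k l.
Definition fam_scale (a : K) (x : bifamily) : bifamily := fun k l => a *: x k l.

Lemma famP (x y : bifamily) : (forall k l, x k l = y k l) -> x = y.
Proof.
move=> h; apply: functional_extensionality_dep => k.
exact: functional_extensionality_dep.
Qed.

Fact fam_addA : associative fam_add.
Proof. by move=> x y z; apply: famP => k l; apply: addrA. Qed.
Fact fam_addC : commutative fam_add.
Proof. by move=> x y; apply: famP => k l; apply: addrC. Qed.
Fact fam_add0 : left_id fam_zero fam_add.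
Proof. by move=> x; apply: famP => k l; apply: add0r. Qed.
Fact fam_addN : left_inverse fam_zero fam_opp fam_add.
Proof. by move=> x; apply: famP => k l; apply: addNr. Qed.
HB.instance Definition _ :=
  GRing.isZmodule.Build bifamily fam_addA fam_addC fam_add0 fam_addN.

Fact fam_scaleA a b x : fam_scale a (fam_scale b x) = fam_scale (a * b) x.
Proof. by apply: famP => k l; apply: scalerA. Qed.
Fact fam_scale1 : left_id 1 fam_scale.
Proof. by move=> x; apply: famP => k l; apply: scale1r. Qed.
Fact fam_scaleDr : right_distributive fam_scale +%R.
Proof. by move=> a x y; apply: famP => k l; apply: scalerDr. Qed.
Fact fam_scaleDl x : {morph fam_scale^~ x : a b / a + b}.
Proof. by move=> a b; apply: famP => k l; apply: scalerDl. Qed.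
HB.instance Definition _ :=
  GRing.Zmodule_isLmodule.Build K bifamily
    fam_scaleA fam_scale1 fam_scaleDr fam_scaleDl.

Variable D : rel nat.

Fact supported_prop :
  submod_prop (fun x : bifamily => forall k l, ~~ D k l -> x k l = 0).
Proof.
split=> [//|a u v hu hv k l h].
by rewrite -[LHS]/(a *: u k l + v k l) hu ?hv // scaler0 addr0.
Qed.

(* The direct sum of the M k l over the pairs (k, l) with D k l, for D with
   finitely many such pairs: families vanishing off D. *)
Definition dsum : lmodType K := subm (submod_of supported_prop).

Definition component k l (x : dsum) : M k l := (\val x : bifamily) k l.

Fact component_linear k l : linear (component k l).
Proof. by move=> a x y; rewrite /component linearP. Qed.
HB.instance Definition _ k l :=
  GRing.isLinear.Build _ _ _ _ (component k l) (component_linear k l).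

Lemma component_off k l (x : dsum) : ~~ D k l -> component k l x = 0.
Proof.
exact: (proj1 (in_submod_of supported_prop (\val x)) (valP x) k l).
Qed.

Lemma dsumP (x y : dsum) : (forall k l, component k l x = component k l y) -> x = y.
Proof. by move=> h; apply/val_inj/famP. Qed.

Section Mk.
Variables (V : lmodType K) (f : forall k l, {linear V -> M k l}).
Hypothesis f_off : forall k l x, ~~ D k l -> f k l x = 0.

Definition dsum_map_fun (x : V) : dsum :=
  Subm (proj2 (in_submod_of supported_prop (fun k l => f k l x))
         (fun k l => @f_off k l x)).

Fact dsum_map_linear : linear dsum_map_fun.
Proof.
by move=> a x y; apply: dsumP => k l; rewrite linearP /component /= linearP.
Qed.
HB.instance Definition _ :=
  GRing.isLinear.Build _ _ _ _ dsum_map_fun dsum_map_linear.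
Definition dsum_map : {linear V -> dsum} := dsum_map_fun.

Lemma dsum_mapE k l x : component k l (dsum_map x) = f k l x.
Proof. by []. Qed.
End Mk.
End DirectSum.

Section Complexes.
Variable K : comNzRingType.

Record complex := Complex {
  cobj :> nat -> lmodType K;
  bd : forall n, {linear cobj n.+1 -> cobj n};
  bd_bd : forall n x, bd n (bd n.+1 x) = 0
}.

(* The differential out of degree n, which is 0 for n = 0. *)
Definition bd_out (C : complex) n : {linear C n -> C n.-1} :=
  match n return {linear C n -> C n.-1} with
  | 0 => \0
  | m.+1 => bd C m
  end.

Definition chain_map (C D : complex) (f : forall n, {linear C n -> D n}) : Prop :=
  forall n x, f n (bd C n x) = bd D n (f n.+1 x).

Section Subcomplex.
Variables (C : complex) (S : forall n, submodClosed (C n)).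
Hypothesis S_bd : forall n x, x \in S n.+1 -> bd C n x \in S n.

Fact subcomplex_bd_bd n (x : subm (S n.+2)) :
  restr (@S_bd n) (restr (@S_bd n.+1) x) = 0.
Proof. by apply/val_inj; rewrite /= bd_bd. Qed.

Definition subcomplex : complex := @Complex (fun n => subm (S n)) _ subcomplex_bd_bd.
End Subcomplex.

Section Omega.
Variables (C : complex) (D : forall n, submodClosed (C n)).

Fact omega_prop n :
  submod_prop (fun x : C n => x \in D n /\ bd_out C n x \in D n.-1).
Proof.
split=> [|a u v [u1 u2] [v1 v2]]; rewrite ?linear0 ?linearP ?rpred0 //.
by split; apply: submodL.
Qed.
Definition omega_sub n := submod_of (@omega_prop n).

Fact omega_bd n x : x \in omega_sub n.+1 -> bd C n x \in omega_sub n.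
Proof.
case/in_submod_of => _ x2; apply/in_submod_of; split; first exact: x2.
have -> : bd_out C n (bd C n x) = 0 by case: n x {x2} => [//|n] x; apply: bd_bd.
exact: rpred0.
Qed.

Definition omega : complex := subcomplex omega_bd.
End Omega.

Definition homology_at (U V W : lmodType K)
    (g : {linear U -> V}) (f : {linear V -> W}) : lmodType K :=
  quotm (presub (\val : {linear subm (kersub f) -> V}) (rangesub g)).

Definition homology (C : complex) n : lmodType K :=
  homology_at (bd C n) (bd_out C n).

Section TensorComplex.
Variables C C' : complex.
Implicit Types n k l : nat.

Definition tens_degree n : lmodType K :=
  dsum (fun k l => tens (C k) (C' l)) (fun k l => k + l == n)%N.

Definition tens_bd_fun n k l (x : tens_degree n.+1) : tens (C k) (C' l) :=
  tmap (bd C k) idfun (component k.+1 l x)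
  + (-1) ^+ k *: tmap idfun (bd C' l) (component k l.+1 x).

Fact tens_bd_linear n k l : linear (@tens_bd_fun n k l).
Proof.
move=> a x y; rewrite /tens_bd_fun !linearP scalerDr !scalerA.
exact: addrACA.
Qed.
HB.instance Definition _ n k l :=
  GRing.isLinear.Build _ _ _ _ (@tens_bd_fun n k l) (@tens_bd_linear n k l).

Fact tens_bd_off n k l x : ~~ (k + l == n)%N -> @tens_bd_fun n k l x = 0.
Proof.
move=> h; rewrite /tens_bd_fun.
rewrite [component _ _ _]component_off ?addSn ?eqSS // linear0 add0r.
by rewrite [component _ _ _]component_off ?addnS ?eqSS // linear0 scaler0.
Qed.

Definition tens_bd n : {linear tens_degree n.+1 -> tens_degree n} :=
  dsum_map (@tens_bd_off n).

Fact tens_bd_bd n x : tens_bd n (tens_bd n.+1 x) = 0.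
Proof.
apply: dsumP => k l; rewrite [RHS]linear0.
transitivity (
  tmap (bd C k) idfun (tens_bd_fun k.+1 l x)
  + (-1) ^+ k *: tmap idfun (bd C' l) (tens_bd_fun k l.+1 x)) => //.
have E1 z : tmap (bd C k) idfun (tmap (bd C k.+1) (@idfun (C' l)) z) = 0.
  by rewrite tmap_comp tmap_0l // => y; apply: bd_bd.
have E2 z : tmap idfun (bd C' l) (tmap (@idfun (C k)) (bd C' l.+1) z) = 0.
  by rewrite tmap_comp tmap_0r // => y; apply: bd_bd.
have E3 z : tmap idfun (bd C' l) (tmap (bd C k) idfun z)
          = tmap (bd C k) idfun (tmap idfun (bd C' l) z).
  by rewrite !tmap_comp; apply: eq_tmap.
have Zl c z : tmap (bd C k) (@idfun (C' l)) (c *: z)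
            = c *: tmap (bd C k) (@idfun (C' l)) z by exact: linearZZ.
have Zr c z : tmap (@idfun (C k)) (bd C' l) (c *: z)
            = c *: tmap (@idfun (C k)) (bd C' l) z by exact: linearZZ.
rewrite /tens_bd_fun 2!linearD Zl Zr E1 E2 E3 add0r !scaler0 addr0.
by rewrite exprS mulN1r scaleNr addNr.
Qed.

Definition tens_complex : complex := Complex tens_bd_bd.
End TensorComplex.

End Complexes.

Section Simplicial.
Variable K : comNzRingType.

(* The operators are indexed by nat; on the objects they are only meaningful,
   and the identities only required, in the ranges d_i : A_{n+1} -> A_n with
   i <= n+1 and s_i : A_n -> A_{n+1} with i <= n. *)
Record simplicial_module := SimplicialModule {
  sobj :> nat -> lmodType K;
  face : forall n, nat -> {linear sobj n.+1 -> sobj n};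
  degen : forall n, nat -> {linear sobj n -> sobj n.+1};
  face_face : forall n i j x, (i <= j <= n.+1)%N ->
    face n i (face n.+1 j.+1 x) = face n j (face n.+1 i x);
  degen_degen : forall n i j x, (i <= j <= n)%N ->
    degen n.+1 i (degen n j x) = degen n.+1 j.+1 (degen n i x);
  face_degen_lt : forall n i j x, (i <= j <= n)%N ->
    face n.+1 i (degen n.+1 j.+1 x) = degen n j (face n i x);
  face_degen_eq : forall n i x, (i <= n)%N -> face n i (degen n i x) = x;
  face_degen_eqS : forall n i x, (i <= n)%N -> face n i.+1 (degen n i x) = x;
  face_degen_gt : forall n i j x, (j < i <= n.+1)%N ->
    face n.+1 i.+1 (degen n.+1 j x) = degen n j (face n i x)
}.

Section Normalization.
Variable A : simplicial_module.

Definition alt_face_fun n (x : A n.+1) : A n :=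
  \sum_(i < n.+2) (-1) ^+ i *: face A n i x.

Fact alt_face_linear n : linear (@alt_face_fun n).
Proof.
move=> a x y; rewrite /alt_face_fun scaler_sumr -big_split /=.
apply: eq_bigr => i _.
by rewrite linearP scalerDr !scalerA mulrC.
Qed.
HB.instance Definition _ n :=
  GRing.isLinear.Build _ _ _ _ (@alt_face_fun n) (@alt_face_linear n).
Definition alt_face n : {linear A n.+1 -> A n} := @alt_face_fun n.

Fact alt_face_alt_face n (x : A n.+2) : alt_face n (alt_face n.+1 x) = 0.
Proof.
pose F (i j : nat) := (-1) ^+ (i + j) *: face A n i (face A n.+1 j x).
have -> : alt_face n (alt_face n.+1 x) = \sum_(i < n.+2) \sum_(j < n.+3) F i j.
  apply: eq_bigr => i _.
  rewrite linear_sum scaler_sumr; apply: eq_bigr => j _.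
  by rewrite linearZZ scalerA -exprD.
have -> : \sum_(i < n.+2) \sum_(j < n.+3) F i j =
  \sum_(i < n.+2) \sum_(j < n.+2 | (j <= i)%N) F i j +
  \sum_(i < n.+2) \sum_(j < n.+2 | (i <= j)%N) F i j.+1.
  rewrite -big_split /=; apply: eq_bigr => i _.
  rewrite (bigID (fun j : 'I_n.+3 => (j <= i)%N)) /=; congr (_ + _).
    rewrite big_mkcond big_ord_recr /= [X in _ + X]ifF ?addr0.
      by rewrite [RHS]big_mkcond.
    by apply/negP => h; have := leq_trans h (leq_ord i); rewrite ltnn.
  rewrite big_mkcond big_ord_recl /= add0r [RHS]big_mkcond /=.
  by apply: eq_bigr => j _; rewrite -ltnNge /bump /= add1n ltnS.
rewrite [X in _ + X](_ : _ = - \sum_(i < n.+2) \sum_(j < n.+2 | (j <= i)%N) F i j).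
  exact: subrr.
rewrite -sumrN (exchange_big_dep predT) //=; apply: eq_bigr => j _.
rewrite -sumrN; apply: eq_bigr => i ij.
rewrite /F addnS exprS mulN1r scaleNr addnC face_face //.
by rewrite ij -ltnS ltn_ord.
Qed.

Definition chains : complex K := Complex alt_face_alt_face.

Definition moore_cond n : A n -> Prop :=
  match n return A n -> Prop with
  | 0 => fun=> True
  | m.+1 => fun x => forall i, (0 < i <= m.+1)%N -> face A m i x = 0
  end.

Fact moore_prop n : submod_prop (@moore_cond n).
Proof.
case: n => [//|n]; split=> [i _|a u v hu hv i hi]; first exact: linear0.
by rewrite linearP hu // hv // scaler0 addr0.
Qed.
Definition moore_sub n := submod_of (@moore_prop n).

Definition degenerate n : submodClosed (A n) :=
  match n return submodClosed (A n) with
  | 0 => zerosub (A 0)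
  | m.+1 => sumsub predT (fun i : 'I_m.+1 => rangesub (degen A m i))
  end.

Lemma moore_faceE n (x : A n.+1) : x \in moore_sub n.+1 ->
  alt_face n x = face A n 0 x.
Proof.
move=> /(in_submod_of (@moore_prop n.+1)) /= h.
rewrite /alt_face /= /alt_face_fun big_ord_recl expr0 scale1r big1 ?addr0 //.
by move=> i _; rewrite lift0 h ?scaler0 //=; exact: ltn_ord i.
Qed.

Fact moore_bd n x : x \in moore_sub n.+1 -> bd chains n x \in moore_sub n.
Proof.
move=> hx; rewrite /= moore_faceE //.
move/(in_submod_of (@moore_prop n.+1)): hx => /= h.
apply/(in_submod_of (@moore_prop n)); case: n x h => [//|n] x h i /andP[i0 i1].
by rewrite -face_face ?h ?linear0 //; lia.
Qed.

Definition moore : complex K := @subcomplex K chains moore_sub moore_bd.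

Lemma degen_degenerate n i (x : A n) : (i <= n)%N ->
  degen A n i x \in degenerate n.+1.
Proof.
move=> hi; apply/(in_submod_of (sumsub_prop _ _)).
exists (fun j : 'I_n.+1 => if j == i :> nat then degen A n i x else 0).
  move=> j _; apply/(in_submod_of (rangesub_prop _)).
  by case: eqP => [->|_]; [exists x | exists 0; rewrite linear0].
rewrite (bigD1 (inord i)) //= inordK ?ltnS // eqxx big1 ?addr0 // => j /eqP nj.
by case: eqP => // ji; case: nj; apply: val_inj; rewrite /= inordK ?ltnS.
Qed.

Lemma face_degen_face n i j (y : A n.+1) : (j.+1 < i <= n.+1)%N ->
  face A n i y = 0 -> face A n i (degen A n j (face A n j.+1 y)) = 0.
Proof.
case: n i y => [|n] [|i] y // ij y0; first by exfalso; clear y0; lia.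
rewrite face_degen_gt; last by clear y0; lia.
by rewrite -face_face ?y0 ?linear0 //; clear y0; lia.
Qed.

Fact moore_degenerate_sum n (x : A n) :
  exists y : moore n, x - \val y \in degenerate n.
Proof.
case: n x => [|n] x.
  have h : x \in moore_sub 0 by apply/(in_submod_of (@moore_prop 0)).
  by exists (Subm h); apply/(in_submod_of (@zerosub_prop _ _)); rewrite /= subrr.
have H t : (t <= n.+1)%N -> exists y : A n.+1,
    x - y \in degenerate n.+1 /\
    forall i, (n.+1 - t < i <= n.+1)%N -> face A n i y = 0.
  elim: t => [|t IH] ht.
    exists x; split=> [|i]; first by rewrite subrr rpred0.
    by rewrite subn0 ltnNge => /andP[/negbTE->].
  have [y [xy hy]] := IH (ltnW ht).
  exists (y - degen A n (n - t) (face A n (n - t).+1 y)); split.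
    by rewrite opprB addrCA rpredD // degen_degenerate // leq_subr.
  move=> i hi; rewrite linearB /=.
  have [->|ij] := eqVneq i (n - t).+1.
    by rewrite face_degen_eqS ?subrr // leq_subr.
  have {}hi : ((n - t).+1 < i <= n.+1)%N by clear -ij hi ht; lia.
  have iy : face A n i y = 0 by apply: hy; clear -hi ht; lia.
  by rewrite iy face_degen_face ?subr0.
have [y [xy hy]] := H n.+1 (leqnn _).
have ym : y \in moore_sub n.+1.
  apply/(in_submod_of (@moore_prop n.+1)) => i.
  by rewrite -[0%N in X in X -> _](subnn n.+1); apply: hy.
by exists (Subm ym).
Qed.

Lemma degen_face_degen n t : (t <= n)%N -> exists b : A n -> A n,
  forall i x, (i < t)%N ->
    degen A n t (face A n t.+1 (degen A n i x)) = degen A n i (b x).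
Proof.
case: n t => [|n] [|t] // ht; [by exists id | by exists id |].
exists (fun x => degen A n t (face A n t.+1 x)) => i x it.
rewrite face_degen_gt; last by clear -it ht; lia.
by rewrite -degen_degen //; clear -it ht; lia.
Qed.

Fact moore_degenerate_disjoint n (x : A n) :
  x \in moore_sub n -> x \in degenerate n -> x = 0.
Proof.
case: n x => [|n] x; first by move=> _ /(in_submod_of (@zerosub_prop _ _)).
move=> /(in_submod_of (@moore_prop n.+1)) /= hx.
move=> xd; have [f fS] := proj1 (in_submod_of
  (sumsub_prop predT (fun i : 'I_n.+1 => rangesub (degen A n i))) x) xd.
have {fS} [a fE] : exists a : nat -> A n, forall i : 'I_n.+1, f i = degen A n i (a i).
  have h i : exists z, f i = degen A n i z.
    exact/(in_submod_of (rangesub_prop _))/fS.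
  exists (fun i => projT1 (cid (h (inord i)))) => i.
  by rewrite (inord_val i); case: cid.
under eq_bigr do rewrite fE.
rewrite -(big_mkord predT (fun i => degen A n i (a i))).
suff H t : (t <= n.+1)%N -> forall c : nat -> A n,
    x = \sum_(0 <= i < t) degen A n i (c i) -> x = 0 by exact: H.
elim: t => [|t IH] ht c xE; first by rewrite xE big_geq.
have [b hb] := @degen_face_degen n t ht.
apply: (IH (ltnW ht) (fun i => c i - b (c i))).
have := hx t.+1; rewrite ht => /(_ isT) /(congr1 (degen A n t)).
rewrite {1}xE big_nat_recr //= linearD /= face_degen_eqS // linear0.
rewrite linearD => /eqP; rewrite addrC addr_eq0 => /eqP at_.
rewrite xE big_nat_recr //= at_ linear_sum.
rewrite [degen A n t _]linear_sum -sumrB.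
by apply: eq_big_nat => i it; rewrite linearB hb.
Qed.

(* The projection along the degenerate part: rho x is the unique y in the Moore
   complex such that x - y is degenerate. *)
Definition rho_fun n (x : A n) : moore n := projT1 (cid (moore_degenerate_sum x)).

Lemma rho_funP n (x : A n) : x - \val (rho_fun x) \in degenerate n.
Proof. exact: projT2 (cid (moore_degenerate_sum x)). Qed.

Lemma rho_fun_uniq n (x : A n) (y : moore n) :
  x - \val y \in degenerate n -> rho_fun x = y.
Proof.
move=> hy; apply/val_inj/eqP; rewrite -subr_eq0; apply/eqP.
apply: moore_degenerate_disjoint.
  by apply: submodB; apply: valP.
have := submodB hy (rho_funP x).
by rewrite opprB addrC addrA addrNK addrC.
Qed.

Fact rho_linear n : linear (@rho_fun n).
Proof.
move=> a x y; apply: rho_fun_uniq; rewrite linearP addrACA -scalerDr.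
by apply: submodL; apply: rho_funP.
Qed.
HB.instance Definition _ n :=
  GRing.isLinear.Build _ _ _ _ (@rho_fun n) (@rho_linear n).
Definition rho n : {linear A n -> moore n} := @rho_fun n.

End Normalization.

Section TensorSimplicial.
Variables A A' : simplicial_module.

Definition tens_face n i : {linear tens (A n.+1) (A' n.+1) -> tens (A n) (A' n)} :=
  tmap (face A n i) (face A' n i).
Definition tens_degen n i : {linear tens (A n) (A' n) -> tens (A n.+1) (A' n.+1)} :=
  tmap (degen A n i) (degen A' n i).

Fact tens_face_face n i j x : (i <= j <= n.+1)%N ->
  tens_face n i (tens_face n.+1 j.+1 x) = tens_face n j (tens_face n.+1 i x).
Proof.
by move=> h; rewrite /tens_face !tmap_comp; apply: eq_tmap => y; apply: face_face.
Qed.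
Fact tens_degen_degen n i j x : (i <= j <= n)%N ->
  tens_degen n.+1 i (tens_degen n j x) = tens_degen n.+1 j.+1 (tens_degen n i x).
Proof.
by move=> h; rewrite /tens_degen !tmap_comp; apply: eq_tmap => y; apply: degen_degen.
Qed.
Fact tens_face_degen_lt n i j x : (i <= j <= n)%N ->
  tens_face n.+1 i (tens_degen n.+1 j.+1 x) = tens_degen n j (tens_face n i x).
Proof.
by move=> h; rewrite /tens_face /tens_degen !tmap_comp; apply: eq_tmap => y;
  apply: face_degen_lt.
Qed.
Fact tens_face_degen_eq n i x : (i <= n)%N -> tens_face n i (tens_degen n i x) = x.
Proof.
move=> h; rewrite /tens_face tmap_comp -[RHS]tmap_id.
by apply: eq_tmap => y; apply: face_degen_eq.
Qed.
Fact tens_face_degen_eqS n i x :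
  (i <= n)%N -> tens_face n i.+1 (tens_degen n i x) = x.
Proof.
move=> h; rewrite /tens_face tmap_comp -[RHS]tmap_id.
by apply: eq_tmap => y; apply: face_degen_eqS.
Qed.
Fact tens_face_degen_gt n i j x : (j < i <= n.+1)%N ->
  tens_face n.+1 i.+1 (tens_degen n.+1 j x) = tens_degen n j (tens_face n i x).
Proof.
by move=> h; rewrite /tens_face /tens_degen !tmap_comp; apply: eq_tmap => y;
  apply: face_degen_gt.
Qed.

Definition tens_simplicial : simplicial_module :=
  SimplicialModule tens_face_face tens_degen_degen tens_face_degen_lt
    tens_face_degen_eq tens_face_degen_eqS tens_face_degen_gt.
End TensorSimplicial.
End Simplicial.

Section Shuffles.

(* A (k, l)-shuffle (mu, nu) is represented by the permutation p of
   {0, .., k + l - 1} whose list of values is mu followed by nu. *)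
Definition shuffle k l (p : 'S_(k + l)) : bool :=
  [forall i : 'I_k, forall j : 'I_k,
     (i < j)%N ==> (p (lshift l i) < p (lshift l j))%N] &&
  [forall i : 'I_l, forall j : 'I_l,
     (i < j)%N ==> (p (rshift k i) < p (rshift k j))%N].

Definition shuffle_mu k l (p : 'S_(k + l)) : seq nat :=
  [seq val (p (lshift l i)) | i <- enum 'I_k].
Definition shuffle_nu k l (p : 'S_(k + l)) : seq nat :=
  [seq val (p (rshift k j)) | j <- enum 'I_l].

End Shuffles.

Section EilenbergZilber.
Variable K : comNzRingType.

Section Iterates.
Variable A : simplicial_module K.

(* The identity when m = n, and 0 otherwise. *)
Definition recast m n : {linear A m -> A n} :=
  match m =P n with
  | ReflectT e => eq_rect m (fun p => {linear A m -> A p}) idfun n e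
  | ReflectF _ => \0
  end.

(* degens [:: i_1; ..; i_r] m n is s_{i_r} ... s_{i_1} : A_m -> A_n if
   n = m + r, and 0 otherwise. *)
Fixpoint degens (s : seq nat) m n : {linear A m -> A n} :=
  if s is i :: s' then (degens s' m.+1 n \o degen A m i) else recast m n.

(* The powers d_0^k : A_{k+l} -> A_l of the first face and, below, of the last
   face, A_{l+k} -> A_k (l factors). *)
Fixpoint first_faces k l : {linear A (k + l)%N -> A l} :=
  match k return {linear A (k + l)%N -> A l} with
  | 0 => idfun
  | k'.+1 => (first_faces k' l \o face A (k' + l)%N 0%N)
  end.

Fixpoint last_faces l k : {linear A (l + k)%N -> A k} :=
  match l return {linear A (l + k)%N -> A k} with
  | 0 => idfun
  | l'.+1 => (last_faces l' k \o face A (l' + k)%N (l' + k).+1%N)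
  end.

End Iterates.

Section Maps.
Variables A A' : simplicial_module K.

Definition EZ_chains_fun n
    (x : tens_complex (chains A) (chains A') n) : chains (tens_simplicial A A') n :=
  \sum_(k < n.+1) \sum_(p : 'S_(k + (n - k)) | shuffle p)
    (-1) ^+ p *: tmap (degens A (shuffle_nu p) k n)
                      (degens A' (shuffle_mu p) (n - k) n)
                      (component k (n - k) x).

Fact EZ_chains_linear n : linear (@EZ_chains_fun n).
Proof.
move=> a x y; rewrite /EZ_chains_fun scaler_sumr -big_split; apply: eq_bigr => k _.
rewrite scaler_sumr -big_split; apply: eq_bigr => p _.
by rewrite [component _ _ _]linearP linearP scalerDr !scalerA mulrC.
Qed.
HB.instance Definition _ n :=
  GRing.isLinear.Build _ _ _ _ (@EZ_chains_fun n) (@EZ_chains_linear n).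
Definition EZ_chains n :
    {linear tens_complex (chains A) (chains A') n -> chains (tens_simplicial A A') n} :=
  @EZ_chains_fun n.

Definition AW_component n k l : {linear tens (A n) (A' n) -> tens (A k) (A' l)} :=
  tmap (last_faces A l k \o recast A n (l + k))
       (first_faces A' k l \o recast A' n (k + l)).

Fact AW_component_off n k l x : ~~ (k + l == n)%N -> AW_component n k l x = 0.
Proof.
move=> h; apply: tmap_0r => y.
have r0 : recast A' n (k + l) y = 0.
  by rewrite /recast; case: eqP => // e; rewrite -e eqxx in h.
transitivity (first_faces A' k l (recast A' n (k + l) y)) => //.
by rewrite r0 linear0.
Qed.

Definition AW_chains n :
    {linear chains (tens_simplicial A A') n -> tens_complex (chains A) (chains A') n} :=
  dsum_map (@AW_component_off n).

End Maps.

Section TensorOfMaps.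
Variables (C C' D D' : complex K).
Variables (f : forall n, {linear C n -> D n}) (f' : forall n, {linear C' n -> D' n}).

Definition tens_maps_component n k l :
    {linear tens_complex C C' n -> tens (D k) (D' l)} :=
  (tmap (f k) (f' l) \o component k l).

Fact tens_maps_off n k l x : ~~ (k + l == n)%N -> tens_maps_component n k l x = 0.
Proof. by move=> h; transitivity (tmap (f k) (f' l) (component k l x)) => //;
  rewrite component_off ?linear0. Qed.

Definition tens_maps n :
    {linear tens_complex C C' n -> tens_complex D D' n} :=
  dsum_map (@tens_maps_off n).
End TensorOfMaps.

Definition moore_incl (A : simplicial_module K) n : {linear moore A n -> A n} := \val.

Section MooreMaps.
Variables A A' : simplicial_module K.

Definition EZ n :
    {linear tens_complex (moore A) (moore A') n -> moore (tens_simplicial A A') n} :=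
  (rho (tens_simplicial A A') n \o
     (EZ_chains A A' n \o
        tens_maps (D := chains A) (D' := chains A') (moore_incl A) (moore_incl A') n)).

Definition AW n :
    {linear moore (tens_simplicial A A') n -> tens_complex (moore A) (moore A') n} :=
  (tens_maps (C := chains A) (C' := chains A') (rho A) (rho A') n \o
     (AW_chains A A' n \o moore_incl (tens_simplicial A A') n)).
End MooreMaps.

End EilenbergZilber.

Section PathPairs.
Variable K : comNzRingType.

(* The data of a path pair; the closure conditions are in [path_pair]. *)
Record module_pair := ModulePair {
  ambient : simplicial_module K;
  paths : forall n, submodClosed (ambient n)
}.

Definition path_pair (P : module_pair) : Prop :=
  (forall n i x, (i <= n)%N -> x \in paths P n ->
     degen (ambient P) n i x \in paths P n.+1) /\
  (forall n x, x \in paths P n.+1 ->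
     face (ambient P) n 0 x \in paths P n /\
     face (ambient P) n n.+1 x \in paths P n).

Definition reduced_paths (P : module_pair) n : submodClosed (moore (ambient P) n) :=
  imsub (rho (ambient P) n) (paths P n).

Definition Omega (P : module_pair) : complex K := omega (reduced_paths P).

Definition Omega_incl (P : module_pair) n :
  {linear Omega P n -> moore (ambient P) n} := \val.

Definition path_homology (P : module_pair) n : lmodType K := homology (Omega P) n.

Definition diamond (A A' : simplicial_module K)
    (B : forall n, submodClosed (A n)) (B' : forall n, submodClosed (A' n)) n :
    submodClosed (tens_simplicial A A' n) :=
  sumsub predT (fun k : 'I_n.+1 =>
    sumsub (@shuffle k (n - k)) (fun p =>
      tsub (imsub (degens A (shuffle_nu p) k n) (B k))
           (imsub (degens A' (shuffle_mu p) (n - k) n) (B' (n - k)%N)))).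

Definition box (P P' : module_pair) : module_pair :=
  ModulePair (diamond (paths P) (paths P')).

End PathPairs.

Section Tor.
Variable K : comNzRingType.

Definition free_cover (M : lmodType K) : {linear {freeg M / K} -> M} :=
  freelift (fun x : M => x).

Definition kernel_cover (V W : lmodType K) (f : {linear V -> W}) :
    {linear {freeg (subm (kersub f)) / K} -> V} :=
  (\val \o free_cover (subm (kersub f))).

(* H_1 of (F_2 -> F_1 -> F_0) (x) N, where .. -> F_2 -> F_1 -> F_0 -> M is the
   canonical free resolution: each F_i is free on the set of elements of the
   module it has to cover. *)
Definition Tor1 (M N : lmodType K) : lmodType K :=
  let d1 := kernel_cover (free_cover M) in
  let d2 := kernel_cover d1 in
  homology_at (tmap d2 (@idfun N)) (tmap d1 (@idfun N)).

End Tor.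

Definition short_exact (K : comNzRingType) (U V W : lmodType K)
    (f : {linear U -> V}) (g : {linear V -> W}) : Prop :=
  [/\ injective f, (forall v, g v = 0 <-> exists u, v = f u)
    & (forall w, exists v, w = g v)].

Definition principal_ideal_domain (K : idomainType) : Prop :=
  forall I : submodClosed K^o, exists a : K, forall x : K,
    x \in I <-> exists y : K, x = y * a.

(* Main.v *)
(* The Alexander-Whitney map is a left inverse of the Eilenberg-Zilber map on
   Moore complexes: after a shuffle (mu, nu), the front face of the first factor
   or the back face of the second is degenerate unless the shuffle is trivial.
   For the other composite, a chain x of the box product is, modulo degenerate
   elements, a sum over shuffles of (s_nu (x) s_mu) z_(mu,nu), where z_(mu,nu)
   lies in the reduced paths of degree (k, l), k + l = n.  A face d_i with i - 1
   and i in different parts of the shuffle is nondegenerate but not a shuffle,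
   and it occurs for exactly the two shuffles exchanged by (i-1 i).  If dx is
   again a sum of shuffles, the coefficients of these two must be opposite;
   hence z_(mu,nu) = sgn(mu,nu) z for a single z in each bidegree, so that
   x = epsilon z with z = alpha x.  Both z and dz are then made of reduced
   paths, and flatness places z in Omega P (x) Omega P'.

   Submodules of free modules over K are free, so complexes of free modules split
   and admit chain maps q : C -> H(C), q' : C' -> H(C').  In the Kuenneth
   sequence, the map to Tor sends a cycle x to (d (x) q') x, which lies in the
   kernel of B_i (x) H'_j -> Z_i (x) H'_j, where Z_i and B_i are the cycles and
   the boundaries of C; on the kernel of this map, q (x) q' is a bijection onto
   the sum of the H_i (x) H'_j. *)

Require Import Defs.
From HB Require Import structures.
From mathcomp Require Import all_boot fingroup perm all_algebra.
From mathcomp Require Import boolp freeg zify.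
From mathcomp Require wochoice.

Set Implicit Arguments.
Unset Strict Implicit.
Unset Printing Implicit Defensive.

Import GRing.Theory.
Local Open Scope ring_scope.

(** * Modules over a principal ideal domain *)

(** The coefficients z_(mu,nu) of a chain have to be read off in A (x) A', where no normal form is
    at hand. Shuffles are therefore turned into words: the word marks the edges collapsed in the
    first factor, the second factor collapses the complementary edges, and a face acts on words by
    merging two neighbouring letters. The operator [strip] undoes the degeneracies of one word on
    Moore elements and kills every word with a letter outside it. Applied to both factors with the
    two merged words of a shuffle, it isolates the one nondegenerate term in which two shuffles
    meet.

    Epsilon is not shown to be a chain map on the whole tensor product. On [Omega] it is the inverse
    of alpha, which is a chain map, and inherits the property. What has to be computed is that the
    boundary of epsilon z is made of reduced paths: d_0 differentiates one factor of z, and the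
    other faces vanish or cancel in pairs. *)

Section LinearMaps.
Variable K : comNzRingType.
Implicit Types U V W : lmodType K.

(** Injectivity of [i] makes the pointwise lifts unique, so choosing them one by one still gives a
    linear map. Many linear maps below are obtained in this way. *)
Lemma linear_choice U V W (i : {linear U -> V}) (f : W -> V) :
  linear f -> injective i -> (forall w, exists u, i u = f w) ->
  exists g : {linear W -> U}, forall w, i (g w) = f w.
Proof.
move=> flin iinj ex; pose g w := projT1 (cid (ex w)).
have gE w : i (g w) = f w by rewrite /g; case: cid.
have glin : linear g by move=> a x y; apply: iinj; rewrite linearP !gE flin.
pose gl : {linear W -> U} := HB.pack g (GRing.isLinear.Build K W U *:%R g glin).
by exists gl.
Qed.

Lemma linear_bij_inv U V (f : {linear U -> V}) : bijective f ->
  exists g : {linear V -> U}, cancel f g /\ cancel g f.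
Proof.
case=> g fK gK.
have [h hE] := @linear_choice U V V f id (fun _ _ _ => erefl) (can_inj fK)
  (fun w => ex_intro _ _ (gK w)).
by exists h; split=> [x|y]; [apply: (can_inj fK); rewrite hE | rewrite hE].
Qed.

Lemma inj_of_ker0 U V (f : {linear U -> V}) :
  (forall x, f x = 0 -> x = 0) -> injective f.
Proof.
by move=> h x y e; apply/eqP; rewrite -subr_eq0; apply/eqP/h; rewrite linearB e subrr.
Qed.

Lemma free_lift (F V W : lmodType K) (g : {linear V -> W}) (f : {linear F -> W}) :
  free_module F -> (forall x, exists v, g v = f x) ->
  exists h : {linear F -> V}, forall x, g (h x) = f x.
Proof.
case=> I [e /linear_bij_inv [e' [eK e'K]]] ex.
have /choice [s sE] : forall i, exists v, g v = f (e << i >>) by move=> i; apply: ex.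
have gs : g \o freelift s =1 f \o e.
  by apply: freeg_lin_ext => i; rewrite /= liftU scale1r sE.
exists (freelift s \o e') => x.
by have := gs (e' x); rewrite /= e'K.
Qed.

Lemma free_iso (U V : lmodType K) (f : {linear U -> V}) :
  bijective f -> free_module U -> free_module V.
Proof.
move=> bf [I [e be]]; exists I, (f \o e); exact: bij_comp.
Qed.
End LinearMaps.

(** * Submodules of free modules are free *)

Section FreeSubmodules.
Variable K : idomainType.
Hypothesis K_pid : principal_ideal_domain K.

(** [wochoice.well_order] says only that every nonempty set has a unique least element; totality,
    antisymmetry and transitivity come from applying this to sets of two or three elements. *)
Lemma well_order_facts (I : eqType) (R : rel I) : wochoice.well_order R ->
  [/\ total R, antisymmetric R, transitive R &
      forall P : I -> Prop, (exists x, P x) -> exists2 m, P m & forall y, P y -> R m y].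
Proof.
move=> wo.
have wf (P : I -> Prop) : (exists x, P x) -> exists2 m, P m & forall y, P y -> R m y.
  case=> x Px; have [|m [[/asboolP Pm lb] _]] := wo (fun x => `[< P x >]).
    by exists x; apply/asboolP.
  by exists m => // y Py; apply: lb; apply/asboolP.
have tot : total R.
  move=> x y; have [|m] := wf (fun z => z = x \/ z = y); first by exists x; left.
  by case=> -> h; rewrite h ?orbT //; [right | left].
have anti : antisymmetric R.
  move=> x y /andP[xy yx].
  have [|m [_ um]] := wo (pred2 x y); first by exists x; rewrite inE /= eqxx.
  have rx z : R z z by have := tot z z; rewrite orbb.
  transitivity m; [symmetry|]; apply: um; split; rewrite ?inE /= ?eqxx ?orbT //.
    by move=> z /pred2P[]->.
  by move=> z /pred2P[]->.
split=> // y x z xy yz.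
have [|m] := wf (fun t => [\/ t = x, t = y | t = z]); first by exists x; constructor.
case=> ->{m} h; first by apply: h; constructor 3.
  by rewrite (anti x y) // xy h //; constructor.
by rewrite -(anti y z) // yz h //; constructor.
Qed.

Lemma exists_maximum (I : eqType) (R : rel I) (s : seq I) :
  total R -> transitive R -> s != [::] ->
  exists2 m, m \in s & {in s, forall j, R j m}.
Proof.
move=> tot tr; case: s => // x s _; elim: s x => [|y s IH] x.
  by exists x; rewrite ?mem_head // => j; rewrite inE => /eqP->; have := tot x x; rewrite orbb.
have [m my hm] := IH y.
case/orP: (tot x m) => xm.
  by exists m; [rewrite inE my orbT | move=> j; rewrite inE => /predU1P[->|/hm]].
exists x; rewrite ?mem_head // => j; rewrite inE => /predU1P[->|/hm jm].
  by have := tot x x; rewrite orbb.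
exact: tr jm xm.
Qed.

Lemma coeffL (I : choiceType) (a : K) (x y : {freeg I / K}) i :
  coeff i (a *: x + y) = a * coeff i x + coeff i y.
Proof. by rewrite coeffD coeffZ. Qed.

Section LeadingTerms.
Variables (I : choiceType) (U : submodClosed {freeg I / K}).
Variable R : rel I.
Hypothesis R_tot : total R.
Hypothesis R_anti : antisymmetric R.
Hypothesis R_tr : transitive R.
Hypothesis R_wf :
  forall P : I -> Prop, (exists x, P x) -> exists2 m, P m & forall y, P y -> R m y.

Definition below i (x : {freeg I / K}) := forall j, coeff j x != 0 -> R j i.

Lemma leading_ideal_prop i : submod_prop (fun a : K^o =>
  exists x, [/\ x \in U, below i x & coeff i x = a]).
Proof.
split; first by exists 0; split; rewrite ?rpred0 ?coeff0 // => j; rewrite coeff0 eqxx.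
move=> a _ _ [x [xU xi <-]] [y [yU yi <-]]; exists (a *: x + y).
split; rewrite ?submodL ?coeffL // => j; rewrite coeffL => h.
have [/eqP x0|/xi//] := boolP (coeff j x == 0); apply: yi.
by move: h; rewrite x0 mulr0 add0r.
Qed.

(** [u] realises a generator of the ideal of coefficients at [i] of those elements of [U] that are
    supported up to [i]. These elements will form an echelon basis. *)
Lemma leading_element i : exists u, [/\ u \in U, below i u &
  forall x, x \in U -> below i x -> exists b, coeff i x = b * coeff i u].
Proof.
have [a ha] := K_pid (submod_of (leading_ideal_prop i)).
have /ha/asboolP [u [uU ui ua]] : exists y : K, a = y * a by exists 1; rewrite mul1r.
exists u; split=> // x xU xi; rewrite ua; apply/ha/asboolP.
by exists x.
Qed.

Let u i := projT1 (cid (leading_element i)).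
Let uU i : u i \in U. Proof. by rewrite /u; case: cid => /= x []. Qed.
Let ui i : below i (u i). Proof. by rewrite /u; case: cid => /= x []. Qed.
Let u_lead i x : x \in U -> below i x -> exists b, coeff i x = b * coeff i (u i).
Proof. by rewrite /u; case: cid => /= y [_ _ h]; apply: h. Qed.

(** The basis is indexed by those [i] whose ideal of leading coefficients is nonzero. *)
Let J := {i : I | coeff i (u i) != 0}.
Let phi : {linear {freeg J / K} -> subm U} := freelift (fun j : J => Subm (uU (val j))).

Let val_phi x : val (phi x) = \sum_(j <- dom x) coeff j x *: u (val j).
Proof.
rewrite -{1}[x]freeg_sumE !linear_sum; apply: eq_bigr => j _.
by rewrite /phi /= liftU.
Qed.

(** At the largest index [m] of the support of [x], only the term of [u m] can have a nonzero
    coefficient, and over a domain its coefficient there is nonzero. *)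
Let phi_inj : injective phi.
Proof.
apply: inj_of_ker0 => x px; apply/eqP; rewrite -dom_eq0; apply/negPn/negP => dx.
have [|||m mx hm] := @exists_maximum J (fun i j => R (val i) (val j)) (dom x) => //.
  by move=> i j k; apply: R_tr.
have /(congr1 (fun z => coeff (val m) (val z))) := px.
rewrite val_phi raddf_sum (bigD1_seq m) ?uniq_dom //= coeffZ coeff0 big_seq_cond.
rewrite big1 ?addr0 => [/eqP|j /andP[/hm jm nj]].
  by rewrite mulf_eq0 -[_ == _]negbK -mem_dom mx /= (negbTE (valP m)).
rewrite coeffZ; have [/eqP->|/ui mj] := boolP (coeff (val m) (u (val j)) == 0).
  by rewrite mulr0.
by case/eqP: nj; apply/val_inj/R_anti; rewrite jm mj.
Qed.

(** Minimal counterexample: at the least bound [m] the leading term of [z] is cancelled by a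
    multiple of [u m]. A nonzero remainder z' with largest index [j] is again a counterexample, so
    minimality gives [R m j]; but z' is supported up to [m], so j = m, where z' has coefficient
    0. *)
Let phi_below i x : x \in U -> below i x -> exists y, val (phi y) = x.
Proof.
pose P i := exists x, [/\ x \in U, below i x & forall y, val (phi y) <> x].
move=> xU xi; apply: contrapT => nx; have [|m [z [zU zm nz]] m_min] := R_wf (P := P).
  by exists i, x; split=> // y e; apply: nx; exists y.
have [b bE] := u_lead zU zm.
(* In the second case [m] lies outside [J]: the leading ideal is zero, [z] already has coefficient 0
   at [m], and nothing is subtracted. *)
have [w wE] : exists w, val (phi w) = b *: u m \/ coeff m (u m) = 0 /\ val (phi w) = 0.
  have [/eqP u0|u0] := boolP (coeff m (u m) == 0).
    by exists 0; right; rewrite linear0.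
  exists (b *: << (Sub m u0 : J) >>); left.
  by rewrite linearZ_LR /phi freeliftE /=.
pose z' := z - val (phi w).
have z'U : z' \in U by rewrite submodB // (valP (phi w)).
have z'm : below m z'.
  move=> j; rewrite /z' coeffB; case: wE => [->|[_ ->]]; last first.
    by rewrite coeff0 subr0; apply: zm.
  rewrite coeffZ; have [/eqP->|/zm//] := boolP (coeff j z == 0).
  have [/eqP->|/ui//] := boolP (coeff j (u m) == 0).
  by rewrite mulr0 subrr eqxx.
have z'0 : coeff m z' = 0.
  rewrite /z' coeffB; case: wE => [->|[u0 ->]]; first by rewrite coeffZ bE subrr.
  by rewrite bE u0 mulr0 coeff0 subrr.
have [z'E|/eqP z'n] := eqVneq z' 0.
  by apply: (nz w); apply/eqP; rewrite eq_sym -subr_eq0 -/z' z'E.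
have [|j jz jm] := exists_maximum R_tot R_tr (s := dom z').
  by rewrite dom_eq0; apply/eqP.
have mj : R m j.
  apply: m_min; exists z'; split=> // [l|y yE]; first by rewrite -mem_dom => /jm.
  by apply: (nz (y + w)); rewrite linearD /= yE /z' subrK.
have /z'm jm' : coeff j z' != 0 by rewrite -mem_dom.
by move: jz; rewrite mem_dom (R_anti (x := j) (y := m)) ?mj ?jm' // z'0 eqxx.
Qed.

Lemma well_ordered_submodule_free : free_module (subm U).
Proof.
have surj x : exists y, phi y = x.
  have [/eqP x0|x0] := boolP (dom (val x) == [::]).
    by exists 0; rewrite linear0; apply/val_inj/eqP; rewrite eq_sym -dom_eq0 x0.
  have [i _ hi] := exists_maximum R_tot R_tr x0.
  have [|y yE] := @phi_below i (val x) (valP x); last by exists y; apply: val_inj.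
  by move=> j; rewrite -mem_dom => /hi.
have /choice [g gE] := surj.
by exists J, phi, g => // y; apply: phi_inj; rewrite gE.
Qed.
End LeadingTerms.

Lemma submodule_free (F : lmodType K) (U : submodClosed F) :
  free_module F -> free_module (subm U).
Proof.
case=> I [e /linear_bij_inv [e' [eK e'K]]].
have [R Rwo] := wochoice.well_ordering_principle I.
have [tot anti tr wf] := well_order_facts Rwo.
have free_pre := well_ordered_submodule_free (presub e U) tot anti tr wf.
have eU x : x \in presub e U -> e x \in U by move/asboolP.
apply: (free_iso (f := restr eU)) free_pre.
have eU' x : x \in U -> e' x \in presub e U by move=> xU; apply/asboolP; rewrite e'K.
by exists (restr eU') => x; apply: val_inj; rewrite /= ?eK ?e'K.
Qed.
End FreeSubmodules.

(** * Exactness properties of the tensor product *)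

Section TensorExactness.
Variable K : comNzRingType.
Implicit Types M N S : lmodType K.

Definition tpurel_fun M N (y : N) (x : M) : tens M N := tpure x y.
Definition tpurer_fun M N (x : M) (y : N) : tens M N := tpure x y.
HB.instance Definition _ M N (y : N) :=
  GRing.isLinear.Build _ _ _ _ (@tpurel_fun M N y) (@tpure_linl K M N y).
HB.instance Definition _ M N (x : M) :=
  GRing.isLinear.Build _ _ _ _ (@tpurer_fun M N x) (@tpure_linr K M N x).
Definition tpurel M N (y : N) : {linear M -> tens M N} := tpurel_fun y.
Definition tpurer M N (x : M) : {linear N -> tens M N} := tpurer_fun x.

Lemma tpureZl M N a (x : M) (y : N) : tpure (a *: x) y = a *: tpure x y.
Proof. exact: (linearZ_LR (tpurel M y)). Qed.
Lemma tpureZr M N a (x : M) (y : N) : tpure x (a *: y) = a *: tpure x y.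
Proof. exact: (linearZ_LR (tpurer N x)). Qed.

Lemma tpureBl M N (x x' : M) (y : N) : tpure (x - x') y = tpure x y - tpure x' y.
Proof. exact: (linearB (tpurel M y)). Qed.
Lemma tpureBr M N (x : M) (y y' : N) : tpure x (y - y') = tpure x y - tpure x y'.
Proof. exact: (linearB (tpurer N x)). Qed.

Lemma tens_ind M N (P : tens M N -> Prop) :
  (forall x y, P (tpure x y)) ->
  (forall a u v, P u -> P v -> P (a *: u + v)) -> forall z, P z.
Proof.
move=> Ppure Plin z; have [w <-] := qproj_surj z.
have P0 : P 0 by rewrite -(tpure0l M (0 : N)).
rewrite -[w]freeg_sumE linear_sum; apply: big_ind => // [x y Px Py|i _].
  by rewrite -[x]scale1r; apply: Plin.
have -> : << coeff i w *g i >> = coeff i w *: (<< i >> : {freeg (M * N)%type / K}).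
  by apply/eqP/freeg_eqP => j; rewrite coeffZ !coeffU mul1r.
have := Plin (coeff i w) (tpure i.1 i.2) 0 (Ppure _ _) P0.
by rewrite addr0 linearZ_LR; case: i.
Qed.

Lemma tmap_compE (M1 M2 M3 N1 N2 N3 : lmodType K)
    (f : {linear M1 -> M2}) (f' : {linear M2 -> M3}) (f'' : {linear M1 -> M3})
    (g : {linear N1 -> N2}) (g' : {linear N2 -> N3}) (g'' : {linear N1 -> N3}) z :
  (forall x, f' (f x) = f'' x) -> (forall y, g' (g y) = g'' y) ->
  tmap f' g' (tmap f g z) = tmap f'' g'' z.
Proof. by move=> hf hg; rewrite tmap_comp; apply: eq_tmap. Qed.

Lemma tmap_idE M N (f : {linear M -> M}) (g : {linear N -> N}) z :
  (forall x, f x = x) -> (forall y, g y = y) -> tmap f g z = z.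
Proof. by move=> hf hg; rewrite -[RHS]tmap_id; apply: eq_tmap. Qed.

Lemma tmap_surj (M M' N N' : lmodType K) (f : {linear M -> M'}) (g : {linear N -> N'}) :
  (forall x, exists y, f y = x) -> (forall x, exists y, g y = x) ->
  forall z, exists w, tmap f g w = z.
Proof.
move=> hf hg; apply: tens_ind => [x y|a _ _ [u <-] [v <-]].
  by have [x' <-] := hf x; have [y' <-] := hg y; exists (tpure x' y'); rewrite tmapE.
by exists (a *: u + v); rewrite linearP.
Qed.

Fact tswap_linl M N (y : N) : linear (fun x : M => tpure y x).
Proof. exact: tpure_linr. Qed.
Fact tswap_linr M N (x : M) : linear (fun y : N => tpure y x).
Proof. exact: tpure_linl. Qed.
Definition tswap M N : {linear tens M N -> tens N M} :=
  tlift (@tswap_linl M N) (@tswap_linr M N).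

Lemma tswapE M N (x : M) (y : N) : tswap M N (tpure x y) = tpure y x.
Proof. exact: tliftE. Qed.

Lemma tswapK M N (z : tens M N) : tswap N M (tswap M N z) = z.
Proof.
by elim/tens_ind: z => [x y|a u v hu hv]; rewrite ?tswapE // !linearP hu hv.
Qed.

Lemma tmap_tswap (M M' N N' : lmodType K) (f : {linear M -> M'}) (g : {linear N -> N'}) z :
  tmap f g (tswap N M z) = tswap N' M' (tmap g f z).
Proof.
elim/tens_ind: z => [x y|a u v hu hv]; first by rewrite tswapE !tmapE tswapE.
by rewrite !linearP hu hv.
Qed.

Lemma freeg_sum_subset (I : choiceType) (D : {freeg I / K}) s :
  uniq s -> {subset dom D <= s} -> D = \sum_(i <- s) coeff i D *: << i >>.
Proof.
move=> us sub; apply/eqP/freeg_eqP => j; rewrite raddf_sum /=.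
under eq_bigr do rewrite coeffZ coeffU mul1r.
have [js|js] := boolP (j \in s).
  rewrite (bigD1_seq j) //= eqxx mulr1 big1 ?addr0 // => i /negbTE->.
  by rewrite mulr0.
rewrite coeff_outdom ?big_seq ?big1 // => [i si|]; last exact: contra (sub j) js.
by rewrite (_ : (i == j) = false) ?mulr0 //; apply: contraNF js => /eqP<-.
Qed.

Section Flat.
Variables (I : choiceType) (N : lmodType K).
Variables (e : {linear {freeg I / K} -> N}) (e' : {linear N -> {freeg I / K}}).
Hypothesis e'K : cancel e' e.
Variable M : lmodType K.

Fact coord_linl i y : linear (fun x : M => coeff i (e' y) *: x).
Proof. by move=> a u v; rewrite scalerDr !scalerA mulrC. Qed.
Fact coord_linr i x : linear (fun y : N => coeff i (e' y) *: (x : M)).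
Proof. by move=> a u v; rewrite linearP coeffD coeffZ scalerDl scalerA. Qed.
(** When the e << i >> form a basis of [N], M (x) N is a direct sum of copies of [M], and this is
    the coordinate at [i]. *)
Definition coord i : {linear tens M N -> M} := tlift (coord_linl i) (coord_linr i).

Lemma tens_coord (z : tens M N) : exists s : seq I,
  z = \sum_(i <- s) tpure (coord i z) (e << i >>).
Proof.
(* Every large enough list is allowed, so that the two summands of the induction step can share one
   list. *)
suff [s hs] : exists s0 : seq I, forall s, uniq s -> {subset s0 <= s} ->
    z = \sum_(i <- s) tpure (coord i z) (e << i >>).
  by exists (undup s); apply: hs; rewrite ?undup_uniq // => i; rewrite mem_undup.
elim/tens_ind: z => [x y|a u v [s hs] [t ht]].
  exists (dom (e' y)) => s us sub.
  under eq_bigr => i _ do rewrite tliftE.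
  have {1}-> : y = \sum_(i <- s) coeff i (e' y) *: e << i >>.
    rewrite -{1}[y]e'K {1}(freeg_sum_subset us sub) linear_sum.
    by apply: eq_bigr => i _; rewrite linearZ_LR.
  rewrite -[LHS]/(tpurer N x _) linear_sum; apply: eq_bigr => i _.
  by rewrite [LHS]tpureZr tpureZl.
exists (s ++ t) => w uw sub.
have sub_s : {subset s <= w} by move=> i si; apply: sub; rewrite mem_cat si.
have sub_t : {subset t <= w} by move=> i ti; apply: sub; rewrite mem_cat ti orbT.
rewrite [in LHS](hs w uw sub_s) [in LHS](ht w uw sub_t) scaler_sumr -big_split.
by apply: eq_bigr => i _; rewrite linearP tpure_linl.
Qed.
End Flat.

(** Taking coordinates commutes with [f], so each coordinate of [z] lies in the kernel of [f] and
    can be lifted on its own. *)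
Lemma flat_exactl (M M' S N : lmodType K) (f : {linear M -> M'}) (j : {linear S -> M}) :
  free_module N -> (forall x, f x = 0 -> exists s, j s = x) ->
  forall z, tmap f (@idfun N) z = 0 -> exists z', tmap j (@idfun N) z' = z.
Proof.
case=> I [e /linear_bij_inv [e' [eK e'K]]] ex z fz.
have coord_nat i w : f (coord e' M i w) = coord e' M' i (tmap f idfun w).
  elim/tens_ind: w => [x y|a u v hu hv]; last by rewrite !linearP hu hv.
  by rewrite tmapE !tliftE linearZ_LR.
have /choice [s sE] : forall i, exists s, j s = coord e' M i z.
  by move=> i; apply: ex; rewrite coord_nat fz linear0.
have [t ->] := tens_coord e'K z.
exists (\sum_(i <- t) tpure (s i) (e << i >>)); rewrite linear_sum.
by apply: eq_bigr => i _; rewrite tmapE sE.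
Qed.

Lemma flat_injl (M M' N : lmodType K) (f : {linear M -> M'}) :
  free_module N -> injective f -> injective (tmap f (@idfun N)).
Proof.
move=> fN fI; apply: inj_of_ker0 => z fz.
have ex x : f x = 0 -> exists y, (\0 : {linear M -> M}) y = x.
  by move=> fx; exists 0; apply: fI; rewrite fx; apply: (linear0 f).
have [z' <-] := flat_exactl fN ex fz.
exact: tmap_0l.
Qed.

(** Preimages under [p] define a map [psi] from M' (x) N to the quotient of M (x) N by the image [T]
    of [j], because two preimages differ by an element coming from [j]. Since [psi] after p (x) 1 is
    the projection modulo [T], the kernel of p (x) 1 lies in [T]. *)
Lemma right_exactl (M M' S N : lmodType K) (p : {linear M -> M'}) (j : {linear S -> M}) :
  (forall y, exists x, p x = y) -> (forall x, p x = 0 -> exists s, j s = x) ->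
  forall z, tmap p (@idfun N) z = 0 -> exists z', tmap j (@idfun N) z' = z.
Proof.
move=> /choice [g gE] ex z pz.
pose T := rangesub (tmap j (@idfun N)).
have jT x y : p x = 0 -> tpure x y \in T.
  by move=> /ex [s <-]; apply/asboolP; exists (tpure s y); rewrite tmapE.
have linl y : linear (fun x => qproj T (tpure (g x) y)).
  move=> a u v; rewrite -linearP; apply/qproj_eq.
  rewrite -tpure_linl -[_ - _]/(tpurel M y _ - tpurel M y _) -linearB.
  by apply: jT; rewrite linearB linearP !gE subrr.
have linr x : linear (fun y => qproj T (tpure (g x) y)).
  by move=> a u v; rewrite -linearP tpure_linr.
pose psi := tlift linl linr.
have psiE : psi (tmap p idfun z) = qproj T z.
  elim/tens_ind: (z) => [x y|a u v hu hv]; last by rewrite !linearP hu hv.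
  rewrite tmapE tliftE; apply/qproj_eq.
  rewrite -[_ - _]/(tpurel M y _ - tpurel M y _) -linearB; apply: jT.
  by rewrite linearB gE subrr.
have /qproj_eq : qproj T z = qproj T 0 by rewrite -psiE pz !linear0.
by rewrite subr0 => /asboolP [z' ->]; exists z'.
Qed.

Lemma flat_exactr (M M' S N : lmodType K) (f : {linear M -> M'}) (j : {linear S -> M}) :
  free_module N -> (forall x, f x = 0 -> exists s, j s = x) ->
  forall z, tmap (@idfun N) f z = 0 -> exists z', tmap (@idfun N) j z' = z.
Proof.
move=> fN ex z fz; have [|z' z'E] := flat_exactl fN ex (z := tswap N M z).
  by rewrite tmap_tswap fz linear0.
by exists (tswap S N z'); rewrite tmap_tswap z'E tswapK.
Qed.

Lemma flat_injr (M M' N : lmodType K) (f : {linear M -> M'}) :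
  free_module N -> injective f -> injective (tmap (@idfun N) f).
Proof.
move=> fN fI z w e; rewrite -[z]tswapK -[w]tswapK; congr (tswap _ _ _).
by apply: (flat_injl fN fI); rewrite !tmap_tswap e.
Qed.

Lemma right_exactr (M M' S N : lmodType K) (p : {linear M -> M'}) (j : {linear S -> M}) :
  (forall y, exists x, p x = y) -> (forall x, p x = 0 -> exists s, j s = x) ->
  forall z, tmap (@idfun N) p z = 0 -> exists z', tmap (@idfun N) j z' = z.
Proof.
move=> ps ex z pz; have [|z' z'E] := right_exactl ps ex (z := tswap N M z).
  by rewrite tmap_tswap pz linear0.
by exists (tswap S N z'); rewrite tmap_tswap z'E tswapK.
Qed.
End TensorExactness.

Section DsumLemmas.
Variable K : comNzRingType.

Lemma dsum_choice (M : nat -> nat -> lmodType K) (D : rel nat)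
    (P : forall k l, M k l -> Prop) :
  (forall k l, D k l -> exists y, P k l y) ->
  exists x : dsum M D, forall k l, D k l -> P k l (component k l x).
Proof.
move=> ex.
have ex' (p : nat * nat) : exists y : M p.1 p.2,
    if D p.1 p.2 then P p.1 p.2 y else y = 0.
  by have [/ex//|_] := boolP (D p.1 p.2); exists 0.
pose x k l := projT1 (cid (ex' (k, l))).
have xP k l : if D k l then P k l (x k l) else x k l = 0.
  exact: projT2 (cid (ex' (k, l))).
have xD k l : ~~ D k l -> x k l = 0 by move=> /negbTE nD; have := xP k l; rewrite nD.
exists (Subm (proj2 (in_submod_of (supported_prop M D) x) xD)) => k l Dkl.
by have := xP k l; rewrite Dkl.
Qed.

Lemma dsum_eq (M : nat -> nat -> lmodType K) (D : rel nat) (x y : dsum M D) :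
  (forall k l, D k l -> component k l x = component k l y) -> x = y.
Proof.
move=> h; apply: dsumP => k l; have [/h//|nD] := boolP (D k l).
by rewrite !component_off.
Qed.

Lemma componentB (M : nat -> nat -> lmodType K) (D : rel nat) (x y : dsum M D) k l :
  component k l (x - y) = component k l x - component k l y.
Proof. exact: (linearB (@component _ M D k l)). Qed.

Lemma tens_bdE (C C' : complex K) n (x : tens_complex C C' n.+1) k l :
  component k l (bd (tens_complex C C') n x) =
  tmap (bd C k) idfun (component k.+1 l x)
  + (-1) ^+ k *: tmap idfun (bd C' l) (component k l.+1 x).
Proof. by []. Qed.
End DsumLemmas.

Section LinIso.
Variable K : comNzRingType.
Implicit Types U V W : lmodType K.

Definition lin_iso U V := exists f : {linear U -> V}, bijective f.

Lemma lin_iso_sym U V : lin_iso U V -> lin_iso V U.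
Proof. by case=> f /linear_bij_inv [g [fK gK]]; exists g, f. Qed.

Lemma lin_iso_trans U V W : lin_iso U V -> lin_iso V W -> lin_iso U W.
Proof. by case=> f fb [g gb]; exists (g \o f); apply: bij_comp. Qed.

Lemma inj_surj_bij U V (f : {linear U -> V}) :
  (forall x, f x = 0 -> x = 0) -> (forall y, exists x, f x = y) -> bijective f.
Proof.
move=> f0 /choice [g gE]; exists g => // x.
by apply: (inj_of_ker0 f0); rewrite gE.
Qed.

Lemma quotient_iso U V (S : submodClosed U) (f : {linear U -> V}) :
  (forall x, x \in S <-> f x = 0) -> (forall y, exists x, f x = y) ->
  lin_iso (quotm S) V.
Proof.
move=> fS fsurj; have f0 x : x \in S -> f x = 0 by move/fS.
exists (qlift f0); apply: inj_surj_bij => [q|y].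
  have [x <-] := qproj_surj q; rewrite /= (qlift_funE f0) => /(proj2 (fS x)) xS.
  by rewrite -(linear0 (qproj S)); apply/qproj_eq; rewrite subr0.
by have [x <-] := fsurj y; exists (qproj S x); rewrite /= (qlift_funE f0).
Qed.
End LinIso.

(** * Cycles, boundaries and splittings of a complex *)

Section Splitting.
Variable K : comNzRingType.
Variable C : complex K.

Definition cycles n := subm (kersub (bd_out C n)).
Definition cycle_class n : {linear cycles n -> homology C n} :=
  qproj (presub (\val : {linear cycles n -> C n}) (rangesub (bd C n))).
(** Taken inside the cycles, as the kernel of the class map, so that boundaries, cycles and homology
    form a presentation of exactly the shape used by [presentation_ker]. *)
Definition bounds n := subm (kersub (cycle_class n)).

Lemma cycle_class0 n (z : cycles n) :
  cycle_class n z = 0 <-> exists x, bd C n x = val z.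
Proof.
rewrite -(linear0 (cycle_class n)); split.
  by move/qproj_eq; rewrite subr0 => /asboolP/asboolP [x ->]; exists x.
case=> x xz; apply/qproj_eq; rewrite subr0; apply/asboolP/asboolP.
by exists x.
Qed.

Lemma bd_out_bd n x : bd_out C n (bd C n x) = 0.
Proof. by case: n x => [//|n] x; apply: bd_bd. Qed.

Lemma bd_bounds_subproof n (x : C n.+1) : exists b : bounds n, val (val b) = bd C n x.
Proof.
have zP : bd C n x \in kersub (bd_out C n) by apply/asboolP/bd_out_bd.
have bP : Subm zP \in kersub (cycle_class n).
  by apply/asboolP/cycle_class0; exists x.
by exists (Subm bP).
Qed.

Lemma bd_bounds_exists n : exists f : {linear C n.+1 -> bounds n},
  forall x, val (val (f x)) = bd C n x.
Proof.
have [||//|f fE] := @linear_choice _ _ _ _ ((\val : {linear cycles n -> C n}) \o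
  (\val : {linear bounds n -> cycles n})) (bd C n).
- exact: linearP.
- by move=> x y /= /val_inj/val_inj.
- by move=> x; apply: bd_bounds_subproof.
by exists f.
Qed.
Definition bd_bounds n := projT1 (cid (bd_bounds_exists n)).
Lemma bd_boundsE n x : val (val (bd_bounds n x)) = bd C n x.
Proof. exact: (projT2 (cid (bd_bounds_exists n))). Qed.

Lemma bd_bounds_surj n (b : bounds n) : exists x, bd_bounds n x = b.
Proof.
have /cycle_class0 [x xE] : cycle_class n (val b) = 0.
  by apply/asboolP; apply: (valP b).
by exists x; do 2!apply: val_inj; rewrite bd_boundsE.
Qed.

Lemma cycle_class_surj n h : exists z, cycle_class n z = h.
Proof. exact: qproj_surj. Qed.

(** [retr] is the projection of C_n onto the cycles along the image of [section]. In degree 0 every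
    chain is a cycle, and [retr_cycle] determines it. *)
Record splitting := Splitting {
  section : forall n, {linear bounds n -> C n.+1};
  retr : forall n, {linear C n -> cycles n};
  bd_section : forall n b, bd C n (section n b) = val (val b);
  retr_cycle : forall n z, retr n (val z) = z;
  retr_bd : forall n x, val (retr n.+1 x) = x - section n (bd_bounds n x)
}.

End Splitting.

Lemma splitting_exists (K : idomainType) (C : complex K) :
  principal_ideal_domain K -> (forall n, free_module (C n)) ->
  exists s : splitting C, True.
Proof.
move=> K_pid Cfree.
have bfree n : free_module (bounds C n).
  by apply: submodule_free => //; apply: submodule_free.
have sex n : exists s : {linear bounds C n -> C n.+1}, forall b, bd_bounds C n (s b) = b.
  have [s sE] := free_lift (f := (idfun : {linear bounds C n -> _})) (bfree n)
    (@bd_bounds_surj _ C n).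
  by exists s => b; rewrite sE.
pose s n := projT1 (cid (sex n)).
have sE n b : bd C n (s n b) = val (val b).
  by rewrite -bd_boundsE /s; case: cid => /= f ->.
have rex n : exists r : {linear C n -> cycles C n},
  (forall z, r (val z) = z) /\
  match n return {linear C n -> cycles C n} -> Prop with
  | 0 => fun=> True
  | m.+1 => fun r => forall x, val (r x) = x - s m (bd_bounds C m x)
  end r.
  case: n => [|n].
    have [||x|r rE] := linear_choice (i := (\val : {linear cycles C 0 -> C 0})) (f := id).
    - by [].
    - exact: val_inj.
    - have xP : x \in kersub (bd_out C 0) by apply/asboolP.
      by exists (Subm xP).
    by exists r; split=> // z; apply: val_inj; apply: rE.
  have [||x|r rE] := linear_choice (i := (\val : {linear cycles C n.+1 -> C n.+1}))
    (f := fun x => x - s n (bd_bounds C n x)).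
  - by move=> a x y; rewrite (linearP (bd_bounds C n)) (linearP (s n)) scalerBr opprD addrACA.
  - exact: val_inj.
  - have xP : x - s n (bd_bounds C n x) \in kersub (bd_out C n.+1).
      by apply/asboolP; rewrite /= linearB sE bd_boundsE subrr.
    by exists (Subm xP).
  exists r; split=> // z; apply: val_inj; rewrite rE.
  have -> : bd_bounds C n (val z) = 0.
    do 2!apply: val_inj; rewrite bd_boundsE.
    exact: (proj1 (in_submod_of (kersub_prop _) _) (valP z)).
  by rewrite linear0 subr0.
pose r n := projT1 (cid (rex n)).
have rc n z : r n (val z) = z by rewrite /r; case: cid => /= f [].
have rb n x : val (r n.+1 x) = x - s n (bd_bounds C n x).
  by rewrite /r; case: cid => /= f [_].
by exists (Splitting sE rc rb).
Qed.

(** * Tor computed from any free presentation *)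

Section TorComparison.
Variable K : comNzRingType.
Variable N : lmodType K.

(** For [F] free and [p] onto, the long exact sequence of 0 -> ker p -> F -> M -> 0 tensored with
    [N] identifies this kernel with Tor_1(M, N). *)
Definition presentation_ker (F M : lmodType K) (p : {linear F -> M}) : lmodType K :=
  subm (kersub (tmap (\val : {linear subm (kersub p) -> F}) (@idfun N))).

Lemma kersub_val (V W : lmodType K) (f : {linear V -> W}) (x : subm (kersub f)) :
  f (val x) = 0.
Proof. exact: (proj1 (in_submod_of (kersub_prop f) _) (valP x)). Qed.

Lemma kersub_lift (V W : lmodType K) (f : {linear V -> W}) x :
  f x = 0 -> exists y : subm (kersub f), val y = x.
Proof.
move=> fx; have xP : x \in kersub f by apply/(in_submod_of (kersub_prop f)).
by exists (Subm xP).
Qed.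

Lemma freeg_free (I : choiceType) : free_module {freeg I / K}.
Proof. by exists I, idfun, idfun. Qed.

Lemma free_cover_surj (M : lmodType K) x : exists y, free_cover M y = x.
Proof. by exists << x >>; apply: freeliftE. Qed.

Lemma cover_map (F F' M : lmodType K) (p : {linear F -> M}) (p' : {linear F' -> M})
    (phi : {linear F -> F'}) : (forall x, p' (phi x) = p x) ->
  forall x, x \in kersub p -> phi x \in kersub p'.
Proof.
move=> h x /(in_submod_of (kersub_prop p)) px.
by apply/(in_submod_of (kersub_prop p')); rewrite h.
Qed.

Lemma cover_map_ker (F F' M : lmodType K) (p : {linear F -> M}) (p' : {linear F' -> M})
    (phi : {linear F -> F'}) (h : forall x, p' (phi x) = p x) z :
  z \in kersub (tmap (\val : {linear subm (kersub p) -> F}) (@idfun N)) ->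
  tmap (restr (cover_map h)) (@idfun N) z \in
    kersub (tmap (\val : {linear subm (kersub p') -> F'}) (@idfun N)).
Proof.
move=> /(in_submod_of (kersub_prop _)) pz; apply/(in_submod_of (kersub_prop _)).
transitivity (tmap phi (@idfun N)
    (tmap (\val : {linear subm (kersub p) -> F}) (@idfun N) z)).
  by rewrite !tmap_comp; apply: eq_tmap.
by rewrite pz linear0.
Qed.

(* Two lifts of the identity of M differ by a map factoring through the kernel
   of p, and the tensored factorisation vanishes on [presentation_ker]. *)
Lemma cover_map_cancel (F F' M : lmodType K) (p : {linear F -> M}) (p' : {linear F' -> M})
    (phi : {linear F -> F'}) (psi : {linear F' -> F})
    (h : forall x, p' (phi x) = p x) (h' : forall x, p (psi x) = p' x) z :
  z \in kersub (tmap (\val : {linear subm (kersub p) -> F}) (@idfun N)) ->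
  tmap (restr (cover_map h')) (@idfun N) (tmap (restr (cover_map h)) (@idfun N) z) = z.
Proof.
move=> /(in_submod_of (kersub_prop _)) pz.
pose i := (\val : {linear subm (kersub p) -> F}).
have [|||s sE] := linear_choice (i := i)
    (f := fun x => psi (phi x) - x).
- by move=> a x y; rewrite (linearP phi) (linearP psi) scalerBr opprD addrACA.
- exact: val_inj.
- by move=> x; apply: kersub_lift; rewrite linearB h' h subrr.
suff -> : tmap (restr (cover_map h')) (@idfun N) (tmap (restr (cover_map h)) (@idfun N) z)
   = z + tmap s (@idfun N) (tmap (\val : {linear subm (kersub p) -> F}) (@idfun N) z).
  by rewrite pz linear0 addr0.
elim/tens_ind: (z) => [x y|a u v hu hv].
  rewrite !tmapE -[RHS]/(tpurel _ y _ + tpurel _ y _) -linearD; congr (tpure _ _).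
  apply: val_inj; rewrite -[LHS]/(psi (phi (val x))).
  by rewrite -[RHS]/(val x + i (s (val x))) sE addrC subrK.
by rewrite !linearP hu hv scalerDr addrACA.
Qed.

Lemma presentation_ker_iso (F F' M : lmodType K) (p : {linear F -> M}) (p' : {linear F' -> M}) :
  free_module F -> free_module F' ->
  (forall y, exists x, p x = y) -> (forall y, exists x, p' x = y) ->
  lin_iso (presentation_ker p) (presentation_ker p').
Proof.
move=> fF fF' ps ps'.
have [phi h] := free_lift (g := p') (f := p) fF (fun x => ps' _).
have [psi h'] := free_lift (g := p) (f := p') fF' (fun x => ps _).
exists (restr (cover_map_ker h)), (restr (cover_map_ker h')).
  by move=> z; apply: val_inj; apply: cover_map_cancel; apply: valP.
by move=> z; apply: val_inj; apply: cover_map_cancel; apply: valP.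
Qed.

(** By right exactness the cokernel of F_2 (x) N -> F_1 (x) N is R (x) N, where R is the kernel of
    F_0 -> M. Hence H_1 is the kernel of R (x) N -> F_0 (x) N. *)
Lemma Tor1_canonical_iso (M : lmodType K) :
  lin_iso (Tor1 M N) (presentation_ker (free_cover M)).
Proof.
pose i := (\val : {linear subm (kersub (free_cover M)) -> {freeg M / K}}).
pose d1 := kernel_cover (free_cover M).
pose c := free_cover (subm (kersub (free_cover M))).
have ic x : i (c x) = d1 x by [].
have cz z : z \in kersub (tmap d1 (@idfun N)) ->
    tmap c (@idfun N) z \in kersub (tmap i (@idfun N)).
  move=> /(in_submod_of (kersub_prop _)) dz; apply/(in_submod_of (kersub_prop _)).
  by rewrite -[RHS]dz; apply: tmap_compE.
apply: (quotient_iso (f := restr cz)) => [z|w].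
  split=> [/(in_submod_of (presub_prop _ _))/(in_submod_of (rangesub_prop _)) [w wE]|rz].
    apply: val_inj; rewrite -[LHS]/(tmap c (@idfun N) (val z)) wE tmap_comp; apply: tmap_0l => x.
    by apply: val_inj; rewrite -[LHS]/(d1 _); apply: kersub_val.
  apply/(in_submod_of (presub_prop _ _))/(in_submod_of (rangesub_prop _)).
  have ker_c x : c x = 0 -> exists w, kernel_cover d1 w = x.
    move=> cx; have [|y <-] := @kersub_lift _ _ d1 x; first by rewrite -ic cx linear0.
    by have [w <-] := free_cover_surj y; exists w.
  have [|w wE] := right_exactl (@free_cover_surj _) ker_c (z := val z).
    by have := congr1 val rz.
  by exists w; apply: esym.
have [v vE] := tmap_surj (f := c) (g := @idfun N) (@free_cover_surj _)
  (fun x => ex_intro _ x erefl) (val w).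
have [|z zE] := @kersub_lift _ _ (tmap d1 (@idfun N)) v.
  transitivity (tmap i (@idfun N) (val w)); last exact: kersub_val.
  by rewrite -vE; symmetry; apply: tmap_compE.
by exists z; apply: val_inj; rewrite -[LHS]/(tmap c (@idfun N) (val z)) zE.
Qed.

Lemma Tor1_iso (F M : lmodType K) (p : {linear F -> M}) :
  free_module F -> (forall y, exists x, p x = y) -> lin_iso (presentation_ker p) (Tor1 M N).
Proof.
move=> fF ps; apply: lin_iso_trans (lin_iso_sym (Tor1_canonical_iso M)).
by apply: presentation_ker_iso => //; [exact: freeg_free | exact: free_cover_surj].
Qed.
End TorComparison.

(** * The Kuenneth sequence *)

Section SplittingTheory.
Variable K : comNzRingType.
Variables (C : complex K) (s : splitting C).

Definition homology_proj n : {linear C n -> homology C n} :=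
  cycle_class C n \o retr s n.

Lemma homology_proj_cycle n z : homology_proj n (val z) = cycle_class C n z.
Proof. by rewrite /homology_proj /= retr_cycle. Qed.

Lemma homology_proj_bd n x : homology_proj n (bd C n x) = 0.
Proof. by rewrite -bd_boundsE homology_proj_cycle kersub_val. Qed.

Lemma bd_bounds_section n b : bd_bounds C n (section s n b) = b.
Proof. by do 2!apply: val_inj; rewrite bd_boundsE bd_section. Qed.

Lemma homology_proj_section n b : homology_proj n.+1 (section s n b) = 0.
Proof.
rewrite /homology_proj /= (_ : retr s n.+1 _ = 0) ?linear0 //.
by apply: val_inj; rewrite retr_bd bd_bounds_section subrr.
Qed.

Lemma homology_proj_surj n h : exists x, homology_proj n x = h.
Proof.
by have [z <-] := cycle_class_surj h; exists (val z); apply: homology_proj_cycle.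
Qed.

Lemma bd_bounds_cycle n (z : cycles C n.+1) : bd_bounds C n (val z) = 0.
Proof. by do 2!apply: val_inj; rewrite bd_boundsE (kersub_val z). Qed.

Lemma retr0 (x : C 0%N) : val (retr s 0 x) = x.
Proof.
have [//|z <-] := @kersub_lift _ _ _ (bd_out C 0) x.
by rewrite retr_cycle.
Qed.

Definition acyclic_part n := subm (kersub (homology_proj n)).

Fact acyclic_bd n x : x \in kersub (homology_proj n.+1) ->
  bd C n x \in kersub (homology_proj n).
Proof. by move=> _; apply/(in_submod_of (kersub_prop _))/homology_proj_bd. Qed.
Definition acyclic_part_bd n : {linear acyclic_part n.+1 -> acyclic_part n} :=
  restr (@acyclic_bd n).

Fact retr_acyclic n x : x \in kersub (homology_proj n) ->
  retr s n x \in kersub (cycle_class C n).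
Proof.
by move=> /(in_submod_of (kersub_prop _)) h; apply/(in_submod_of (kersub_prop _)).
Qed.
(** A contracting homotopy of the kernel of q: on this kernel [retr] takes values in the boundaries,
    to which the section applies. *)
Definition contraction n : {linear acyclic_part n -> C n.+1} :=
  section s n \o restr (@retr_acyclic n).

Lemma bd_contraction0 (t : acyclic_part 0) : bd C 0 (contraction 0 t) = val t.
Proof. by rewrite bd_section /= retr0. Qed.

Lemma bd_contraction n (t : acyclic_part n.+1) :
  bd C n.+1 (contraction n.+1 t) + contraction n (acyclic_part_bd n t) = val t.
Proof.
rewrite bd_section /= retr_bd -addrA [X in _ + X](_ : _ = 0) ?addr0 // addrC.
apply/eqP; rewrite subr_eq0; apply/eqP; congr (section s n _).
apply: val_inj; rewrite /= -[in LHS]bd_boundsE retr_cycle.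
by [].
Qed.
End SplittingTheory.

Section TensorCycles.
Variable K : comNzRingType.
Variables C C' : complex K.
Variables (s : splitting C) (s' : splitting C').
Local Notation CC := (tens_complex C C').
Local Notation q := (homology_proj s).
Local Notation q' := (homology_proj s').
Variable n : nat.

Definition tens_cycle (x : CC n) := forall i j,
  tmap (bd C i) idfun (component i.+1 j x)
  + (-1) ^+ i *: tmap idfun (bd C' j) (component i j.+1 x) = 0.

Lemma tens_cycleP (x : CC n) : bd_out CC n x = 0 <-> tens_cycle x.
Proof.
move: x; rewrite /tens_cycle; case: n => [|m] x; split=> //.
- by move=> _ i j; rewrite !component_off ?addnS // !linear0 ?scaler0 addr0.
- by move=> e i j; rewrite -tens_bdE -[LHS]/(component i j (bd_out CC m.+1 x)) e linear0.
- by move=> h; apply: dsumP => i j; rewrite [RHS]linear0; apply: h.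
Qed.

(** The cycle condition turns (d (x) 1) x into a multiple of (1 (x) d') x, which q' kills, so (d (x)
    q') x is zero in C_i (x) H'_j. The cycles are a retract of C_i, hence it is zero already in Z_i
    (x) H'_j. In B_i (x) H'_j it may survive, and there it is the Tor class. *)
Lemma tens_cycle_ker (x : CC n) i j : tens_cycle x ->
  tmap (\val : {linear bounds C i -> cycles C i}) idfun
    (tmap (bd_bounds C i) (q' j) (component i.+1 j x)) = 0.
Proof.
move=> /(_ i j) xc.
pose vC := (\val : {linear cycles C i -> C i}).
apply: (can_inj (f := tmap vC idfun) (g := tmap (retr s i) idfun)) => [z|].
  by rewrite tmap_comp; apply: tmap_idE => // y; apply: retr_cycle.
rewrite linear0.
transitivity (tmap idfun (q' j) (tmap (bd C i) idfun (component i.+1 j x))).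
  by rewrite !tmap_comp; apply: eq_tmap => // y; apply: bd_boundsE.
move/eqP: xc; rewrite addr_eq0 => /eqP->; rewrite linearN linearZ_LR.
rewrite tmap_comp tmap_0r ?scaler0 ?oppr0 // => y.
exact: homology_proj_bd.
Qed.

Lemma tens_ker_bd (w : CC n.+1) i j :
  tmap (bd_bounds C i) (q' j) (component i.+1 j (bd CC n w)) = 0.
Proof.
rewrite tens_bdE linearD linearZ_LR !tmap_comp tmap_0l ?add0r => [|x].
  by rewrite tmap_0r ?scaler0 // => y; apply: homology_proj_bd.
by do 2!apply: val_inj; rewrite bd_boundsE bd_bd.
Qed.

Lemma tens_proj_bd (w : CC n.+1) i j :
  tmap (q i) (q' j) (component i j (bd CC n w)) = 0.
Proof.
rewrite tens_bdE linearD linearZ_LR !tmap_comp tmap_0l ?add0r => [|x].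
  by rewrite tmap_0r ?scaler0 // => y; apply: homology_proj_bd.
exact: homology_proj_bd.
Qed.
End TensorCycles.

(** [f] inverts [r] on the kernel of [g]. In the Kuenneth sequence this yields the injection without
    building it on the tensor products of the homologies. *)
Lemma short_exact_of_retraction (K : comNzRingType) (U V W : lmodType K)
    (g : {linear V -> W}) (r : {linear V -> U}) :
  (forall w, exists v, g v = w) -> (forall v, g v = 0 -> r v = 0 -> v = 0) ->
  (forall u, exists v, g v = 0 /\ r v = u) ->
  exists f : {linear U -> V}, short_exact f g.
Proof.
move=> gsurj inj surj; pose i := (\val : {linear subm (kersub g) -> V}).
pose ri : {linear subm (kersub g) -> U} := r \o i.
have ri_inj : injective ri.
  apply: inj_of_ker0 => x rx; apply: val_inj; apply: inj rx; exact: kersub_val.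
have ri_surj u : exists x, ri x = u.
  have [v [gv <-]] := surj u; have [x xE] := kersub_lift gv.
  by exists x; rewrite -xE.
have [f fE] := linear_choice (f := id) (fun _ _ _ => erefl) ri_inj ri_surj.
exists (i \o f); split=> [x y /val_inj e|v|w].
- by rewrite -(fE x) e fE.
- split=> [gv|[u ->]]; last exact: kersub_val.
  have [x xE] := kersub_lift gv; exists (r v); rewrite -xE /=; congr (val _).
  by apply: ri_inj; rewrite fE.
by have [v <-] := gsurj w; exists v.
Qed.

Section Kunneth.
Variable K : idomainType.
Hypothesis K_pid : principal_ideal_domain K.
Variables C C' : complex K.
Hypothesis C_free : forall n, free_module (C n).
Variables (s : splitting C) (s' : splitting C').
Local Notation CC := (tens_complex C C').
Local Notation q := (homology_proj s).
Local Notation q' := (homology_proj s').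
Variable n : nat.
Local Notation val_cycles X i := (\val : {linear cycles X i -> X i}).
Local Notation val_bounds X i := (\val : {linear bounds X i -> cycles X i}).

(** Since [retr] is 1 - s d, the vanishing of the (d (x) q') x moves (1 (x) q') x into the image of
    Z_i (x) H'_j. The vanishing of (q (x) q') x then moves it into the image of B_i (x) H'_j, where
    it can be lifted along d. *)
Lemma tmap_fst_lift (x : CC n) i j :
  tens_cycle x ->
  (forall i' j', tmap (bd_bounds C i') (q' j') (component i'.+1 j' x) = 0) ->
  tmap (q i) (q' j) (component i j x) = 0 ->
  exists w, tmap (bd C i) (q' j) w = tmap idfun (q' j) (component i j x).
Proof.
move=> xc xg xr; pose y := tmap (@idfun (C i)) (q' j) (component i j x).
have yE : tmap (val_cycles C i \o retr s i) idfun y = y.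
  rewrite /y; case: i xr y => [|i] xr _.
    by apply: tmap_idE => // z; apply: retr0.
  have E z : tmap (val_cycles C i.+1 \o retr s i.+1) (@idfun (homology C' j)) z
    = z - tmap (section s i \o bd_bounds C i) idfun z.
    elim/tens_ind: z => [a b|a u v hu hv].
      rewrite !tmapE -[RHS]/(tpurel _ b _ - tpurel _ b _) -linearB.
      by congr (tpure _ _); apply: retr_bd.
    by rewrite !linearP hu hv /= scalerDr addrACA.
  rewrite E (_ : tmap _ _ (tmap _ _ _) =
    tmap (section s i) idfun (tmap (bd_bounds C i) (q' j) (component i.+1 j x))).
    by rewrite xg linear0 subr0.
  by rewrite !tmap_comp; apply: eq_tmap.
have [|t tE] := right_exactl (@cycle_class_surj _ C i) (@kersub_lift _ _ _ (cycle_class C i))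
  (z := tmap (retr s i) idfun y).
  by rewrite -[RHS]xr /y !tmap_comp; apply: eq_tmap.
have [w wE] := tmap_surj (@bd_bounds_surj _ C i) (@homology_proj_surj _ _ s' j) t.
exists w; rewrite -/y -yE.
transitivity (tmap (val_cycles C i) idfun (tmap (retr s i) (@idfun (homology C' j)) y)).
  rewrite -tE -wE !tmap_comp; apply: eq_tmap => // z.
  by rewrite /= bd_boundsE.
by rewrite tmap_comp; apply: eq_tmap.
Qed.

(** By flatness of C_i, [x] comes from C (x) ker q'. There 1 (x) h, with h the contraction of ker
    q', produces a chain bounded by [x]. *)
Lemma acyclic_tens_cycle (x : CC n) : tens_cycle x ->
  (forall i j, tmap idfun (q' j) (component i j x) = 0) ->
  exists w, bd CC n w = x.
Proof.
move=> xc x0.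
pose vT j := (\val : {linear acyclic_part s' j -> C' j}).
have [|xt xtE'] := @dsum_choice _ (fun i j => tens (C i) (acyclic_part s' j))
  (fun i j => i + j == n)%N (fun i j y => tmap idfun (vT j) y = component i j x).
  move=> i j _; apply: flat_exactr (x0 i j) => //.
  exact: (@kersub_lift _ _ _ (q' j)).
have xtE i j : tmap idfun (vT j) (component i j xt) = component i j x.
  by have [/xtE'//|nD] := boolP (i + j == n)%N; rewrite !component_off // linear0.
have xtc i j : tmap (bd C i) idfun (component i.+1 j xt) =
    - ((-1) ^+ i *: tmap idfun (acyclic_part_bd s' j) (component i j.+1 xt)).
  apply: (@flat_injr _ _ _ _ (vT j) (C_free i)); first exact: val_inj.
  apply/eqP; rewrite linearN linearZ_LR -addr_eq0; apply/eqP.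
  rewrite -[RHS](xc i j) -!xtE !tmap_comp; congr (_ + _ *: _); exact: eq_tmap.
(* The sign (-1)^i cancels the one in front of 1 (x) d'. The contraction raises degrees, so nothing
   lands in j = 0. *)
have [|w wE'] := @dsum_choice _ (fun i j => tens (C i) (C' j))
  (fun i j => i + j == n.+1)%N (fun i j => match j return tens (C i) (C' j) -> Prop with
  | 0 => fun y => y = 0
  | j'.+1 => fun y => y = (-1) ^+ i *: tmap idfun (contraction s' j') (component i j' xt)
  end).
  move=> i [|j] _; first by exists 0.
  by eexists; reflexivity.
have wS i j : component i j.+1 w =
    (-1) ^+ i *: tmap idfun (contraction s' j) (component i j xt).
  have [/wE'//|nD] := boolP (i + j.+1 == n.+1)%N; rewrite !component_off //.
    by rewrite linear0 scaler0.
  by move: nD; rewrite addnS.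
have w0 i : component i 0 w = 0.
  by have [/wE'//|nD] := boolP (i + 0 == n.+1)%N; rewrite !component_off.
have sgn2 i : (-1) ^+ i * (-1) ^+ i = 1 :> K by rewrite -expr2 sqrr_sign.
exists w; apply: dsumP => i j; rewrite tens_bdE wS -xtE.
rewrite [X in _ *: X]linearZ_LR scalerA sgn2 scale1r.
case: j => [|j].
  rewrite w0 linear0 add0r tmap_comp; apply: eq_tmap => // t.
  exact: bd_contraction0.
rewrite wS linearZ_LR.
have -> : tmap (bd C i) idfun (tmap idfun (contraction s' j) (component i.+1 j xt)) =
  tmap idfun (contraction s' j) (tmap (bd C i) idfun (component i.+1 j xt)).
  by rewrite !tmap_comp; apply: eq_tmap.
rewrite xtc linearN linearZ_LR exprS mulN1r scaleNr scalerN opprK scalerA sgn2 scale1r.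
elim/tens_ind: (component _ _ _) => [a b|a u v hu hv].
  rewrite !tmapE -[LHS]/(tpurer _ a _ + tpurer _ a _) -linearD.
  by congr (tpure _ _); rewrite /= addrC; apply: bd_contraction.
by rewrite !linearP -hu -hv scalerDr addrACA.
Qed.

(** Choose [w] with (d (x) q') w = (1 (x) q') x. Then x - d w is a cycle killed by 1 (x) q', hence a
    boundary. *)
Lemma kunneth_injective (x : CC n) : tens_cycle x ->
  (forall i j, tmap (bd_bounds C i) (q' j) (component i.+1 j x) = 0) ->
  (forall i j, tmap (q i) (q' j) (component i j x) = 0) ->
  exists w, bd CC n w = x.
Proof.
move=> xc xg xr.
have [|w wE'] := @dsum_choice _ (fun i j => tens (C i) (C' j))
  (fun i j => i + j == n.+1)%N (fun i j => match i return tens (C i) (C' j) -> Prop with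
  | 0 => fun=> True
  | i'.+1 => fun y => tmap (bd C i') (q' j) y = tmap idfun (q' j) (component i' j x)
  end).
  by move=> [|i] j _; [exists 0 | apply: tmap_fst_lift].
have wE i j : tmap (bd C i) (q' j) (component i.+1 j w) =
    tmap idfun (q' j) (component i j x).
  by have [/wE'//|nD] := boolP (i.+1 + j == n.+1)%N; rewrite !component_off // !linear0.
have [||v vE] := @acyclic_tens_cycle (x - bd CC n w).
- apply/tens_cycleP; rewrite linearB bd_out_bd subr0.
  exact/tens_cycleP.
- move=> i j; rewrite componentB linearB tens_bdE linearD linearZ_LR !tmap_comp.
  rewrite [X in _ - (_ + _ *: X)]tmap_0r => [|y]; last exact: homology_proj_bd.
  rewrite scaler0 addr0 -wE; apply/eqP; rewrite subr_eq0; apply/eqP.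
  exact: eq_tmap.
by exists (v + w); rewrite linearD vE subrK.
Qed.

Lemma kunneth_proj_surjective
    (h : dsum (fun i j => tens (homology C i) (homology C' j)) (fun i j => i + j == n)%N) :
  exists x : CC n, [/\ tens_cycle x,
   forall i j, tmap (bd_bounds C i) (q' j) (component i.+1 j x) = 0 &
   forall i j, tmap (q i) (q' j) (component i j x) = component i j h].
Proof.
pose Q i j (y : tens (C i) (C' j)) := exists2 z, y = tmap (val_cycles C i) (val_cycles C' j) z
  & tmap (cycle_class C i) (cycle_class C' j) z = component i j h.
have [|x xE'] := @dsum_choice _ _ (fun i j => i + j == n)%N Q.
  move=> i j _; have [z zE] := tmap_surj (@cycle_class_surj _ C i)
    (@cycle_class_surj _ C' j) (component i j h).
  by exists (tmap (val_cycles C i) (val_cycles C' j) z); exists z.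
have xE i j : Q i j (component i j x).
  have [/xE'//|nD] := boolP (i + j == n)%N.
  by exists 0; rewrite !component_off // linear0.
exists x; split=> i j.
- have [z -> _] := xE i.+1 j; have [z' -> _] := xE i j.+1; rewrite !tmap_comp.
  rewrite tmap_0l ?tmap_0r ?scaler0 ?addr0 // => y; exact: kersub_val.
- have [z -> _] := xE i.+1 j; rewrite tmap_comp tmap_0l // => y.
  exact: bd_bounds_cycle.
have [z -> <-] := xE i j; rewrite tmap_comp.
by apply: eq_tmap => y; apply: homology_proj_cycle.
Qed.

(** Lift [t] to [w] in C (x) Z'. As [t] dies in Z_i (x) H'_j, (d (x) 1) w comes from some [u] in C_i
    (x) B'_j, and subtracting (1 (x) s') u with a sign turns [w] into a cycle. The correction is
    invisible to q', which vanishes on the image of the section s'. *)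
Lemma kunneth_tor_surjective
    (t : forall i j, tens (bounds C i) (homology C' j)) :
  (forall i j, tmap (val_bounds C i) idfun (t i j) = 0) ->
  (forall i j, ((i + j).+1 != n)%N -> t i j = 0) ->
  exists2 x : CC n, tens_cycle x &
    forall i j, tmap (bd_bounds C i) (q' j) (component i.+1 j x) = t i j.
Proof.
move=> tker toff.
pose Q i j : tens (C i) (cycles C' j) -> Prop := match i with
  | 0 => fun=> True
  | i'.+1 => fun w => tmap (bd_bounds C i') (cycle_class C' j) w = t i' j
  end.
have [|w wE'] := @dsum_choice _ _ (fun i j => i + j == n)%N Q.
  move=> [|i] j _; first by exists 0.
  exact: (tmap_surj (@bd_bounds_surj _ C i) (@cycle_class_surj _ C' j)).
have wE i j : tmap (bd_bounds C i) (cycle_class C' j) (component i.+1 j w) = t i j.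
  have [/wE'//|nD] := boolP (i.+1 + j == n)%N.
  by rewrite component_off // linear0 toff.
have uex i j : exists u, tmap (@idfun (C i)) (val_bounds C' j) u =
    tmap (bd C i) idfun (component i.+1 j w).
  apply: (right_exactr (@cycle_class_surj _ C' j) (@kersub_lift _ _ _ (cycle_class C' j))).
  transitivity (tmap (val_cycles C i) (@idfun (homology C' j))
    (tmap (val_bounds C i) idfun (t i j))); last by rewrite tker linear0.
  by rewrite -wE !tmap_comp; apply: eq_tmap => // y; rewrite /= bd_boundsE.
have [|u uE'] := @dsum_choice _ _ (fun i j => i + j.+1 == n)%N
  (fun i j u => tmap (@idfun (C i)) (val_bounds C' j) u =
    tmap (bd C i) idfun (component i.+1 j w)).
  by move=> i j _; apply: uex.
have uE i j : tmap (@idfun (C i)) (val_bounds C' j) (component i j u) =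
    tmap (bd C i) idfun (component i.+1 j w).
  have [/uE'//|nD] := boolP (i + j.+1 == n)%N.
  by rewrite !component_off ?linear0 // addSn -addnS.
(* C_i is flat, so B'_j -> Z'_j remains injective after tensoring, and (d (x) 1) u = 0 follows from
   d d = 0. *)
have u_bd i j : tmap (bd C i) idfun (component i.+1 j u) = 0.
  apply: (@flat_injr _ _ _ _ (val_bounds C' j) (C_free i)); first exact: val_inj.
  transitivity (tmap (bd C i) (@idfun (cycles C' j))
    (tmap (@idfun (C i.+1)) (val_bounds C' j) (component i.+1 j u))).
    by rewrite !tmap_comp; apply: eq_tmap.
  by rewrite uE tmap_comp linear0; apply: tmap_0l => y; apply: bd_bd.
pose v i j : tens (C i) (C' j) := match j with
  | 0 => 0
  | j'.+1 => (-1) ^+ i *: tmap idfun (section s' j') (component i j' u)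
  end.
pose P i j y := y = tmap (@idfun (C i)) (val_cycles C' j) (component i j w) - v i j.
have [|x xE'] := @dsum_choice _ _ (fun i j => i + j == n)%N P.
  by move=> i j _; eexists; reflexivity.
have xE i j : P i j (component i j x).
  have [/xE'//|nD] := boolP (i + j == n)%N.
  rewrite /P !component_off // linear0 sub0r /v; case: j nD => [|j] nD.
    by rewrite oppr0.
  by rewrite component_off // linear0 scaler0 oppr0.
exists x => i j; rewrite !xE.
  rewrite 2!linearB; have -> : tmap (bd C i) idfun (v i.+1 j) = 0.
    rewrite /v; case: j => [|j]; first by rewrite linear0.
    rewrite linearZ_LR (_ : tmap _ _ _ = tmap idfun (section s' j)
      (tmap (bd C i) idfun (component i.+1 j u))); first by rewrite u_bd linear0 scaler0.
    by rewrite !tmap_comp; apply: eq_tmap.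
  rewrite subr0 /v linearZ_LR scalerBr scalerA -expr2 sqrr_sign scale1r.
  have -> : tmap (@idfun (C i)) (bd C' j)
      (tmap idfun (val_cycles C' j.+1) (component i j.+1 w)) = 0.
    by rewrite tmap_comp; apply: tmap_0r => y; apply: kersub_val.
  rewrite scaler0 sub0r; apply/eqP; rewrite subr_eq0; apply/eqP.
  transitivity (tmap idfun (val_cycles C' j)
    (tmap (@idfun (C i)) (val_bounds C' j) (component i j u))).
    by rewrite uE !tmap_comp; apply: eq_tmap.
  by rewrite !tmap_comp; apply: eq_tmap => // y; rewrite /= bd_section.
rewrite linearB [X in _ - X](_ : _ = 0) ?subr0.
  by rewrite -wE tmap_comp; apply: eq_tmap => // y; apply: homology_proj_cycle.
rewrite /v; case: j => [|j]; first by rewrite linear0.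
rewrite linearZ_LR tmap_comp tmap_0r ?scaler0 // => y; exact: homology_proj_section.
Qed.

Lemma kunneth : exists
    (f : {linear dsum (fun i j => tens (homology C i) (homology C' j))
                      (fun i j => i + j == n)%N -> homology CC n})
    (g : {linear homology CC n ->
            dsum (fun i j => Tor1 (homology C i) (homology C' j))
                 (fun i j => (i + j).+1 == n)%N}), short_exact f g.
Proof.
have theta_ex i j : lin_iso
    (presentation_ker (homology C' j) (cycle_class C i)) (Tor1 (homology C i) (homology C' j)).
  by apply: Tor1_iso; [exact: submodule_free | exact: cycle_class_surj].
have [theta theta_bij] : exists theta : forall i j, {linear presentation_ker
    (homology C' j) (cycle_class C i) -> Tor1 (homology C i) (homology C' j)},
    forall i j, bijective (theta i j).
  exists (fun i j => projT1 (cid (theta_ex i j))) => i j.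
  exact: projT2 (cid (theta_ex i j)).
have [theta' theta'K] : exists theta' : forall i j, {linear
    Tor1 (homology C i) (homology C' j) ->
    presentation_ker (homology C' j) (cycle_class C i)},
    forall i j, cancel (theta' i j) (theta i j).
  exists (fun i j => projT1 (cid (linear_bij_inv (theta_bij i j)))) => i j.
  by have [_ h] := projT2 (cid (linear_bij_inv (theta_bij i j))).
have cyc (x : cycles CC n) : tens_cycle (val x).
  exact/tens_cycleP/kersub_val.
have G_ex i j : exists G : {linear cycles CC n ->
     presentation_ker (homology C' j) (cycle_class C i)},
   forall x, val (G x) = tmap (bd_bounds C i) (q' j) (component i.+1 j (val x)).
  pose F : {linear cycles CC n -> tens (bounds C i) (homology C' j)} :=
    tmap (bd_bounds C i) (q' j) \o (component i.+1 j \o (\val : {linear cycles CC n -> CC n})).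
  pose v := (\val : {linear presentation_ker (homology C' j) (cycle_class C i)
                     -> tens (bounds C i) (homology C' j)}).
  have Fker x : exists y, v y = F x by apply: kersub_lift; exact: (tens_cycle_ker s s' i j (cyc x)).
  have Flin : linear F by exact: linearP.
  have vinj : injective v by exact: val_inj.
  have [G GE] := linear_choice Flin vinj Fker.
  by exists G.
have {G_ex} [G GE] : exists G : forall i j, {linear cycles CC n ->
     presentation_ker (homology C' j) (cycle_class C i)},
   forall i j x, val (G i j x) = tmap (bd_bounds C i) (q' j) (component i.+1 j (val x)).
  exists (fun i j => projT1 (cid (G_ex i j))) => i j.
  exact: projT2 (cid (G_ex i j)).
have G_off i j x : ~~ ((i + j).+1 == n)%N -> (theta i j \o G i j) x = 0.
  move=> nD; rewrite -[LHS]/(theta i j (G i j x)).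
  have -> : G i j x = 0.
    apply: val_inj; rewrite GE component_off //.
    exact: linear0.
  exact: linear0.
pose g0 := dsum_map G_off.
have g0_ker x : g0 x = 0 ->
    forall i j, tmap (bd_bounds C i) (q' j) (component i.+1 j (val x)) = 0.
  move=> gx i j; rewrite -GE (_ : G i j x = 0) //.
  apply: (bij_inj (theta_bij i j)).
  exact: etrans (congr1 (component i j) gx) (esym (linear0 (theta i j))).
have R_off i j x : ~~ (i + j == n)%N ->
    (tmap (q i) (q' j) \o (component i j \o (\val : {linear cycles CC n -> CC n}))) x = 0.
  move=> nD; rewrite -[LHS]/(tmap (q i) (q' j) (component i j (val x))).
  by rewrite component_off //; apply: linear0.
pose r0 := dsum_map R_off.
have bd_cycle (x : cycles CC n) (P : CC n -> Prop) : (forall w, P (bd CC n w)) ->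
    x \in presub (\val : {linear cycles CC n -> CC n}) (rangesub (bd CC n)) -> P (val x).
  by move=> Pbd /(in_submod_of (presub_prop _ _))/(in_submod_of (rangesub_prop _)) [w ->].
have g0_bd x : x \in presub (\val : {linear cycles CC n -> CC n}) (rangesub (bd CC n)) ->
    g0 x = 0.
  move=> xb; apply: dsumP => i j; rewrite -[LHS]/(theta i j (G i j x)).
  have -> : G i j x = 0; last exact: linear0.
  apply: val_inj; rewrite GE.
  exact: (bd_cycle x (fun w => tmap (bd_bounds C i) (q' j) (component i.+1 j w) = 0)
    (fun w => tens_ker_bd s' w i j) xb).
have r0_bd x : x \in presub (\val : {linear cycles CC n -> CC n}) (rangesub (bd CC n)) ->
    r0 x = 0.
  move=> xb; apply: dsumP => i j.
  rewrite -[LHS]/(tmap (q i) (q' j) (component i j (val x))).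
  exact: (bd_cycle x (fun w => tmap (q i) (q' j) (component i j w) = 0)
    (fun w => tens_proj_bd s s' w i j) xb).
have [gq gE] : exists gq : {linear homology CC n -> dsum
      (fun i j => Tor1 (homology C i) (homology C' j)) (fun i j => (i + j).+1 == n)%N},
    forall x, gq (cycle_class CC n x) = g0 x.
  by exists (qlift g0_bd) => x; apply: qlift_funE.
have [rq rE] : exists rq : {linear homology CC n -> dsum
      (fun i j => tens (homology C i) (homology C' j)) (fun i j => i + j == n)%N},
    forall x, rq (cycle_class CC n x) = r0 x.
  by exists (qlift r0_bd) => x; apply: qlift_funE.
suff [f fE] : exists f : {linear dsum (fun i j => tens (homology C i) (homology C' j))
    (fun i j => i + j == n)%N -> homology CC n}, short_exact f gq by exists f, gq.
apply: (short_exact_of_retraction (r := rq)).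
- move=> y.
  pose t i j := val (theta' i j (component i j y)).
  have [||x xc xE] := @kunneth_tor_surjective t.
  + by move=> i j; apply: kersub_val.
  + by move=> i j nD; rewrite /t component_off // linear0.
  have [z zE] := @kersub_lift _ _ _ (bd_out CC n) x (proj2 (tens_cycleP x) xc).
  exists (cycle_class CC n z); rewrite gE; apply: dsumP => i j.
  rewrite -[LHS]/(theta i j (G i j z)).
  have -> : G i j z = theta' i j (component i j y).
    by apply: val_inj; rewrite GE zE xE.
  exact: theta'K.
- move=> h; have [x xE] := cycle_class_surj h; rewrite -xE gE rE => gx rx.
  apply/cycle_class0; apply: kunneth_injective; [exact: cyc | exact: g0_ker |].
  by move=> i j; rewrite -[LHS]/(component i j (r0 x)) rx linear0.
move=> h; have [x [xc xg xr]] := kunneth_proj_surjective h.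
have [z zE] := @kersub_lift _ _ _ (bd_out CC n) x (proj2 (tens_cycleP x) xc).
exists (cycle_class CC n z); rewrite gE rE; split; apply: dsumP => i j.
  rewrite -[LHS]/(theta i j (G i j z)).
  have -> : G i j z = 0; last exact: linear0.
  by apply: val_inj; rewrite GE zE xg.
by rewrite -xr -zE.
Qed.
End Kunneth.

(** * Degeneracies indexed by words *)

Section DegeneracyWords.
Local Open Scope nat_scope.
Variable K : comNzRingType.
Variable A : simplicial_module K.
Implicit Types (w S : pred nat) (i j k l m n t : nat).

Lemma recast_id n x : recast A n n x = x.
Proof. by rewrite /recast; case: eqP => // e; rewrite (eq_axiomK e). Qed.

Lemma recast_ne m n x : m != n -> recast A m n x = 0%R.
Proof. by rewrite /recast; case: eqP. Qed.

Lemma degens_rcons s i m n x :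
  degens A (rcons s i) m n.+1 x = degen A n i (degens A s m n x).
Proof.
elim: s m x => [|t s IH] m x /=; last exact: IH.
have [e|ne] := eqVneq m n; last by rewrite !recast_ne ?linear0 // eqSS.
by case: n / e; rewrite !recast_id.
Qed.

Lemma degens_size s m n x : m + size s != n -> degens A s m n x = 0%R.
Proof.
elim: s m x => [|t s IH] m x /=; first by rewrite addn0; apply: recast_ne.
by rewrite addnS -addSn; apply: IH.
Qed.

(* The word w marks the edges t -> t + 1 of a simplex that are collapsed;
   [wdegens w j k n] is 0 unless k + #{t < j | w t} = n. *)
Definition wdegens w j k n : {linear A k -> A n} :=
  degens A [seq t <- iota 0 j | w t] k n.
Definition wcount w j := count w (iota 0 j).

Lemma iotaS_rcons j : iota 0 j.+1 = rcons (iota 0 j) j.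
Proof. by rewrite -addn1 iotaD cats1. Qed.

Lemma wcountS w j : wcount w j.+1 = (w j + wcount w j)%N.
Proof. by rewrite /wcount iotaS_rcons -cats1 count_cat /= addn0 addnC. Qed.

Lemma wcount_le w j : (wcount w j <= j)%N.
Proof. by rewrite /wcount (leq_trans (count_size _ _)) ?size_iota. Qed.

Lemma wdegensT w j k n x : w j ->
  wdegens w j.+1 k n.+1 x = degen A n j (wdegens w j k n x).
Proof. by move=> wj; rewrite /wdegens iotaS_rcons filter_rcons wj degens_rcons. Qed.

Lemma wdegensF w j k n x : ~~ w j -> wdegens w j.+1 k n x = wdegens w j k n x.
Proof. by move=> wj; rewrite /wdegens iotaS_rcons filter_rcons (negbTE wj). Qed.

Lemma wdegens_off w j k n x : k + wcount w j != n -> wdegens w j k n x = 0%R.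
Proof. by move=> h; apply: degens_size; rewrite size_filter. Qed.

Lemma eq_wdegens w w' j k n x : (forall t, t < j -> w t = w' t) ->
  wdegens w j k n x = wdegens w' j k n x.
Proof.
move=> h; rewrite /wdegens (@eq_in_filter _ _ w') // => t.
by rewrite mem_iota add0n; apply: h.
Qed.

Lemma wdegens_range w j k n t x : t < j <= n.+1 -> w t ->
  exists y, wdegens w j k n.+1 x = degen A n t y.
Proof.
elim: j n => [|j IH] n // /andP[tj jn] wt.
have [wj|wj] := boolP (w j); last first.
  rewrite wdegensF //; apply: IH => //; rewrite (ltnW jn) andbT.
  move: tj; rewrite ltnS leq_eqVlt => /predU1P[e|//].
  by rewrite -e wt in wj.
rewrite wdegensT //; move: tj; rewrite ltnS leq_eqVlt => /predU1P[->|tj].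
  by exists (wdegens w j k n x).
case: n jn => [|n] jn; first by exfalso; lia.
have [|y ->] := IH n _ wt; first by rewrite tj.
case: j tj jn {IH wj} => // j tj jn.
by rewrite -degen_degen; [eexists; reflexivity | lia].
Qed.

(** When s_t is moved to the outside, its index grows by one at each degeneracy of [w] that it
    passes from below, so it ends at an edge that [w] does not collapse. *)
Lemma wdegens_degen w j k n t x : t <= k -> j <= n.+1 -> (n = k + wcount w j)%N ->
  exists u y, [/\ u <= n, u < j -> ~~ w u &
    wdegens w j k.+1 n.+1 (degen A k t x) = degen A n u y].
Proof.
elim: j n => [|j IH] n tk jn nE.
  rewrite /wcount /= addn0 in nE; case: k / nE t x tk => t x tk.
  by exists t, x; rewrite /wdegens /= recast_id.
rewrite wcountS in nE; have [wj|wj] := boolP (w j); last first.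
  rewrite (negbTE wj) add0n in nE; have [u [y [un uj E]]] := IH n tk (ltnW jn) nE.
  exists u, y; split=> //; last by rewrite wdegensF.
  by rewrite ltnS leq_eqVlt => /predU1P[->|/uj].
rewrite wj /= add1n addnS in nE; case: n nE jn => // n [nE] jn.
have [u [y [un uj E]]] := IH n tk jn nE; rewrite wdegensT // E.
have [uj'|ju] := ltnP u j.
  case: j uj' {IH wj nE E} uj jn => // j uj' uj jn.
  exists u, (degen A n j y); split; [lia | by move=> _; apply: uj|].
  by rewrite [RHS]degen_degen //; lia.
exists u.+1, (degen A n j y); split; [lia | lia |].
by rewrite degen_degen // ju.
Qed.

(* Removing the i-th vertex merges the edges i - 1 and i. *)
Definition wdel i w : pred nat := fun t =>
  if t.+1 < i then w t else if t.+1 == i then w t && w i else w t.+1.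

(** One of the edges at the vertex i is collapsed. Then d_i cancels a degeneracy and leaves the
    inner element alone; otherwise d_i reaches the inner element. *)
Definition wmerge i j w := (0 < i) && w i.-1 || (i < j) && w i.

Lemma face_wdegens_gt w i j k n x : j < i <= n.+1 -> (n = k + wcount w j)%N ->
  face A n i (wdegens w j k.+1 n.+1 x) = wdegens w j k n (face A k (i - wcount w j) x).
Proof.
elim: j i n => [|j IH] i n ijn nE.
  rewrite /wcount /= addn0 in nE; case: k / nE x => x.
  by rewrite /wdegens /= !recast_id subn0.
rewrite wcountS in nE *; have [wj|wj] := boolP (w j); last first.
  rewrite (negbTE wj) add0n in nE *; rewrite !wdegensF //; apply: IH => //; lia.
rewrite wj /= add1n in nE *; rewrite addnS in nE; case: n nE ijn => // n [nE] ijn.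
case: i ijn => // i ijn.
rewrite !wdegensT // face_degen_gt; last lia.
by rewrite IH //; lia.
Qed.

Lemma wdel_ge i t w : i <= t -> wdel i w t = w t.+1.
Proof. by move=> it; rewrite /wdel !ifF //; lia. Qed.

Lemma wdel_lt i t w : t.+1 < i -> wdel i w t = w t.
Proof. by rewrite /wdel => ->. Qed.

Lemma wdel_eq t w : wdel t.+1 w t = w t && w t.+1.
Proof. by rewrite /wdel ltnn eqxx. Qed.

Lemma face_wdegens_merge w i j k n x : i <= j <= n.+1 -> wmerge i j w ->
  face A n i (wdegens w j k n.+1 x) = wdegens (wdel i w) j.-1 k n x.
Proof.
elim: j n => [|j IH] n ijn mij /=.
  by move: mij ijn; rewrite /wmerge; case: i.
have [wj|wj] := boolP (w j).
  rewrite wdegensT //; have [ij|ji|ij] := ltngtP i j; last first.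
  - rewrite ij face_degen_eq; last lia.
    apply: eq_wdegens => t tj; have [tj'|tj'] := ltnP t.+1 j; first by rewrite wdel_lt.
    by have -> : j = t.+1 by [lia]; rewrite wdel_eq; have -> : t.+1 = j by [lia]; rewrite wj andbT.
  - have -> : i = j.+1 by lia.
    rewrite face_degen_eqS; last lia.
    by apply: eq_wdegens => t tj; rewrite wdel_lt.
  case: j IH ij wj mij ijn => // j IH ij wj mij ijn.
  case: n ijn => [|n] ijn; first lia.
  rewrite face_degen_lt; last lia.
  rewrite IH; last 2 first.
  - lia.
  - by move: mij; rewrite /wmerge ij (ltn_trans ij).
  by rewrite wdegensT // wdel_ge.
rewrite wdegensF //; have [ij|ij] := leqP i j; last first.
  have ei : i = j.+1 by lia.
  by move: mij; rewrite /wmerge ei /= ltnn (negbTE wj).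
rewrite IH; last 2 first.
- lia.
- move: mij; rewrite /wmerge ltnS ij; move: ij; rewrite leq_eqVlt.
  by case/predU1P=> [->|->] //; rewrite (negbTE wj) !andbF.
case: j ij wj {IH mij ijn} => // j ij wj; rewrite wdegensF //.
move: ij; rewrite leq_eqVlt => /predU1P[->|ij]; first by rewrite wdel_eq (negbTE wj) andbF.
by rewrite wdel_ge.
Qed.

(** The index [i - wcount w i] is the image of the vertex i under the collapse of the edges in
    [w]. *)
Lemma face_wdegens_nomerge w i j k n x : i <= j <= n.+1 -> ~~ wmerge i j w ->
  (n = k + wcount w j)%N ->
  face A n i (wdegens w j k.+1 n.+1 x) =
  wdegens (wdel i w) j.-1 k n (face A k (i - wcount w i) x).
Proof.
elim: j n => [|j IH] n ijn mij nE /=.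
  case: i ijn mij => // _ _; rewrite /wcount /= addn0 in nE.
  by case: k / nE x => x; rewrite /wdegens /= !recast_id.
have [ij|ij] := leqP i j; last first.
  have ei : i = j.+1 by lia.
  have wj : ~~ w j by move: mij; rewrite /wmerge ei /=; case: (w j).
  rewrite wcountS (negbTE wj) add0n in nE.
  rewrite wdegensF // ei face_wdegens_gt //; last lia.
  rewrite wcountS (negbTE wj) add0n; apply: eq_wdegens => t tj.
  by rewrite wdel_lt.
have [wj|wj] := boolP (w j).
  have ij' : i < j.
    by rewrite ltn_neqAle ij andbT; apply: contraNneq mij => ->; rewrite /wmerge wj ltnSn orbT.
  rewrite wcountS wj add1n addnS in nE; case: n nE ijn => // n [nE] ijn.
  case: j IH ij ij' wj mij nE ijn => // j IH ij ij' wj mij nE ijn.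
  rewrite wdegensT // face_degen_lt; last lia.
  rewrite IH //; last 2 first.
  - lia.
  - by move: mij; rewrite /wmerge ij' (ltn_trans ij').
  by rewrite wdegensT // wdel_ge.
rewrite wdegensF // IH; last 3 first.
- lia.
- move: mij; rewrite /wmerge ltnS ij; move: ij; rewrite leq_eqVlt.
  by case/predU1P=> [->|->] //; rewrite ltnn /= orbF negb_or => /andP[].
- by move: nE; rewrite wcountS (negbTE wj).
case: j ij wj {IH mij ijn nE} => // j ij wj; rewrite wdegensF //.
move: ij; rewrite leq_eqVlt => /predU1P[->|ij]; first by rewrite wdel_eq (negbTE wj) andbF.
by rewrite wdel_ge.
Qed.

Lemma wcount_lt w j t : t < j -> ~~ w t -> wcount w j < j.
Proof.
move=> tj wt; rewrite ltn_neqAle wcount_le andbT; apply: contra wt.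
rewrite /wcount -{2}(size_iota 0 j) -all_count => /allP; apply.
by rewrite mem_iota add0n.
Qed.

(** To see that a term is killed, only the word left after the face matters; the inner element and
    its degree are forgotten. *)
Lemma face_wdegens_ex w i j k n x : i <= j <= n.+1 ->
  exists m y, face A n i (wdegens w j k n.+1 x) = wdegens (wdel i w) j.-1 m n y.
Proof.
move=> ijn; have [mij|mij] := boolP (wmerge i j w).
  by exists k, x; apply: face_wdegens_merge.
have [e|ne] := eqVneq (k + wcount w j)%N n.+1; last first.
  by exists 0, 0%R; rewrite wdegens_off // !linear0.
case: k x e => [|k] x e; last first.
  by exists k, (face A k (i - wcount w i) x); apply: face_wdegens_nomerge; lia.
(* For k = 0 the word has to collapse all n + 1 edges, which contradicts the uncollapsed edges at
   the vertex i. *)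
have ej : j = n.+1 by have := wcount_le w j; lia.
exfalso; have [ij|ij] := leqP j i.
  have : ~~ w j.-1.
    by move: mij; rewrite /wmerge (_ : i = j) ?ej /=; [case: (w n) | lia].
  by move/(@wcount_lt _ j); lia.
have wi : ~~ w i by move: mij; rewrite /wmerge ij /= negb_or => /andP[].
by have := wcount_lt ij wi; lia.
Qed.

Lemma last_facesS l k x :
  last_faces A l.+1 k x = last_faces A l k (face A (l + k) (l + k).+1 x).
Proof. by []. Qed.

Lemma first_facesS k l x :
  first_faces A k.+1 l x = first_faces A k l (face A (k + l) 0 x).
Proof. by []. Qed.

Lemma last_faces_wdegens_ex w l k m x : exists m' y,
  last_faces A l k (wdegens w (l + k) m (l + k) x) = wdegens w k m' k y.
Proof.
elim: l m x => [|l IH] m x; first by exists m, x.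
have [|m' [y E]] := @face_wdegens_ex w (l + k).+1 (l + k).+1 m (l + k) x.
  by rewrite !leqnn.
have [m'' [z E']] := IH m' y; exists m'', z.
rewrite last_facesS E -E'; congr (last_faces _ _ _ _).
by apply: eq_wdegens => t tlk; rewrite wdel_lt.
Qed.

Lemma last_faces_wdegens w l k m x : (forall t, k <= t < l + k -> w t) ->
  last_faces A l k (wdegens w (l + k) m (l + k) x) = wdegens w k m k x.
Proof.
elim: l m x => [|l IH] m x wt //; rewrite last_facesS face_wdegens_merge //; last 2 first.
- by rewrite !leqnn.
- by rewrite /wmerge /= wt // addSn ltnSn leq_addl.
rewrite -IH => [|t /andP[kt tl]]; last by rewrite wt // kt addSn ltnW.
by congr (last_faces _ _ _ _); apply: eq_wdegens => t tlk; rewrite wdel_lt.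
Qed.

Lemma first_faces_wdegens_ex w k l m x : exists m' y,
  first_faces A k l (wdegens w (k + l) m (k + l) x) =
    wdegens (fun t => w (k + t)) l m' l y.
Proof.
elim: k w m x => [|k IH] w m x; first by exists m, x.
have [|m' [y E]] := @face_wdegens_ex w 0 (k + l).+1 m (k + l) x; first by rewrite /= leqnn.
have [m'' [z E']] := IH (wdel 0 w) m' y; exists m'', z.
rewrite first_facesS E E'.
by apply: eq_wdegens => t _; rewrite wdel_ge // addSn.
Qed.

Lemma first_faces_wdegens w k l m x : (forall t, t < k -> w t) ->
  first_faces A k l (wdegens w (k + l) m (k + l) x) =
    wdegens (fun t => w (k + t)) l m l x.
Proof.
elim: k w m x => [|k IH] w m x wt //.
rewrite first_facesS face_wdegens_merge; last 2 first.
- by rewrite /= leqnn.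
- by rewrite /wmerge /= wt.
rewrite IH => [|t tk]; last by rewrite wdel_ge // wt.
by apply: eq_wdegens => t _; rewrite wdel_ge // addSn.
Qed.

Lemma wdegens_none w j n x : (forall t, t < j -> ~~ w t) -> wdegens w j n n x = x.
Proof.
elim: j => [|j IH] h; first exact: recast_id.
by rewrite wdegensF ?h //; apply: IH => t tj; apply: h; rewrite ltnW.
Qed.

Lemma rho_degenerate n x : x \in degenerate A n -> rho A n x = 0%R.
Proof. by move=> xd; apply: rho_fun_uniq; rewrite subr0. Qed.

Lemma rho_moore n (x : moore A n) : rho A n (val x) = x.
Proof. by apply: rho_fun_uniq; rewrite subrr rpred0. Qed.

Lemma wdegens_degenerate w n m x t : t < n -> w t ->
  wdegens w n m n x \in degenerate A n.
Proof.
case: n => [//|n] tn wt; have [|y ->] := @wdegens_range w n.+1 m n t x _ wt.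
  by rewrite tn leqnn.
exact: degen_degenerate.
Qed.

Lemma moore_face n i (c : moore A n.+1) : 0 < i <= n.+1 -> face A n i (val c) = 0%R.
Proof. exact: (proj1 (in_submod_of (@moore_prop K A n.+1) _) (valP c)). Qed.

Definition pface m i : {linear A m -> A m.-1} :=
  match m return {linear A m -> A m.-1} with
  | 0 => \0%R
  | m'.+1 => face A m' i
  end.

Definition codegen m t : {linear A m -> A m} :=
  match m return {linear A m -> A m} with
  | 0 => idfun
  | m'.+1 => (idfun \- (degen A m' t \o face A m' t.+1))%R
  end.

(* Going down from edge j - 1, [strip] applies d_{t+1} on the edges t in S and
   1 - s_t d_{t+1} on the others; it inverts the degeneracies in S on the Moore
   complex and kills every other degeneracy. *)
Fixpoint strip S j m k : {linear A m -> A k} :=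
  match j return {linear A m -> A k} with
  | 0 => recast A m k
  | t.+1 => match S t return {linear A m -> A k} with
            | true => strip S t m.-1 k \o pface m t.+1
            | false => strip S t m k \o codegen m t
            end
  end.

Lemma stripT S t m k x : S t -> strip S t.+1 m.+1 k x = strip S t m k (face A m t.+1 x).
Proof. by move=> /= ->. Qed.

Lemma stripF S t m k x : ~~ S t -> strip S t.+1 m.+1 k x =
  strip S t m.+1 k (x - degen A m t (face A m t.+1 x))%R.
Proof. by move=> /= /negbTE->. Qed.

(** At the edge t the factor 1 - s_t d_{t+1} annihilates s_t. At the edges above, every factor can
    be moved past s_t with shifted indices, leaving s_t in front. *)
Lemma strip_degen S j m k t x : t < j <= m.+1 -> ~~ S t ->
  strip S j m.+1 k (degen A m t x) = 0%R.
Proof.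
move=> tj St; elim: j m x tj => [//|j IH] m x tjm.
have [Sj|Sj] := boolP (S j).
  rewrite stripT //; have tj : t < j.
    by rewrite ltn_neqAle -ltnS (proj1 (andP tjm)) andbT; apply: contraNneq St => ->.
  case: m x tjm => [|m] x tjm; first by exfalso; clear -tj tjm; lia.
  rewrite face_degen_gt; last by clear -tj tjm; lia.
  by apply: IH; clear -tj tjm; lia.
rewrite stripF //; have [etj|tj] := eqVneq t j.
  by rewrite etj face_degen_eqS ?subrr ?linear0 //; clear -tjm; lia.
have {}tj : t < j by clear -tj tjm; lia.
case: m x tjm => [|m] x tjm; first by exfalso; clear -tj tjm; lia.
rewrite face_degen_gt; last by clear -tj tjm; lia.
case: j IH tj tjm {Sj} => // j IH tj tjm.
rewrite -(@degen_degen _ A m t j); last by clear -tj tjm; lia.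
by rewrite -linearB; apply: IH; clear -tj tjm; lia.
Qed.

Lemma strip_wdegens_kill S w n m k x t : t < n -> w t -> ~~ S t ->
  strip S n n k (wdegens w n m n x) = 0%R.
Proof.
case: n => [//|n] tn wt St; have [|y ->] := @wdegens_range w n.+1 m n t x _ wt.
  by rewrite tn leqnn.
by apply: strip_degen => //; rewrite tn leqnn.
Qed.

(** Outside [S] the correction s_t d_{t+1} contributes nothing: d_{t+1} passes through the remaining
    degeneracies and becomes a face of positive index on the Moore element [c]. *)
Lemma strip_wdegens S j k n (c : moore A k) : (k + wcount S j)%N = n -> j <= n ->
  strip S j n k (wdegens S j k n (val c)) = val c.
Proof.
elim: j n => [|j IH] n nE jn.
  rewrite /wcount /= addn0 in nE; case: n / nE {jn}.
  by rewrite /= /wdegens /= !recast_id.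
case: n nE jn => // n nE jn; rewrite wcountS in nE.
have [Sj|Sj] := boolP (S j).
  rewrite Sj add1n addnS in nE; case: nE => nE.
  by rewrite wdegensT // stripT // face_degen_eqS // IH.
rewrite (negbTE Sj) add0n in nE; rewrite wdegensF // stripF //.
suff -> : face A n j.+1 (wdegens S j k n.+1 (val c)) = 0%R.
  by rewrite linear0 subr0 IH // ltnW.
case: k c {IH} nE => [|k] c nE.
  by exfalso; have := wcount_le S j; clear -nE jn; lia.
rewrite face_wdegens_gt; last 2 first.
- by rewrite ltnSn.
- by clear -nE; lia.
by rewrite moore_face ?linear0 //; have := wcount_le S j; clear -nE jn; lia.
Qed.
End DegeneracyWords.

(** * Shuffles as words, and exchanges of neighbouring letters *)

Section ShuffleWords.
Local Open Scope nat_scope.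
Variables k l : nat.
Implicit Types (p q : 'S_(k + l)) (t a : nat).

(** The edges collapsed in the first factor. The entries of mu are the complement, so this word
    determines the shuffle. *)
Definition sword p : pred nat := fun t => t \in shuffle_nu p.

Lemma mem_shuffle_nu p (x : 'I_(k + l)) : (val (p x) \in shuffle_nu p) = (k <= x).
Proof.
apply/mapP/idP => [[j _ /val_inj/perm_inj->]|]; first by rewrite /= leq_addr.
case: (splitP x) => j xj; first by rewrite xj leqNgt ltn_ord.
by move=> _; exists j; rewrite ?mem_enum //; congr (val (p _)); apply: val_inj.
Qed.

Lemma mem_shuffle_mu p (x : 'I_(k + l)) : (val (p x) \in shuffle_mu p) = (x < k).
Proof.
apply/mapP/idP => [[j _ /val_inj/perm_inj->]|]; first exact: (ltn_ord j).
case: (splitP x) => j xj // .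
by move=> _; exists j; rewrite ?mem_enum //; congr (val (p _)); apply: val_inj.
Qed.

Lemma shuffle_nu_lt p t : t \in shuffle_nu p -> t < k + l.
Proof. by case/mapP=> j _ ->; apply: ltn_ord. Qed.

Lemma shuffle_mu_lt p t : t \in shuffle_mu p -> t < k + l.
Proof. by case/mapP=> j _ ->; apply: ltn_ord. Qed.

Lemma mem_shuffle_muE p t : (t \in shuffle_mu p) = (t < k + l) && ~~ sword p t.
Proof.
have [tkl|tkl] := ltnP t (k + l); last first.
  by apply: contraTF tkl => /shuffle_mu_lt; rewrite ltnNge.
have -> : t = val (p ((p^-1)%g (Ordinal tkl))) by rewrite permKV.
by rewrite mem_shuffle_mu /sword mem_shuffle_nu ltnNge.
Qed.

Lemma shuffle_muP p : shuffle p -> forall i j : 'I_k, i < j ->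
  p (lshift l i) < p (lshift l j).
Proof. by case/andP=> /'forall_'forall_implyP. Qed.

Lemma shuffle_nuP p : shuffle p -> forall i j : 'I_l, i < j ->
  p (rshift k i) < p (rshift k j).
Proof. by case/andP=> _ /'forall_'forall_implyP. Qed.

Lemma sorted_enum_ord n : sorted (fun i j : 'I_n => i < j) (enum 'I_n).
Proof.
have := iota_ltn_sorted 0 n; rewrite -val_enum_ord sorted_map.
by apply: sub_sorted.
Qed.

Lemma shuffle_nu_filter p : shuffle p ->
  shuffle_nu p = [seq t <- iota 0 (k + l) | sword p t].
Proof.
move=> sp; apply: (irr_sorted_eq ltn_trans ltnn).
- rewrite sorted_map; apply: sub_sorted (sorted_enum_ord l) => i j.
  exact: shuffle_nuP.
- by apply: sorted_filter (iota_ltn_sorted _ _); apply: ltn_trans.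
move=> t; rewrite mem_filter mem_iota add0n /sword.
by case: (boolP (t \in _)) => // /shuffle_nu_lt->.
Qed.

Lemma shuffle_mu_filter p : shuffle p ->
  shuffle_mu p = [seq t <- iota 0 (k + l) | ~~ sword p t].
Proof.
move=> sp; apply: (irr_sorted_eq ltn_trans ltnn).
- rewrite sorted_map; apply: sub_sorted (sorted_enum_ord k) => i j.
  exact: shuffle_muP.
- by apply: sorted_filter (iota_ltn_sorted _ _); apply: ltn_trans.
by move=> t; rewrite mem_filter mem_iota add0n /= mem_shuffle_muE andbC.
Qed.

Lemma wcount_sword p : shuffle p -> wcount (sword p) (k + l) = l.
Proof.
move=> sp; rewrite /wcount -size_filter -shuffle_nu_filter //.
by rewrite size_map size_enum_ord.
Qed.

Lemma wcount_swordC p : shuffle p -> wcount (fun t => ~~ sword p t) (k + l) = k.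
Proof.
move=> sp; rewrite /wcount -size_filter -shuffle_mu_filter //.
by rewrite size_map size_enum_ord.
Qed.

Lemma sword_inj p q : shuffle p -> shuffle q ->
  (forall t, t < k + l -> sword p t = sword q t) -> p = q.
Proof.
move=> sp sq e.
have eN : shuffle_nu p = shuffle_nu q.
  rewrite !shuffle_nu_filter //; apply: eq_in_filter => t.
  by rewrite mem_iota; apply: e.
have eM : shuffle_mu p = shuffle_mu q.
  rewrite !shuffle_mu_filter //; apply: eq_in_filter => t.
  by rewrite mem_iota => /e->.
apply/permP => x; case: (splitP x) => j xj.
  have -> : x = lshift l j by apply: val_inj.
  by apply: val_inj; have /eq_in_map := eM; apply; rewrite mem_enum.
have -> : x = rshift k j by apply: val_inj.
by apply: val_inj; have /eq_in_map := eN; apply; rewrite mem_enum.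
Qed.

Lemma shuffle1 : shuffle (1%g : 'S_(k + l)).
Proof.
by apply/andP; split; apply/'forall_'forall_implyP => i j ij; rewrite !perm1 //= ltn_add2l.
Qed.

Lemma sword1 t : t < k + l -> sword 1%g t = (k <= t).
Proof.
move=> tkl; rewrite /sword -[t]/(val (Ordinal tkl)) -{1}(perm1 (Ordinal tkl)).
exact: mem_shuffle_nu.
Qed.

Definition swapn a t := if t == a then a.+1 else if t == a.+1 then a else t.

Lemma swapnK a : involutive (swapn a).
Proof. by move=> t; rewrite /swapn; do 4?case: eqP; lia. Qed.

Section Swap.
Variables (p : 'S_(k + l)) (a : nat).
Hypotheses (akl : a.+1 < k + l).

Let x0 : 'I_(k + l) := Ordinal (ltnW akl).
Let x1 : 'I_(k + l) := Ordinal akl.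
Definition swap_shuffle : 'S_(k + l) := (p * tperm x0 x1)%g.

Lemma swap_shuffleE x : val (swap_shuffle x) = swapn a (val (p x)).
Proof.
have e0 y : (val y == a) = (y == x0) by rewrite -val_eqE.
have e1 y : (val y == a.+1) = (y == x1) by rewrite -val_eqE.
rewrite permM /swapn e0 e1; case: tpermP => [->|->|/eqP/negbTE->/eqP/negbTE->] //.
  by rewrite eqxx.
by rewrite eqxx ifF // -val_eqE /= gtn_eqF.
Qed.

Lemma sword_swap t : sword swap_shuffle t = sword p (swapn a t).
Proof.
apply/mapP/mapP => [][j je tE]; exists j => //.
  by rewrite tE swap_shuffleE swapnK.
by rewrite swap_shuffleE -tE swapnK.
Qed.

Lemma odd_swap : odd_perm swap_shuffle = ~~ odd_perm p.
Proof. by rewrite odd_permM odd_tperm -val_eqE /= neq_ltn ltnSn addbT. Qed.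

Lemma shuffle_swap : shuffle p -> sword p a != sword p a.+1 -> shuffle swap_shuffle.
Proof.
move=> sp pa; have mu_word (i : 'I_k) : ~~ sword p (p (lshift l i)).
  by rewrite /sword mem_shuffle_nu -ltnNge /= ltn_ord.
have nu_word (i : 'I_l) : sword p (p (rshift k i)).
  by rewrite /sword mem_shuffle_nu /= leq_addr.
apply/andP; split; apply/'forall_'forall_implyP => i j ij.
  rewrite -[X in X < _]/(val _) -[X in _ < X]/(val _) !swap_shuffleE /=.
  have := shuffle_muP sp ij; have := mu_word i; have := mu_word j.
  move: (nat_of_ord (p (lshift l i))) (nat_of_ord (p (lshift l j))) => u v; rewrite /swapn.
  case: (eqVneq u a) => [->|ua]; case: (eqVneq v a.+1) => [->|va].
  - by move=> /negbTE h1 /negbTE h2; rewrite h1 h2 in pa.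
  - by clear -va; do 4?case: eqP; lia.
  - by clear -ua; do 4?case: eqP; lia.
  by clear -ua va; do 4?case: eqP; lia.
rewrite -[X in X < _]/(val _) -[X in _ < X]/(val _) !swap_shuffleE /=.
have := shuffle_nuP sp ij; have := nu_word i; have := nu_word j.
move: (nat_of_ord (p (rshift k i))) (nat_of_ord (p (rshift k j))) => u v; rewrite /swapn.
case: (eqVneq u a) => [->|ua]; case: (eqVneq v a.+1) => [->|va].
- by move=> h1 h2; rewrite h1 h2 in pa.
- by clear -va; do 4?case: eqP; lia.
- by clear -ua; do 4?case: eqP; lia.
by clear -ua va; do 4?case: eqP; lia.
Qed.

Lemma swap_mu_sum : sword p a -> ~~ sword p a.+1 ->
  \sum_(i < k) val (swap_shuffle (lshift l i)) < \sum_(i < k) val (p (lshift l i)).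
Proof.
move=> pa pSa; have /mapP[i _ iE] : a.+1 \in shuffle_mu p.
  by rewrite mem_shuffle_muE akl.
rewrite (bigD1 i) //= [X in _ < X](bigD1 i) //= -addSn leq_add //.
  have := swap_shuffleE (lshift l i); rewrite -iE /swapn gtn_eqF // eqxx /= => ->.
  by rewrite -[X in _ < X]/(val _) -iE.
apply: leq_sum => j _; rewrite -[X in X <= _]/(val _) swap_shuffleE /swapn.
case: eqP => [e|_]; last by case: eqP => [->|].
have : ~~ sword p (p (lshift l j)) by rewrite /sword mem_shuffle_nu -ltnNge /= ltn_ord.
by rewrite -[nat_of_ord _]/(val _) e pa.
Qed.
End Swap.

Lemma monotone_threshold (w : pred nat) n :
  (forall a, a.+1 < n -> w a -> w a.+1) ->
  exists2 c, c <= n & forall t, t < n -> w t = (c <= t).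
Proof.
elim: n => [|n IH] h; first by exists 0.
have [a an|c cn cE] := IH; first by apply: h; rewrite ltnW.
have [wn|wn] := boolP (w n).
  exists c; first by rewrite ltnW.
  by move=> t; rewrite ltnS leq_eqVlt => /predU1P[->|/cE//]; rewrite wn cn.
have ecn : c = n.
  apply/eqP; rewrite eqn_leq cn leqNgt; apply: contra wn => cn'.
  by case: n cn' cE h {IH cn} => // n cn' cE h; apply: h; rewrite // cE.
exists n.+1 => // t; rewrite ltnS leq_eqVlt => /predU1P[->|tn].
  by rewrite ltnn (negbTE wn).
by rewrite cE // ecn ltnNge (ltnW tn) leqNgt tn.
Qed.

Lemma wcount_threshold (w : pred nat) c n : c <= n ->
  (forall t, t < n -> w t = (c <= t)) -> wcount w n = n - c.
Proof.
elim: n => [|n IH] cn h; first by rewrite /wcount.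
rewrite wcountS h //; move: cn; rewrite leq_eqVlt => /predU1P[cE|cn].
  rewrite cE ltnn subnn add0n; apply/eqP; rewrite -leqn0 leqNgt -has_count.
  apply/hasPn => t; rewrite mem_iota add0n => /andP[_ tn].
  by rewrite h ?cE -?ltnNge; rewrite ltnS ltnW.
rewrite IH //; first by rewrite -ltnS cn add1n subSn.
by move=> t tn; apply: h; rewrite ltnW.
Qed.

(** A word without descent is false up to some [c] and true from there on. Counting its letters
    gives c = k, which is the word of the identity. *)
Lemma shuffle_descent p : shuffle p -> p != 1%g ->
  exists a, [/\ a.+1 < k + l, sword p a & ~~ sword p a.+1].
Proof.
move=> sp p1; apply: contrapT => nex.
have [|c cn cE] := @monotone_threshold (sword p) (k + l).
  by move=> a akl pa; apply/negPn/negP => pSa; apply: nex; exists a.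
have ck : c = k.
  by have := wcount_threshold cn cE; rewrite wcount_sword //; move: cn; clear; lia.
case/eqP: p1; apply: sword_inj => // [|t tkl]; first exact: shuffle1.
by rewrite cE // sword1 // ck.
Qed.

(* Swapping at a descent decreases the sum of mu. *)
Lemma alternating_shuffle (R : pzRingType) (V : lmodType R) (F : 'S_(k + l) -> V) :
  (forall p a (akl : a.+1 < k + l), shuffle p -> sword p a -> ~~ sword p a.+1 ->
     F (swap_shuffle p akl) = (- F p)%R) ->
  forall p, shuffle p -> F p = ((-1) ^+ odd_perm p *: F 1%g)%R.
Proof.
move=> Fswap p; have [m] := ubnP (\sum_(i < k) val (p (lshift l i))).
elim: m p => // m IH p pm sp.
have [->|p1] := eqVneq p 1%g; first by rewrite odd_perm1 expr0 scale1r.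
have [a [akl pa pSa]] := shuffle_descent sp p1.
have := IH (swap_shuffle p akl) (leq_trans (swap_mu_sum akl pa pSa) pm).
rewrite shuffle_swap ?pa ?(negbTE pSa) // => /(_ isT).
by rewrite Fswap // odd_swap signrN scaleNr => /oppr_inj.
Qed.

(** The permutation lists the positions outside [w] and then those in [w], each in increasing
    order. *)
Lemma shuffle_of_word (w : pred nat) : wcount w (k + l) = l ->
  exists2 p, shuffle p & forall t, t < k + l -> sword p t = w t.
Proof.
move=> wl; pose f := [seq t <- iota 0 (k + l) | ~~ w t].
pose g := [seq t <- iota 0 (k + l) | w t].
have sg : size g = l by rewrite size_filter.
have sf : size f = k.
  have := count_predC w (iota 0 (k + l)); rewrite size_iota -/(wcount w (k + l)) wl.
  by rewrite addnC => /addIn; rewrite size_filter.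
have fg : perm_eq (f ++ g) (iota 0 (k + l)).
  by rewrite perm_catC; apply/permPl/perm_filterC.
have fg_lt t : t < k + l -> nth 0 (f ++ g) t < k + l.
  move=> tkl; have : nth 0 (f ++ g) t \in f ++ g by rewrite mem_nth // size_cat sf sg.
  by rewrite (perm_mem fg) mem_iota.
pose h (x : 'I_(k + l)) := Ordinal (fg_lt x (ltn_ord x)).
have h_inj : injective h.
  move=> x y /(congr1 val)/eqP /=; rewrite nth_uniq ?size_cat ?sf ?sg //.
    by move/eqP/val_inj.
  by rewrite (perm_uniq fg) iota_uniq.
have fS : sorted ltn f by apply: sorted_filter (iota_ltn_sorted _ _); apply: ltn_trans.
have gS : sorted ltn g by apply: sorted_filter (iota_ltn_sorted _ _); apply: ltn_trans.
have muE (i : 'I_k) : val (perm h_inj (lshift l i)) = nth 0 f i.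
  by rewrite permE /= nth_cat sf ltn_ord.
have nuE (i : 'I_l) : val (perm h_inj (rshift k i)) = nth 0 g i.
  by rewrite permE /= nth_cat sf ltnNge leq_addr addKn.
exists (perm h_inj).
  apply/andP; split; apply/'forall_'forall_implyP => i j ij.
    rewrite -[X in X < _]/(val _) -[X in _ < X]/(val _) !muE.
    by apply: (sorted_ltn_nth ltn_trans 0 fS); rewrite // inE sf.
  rewrite -[X in X < _]/(val _) -[X in _ < X]/(val _) !nuE.
  by apply: (sorted_ltn_nth ltn_trans 0 gS); rewrite // inE sg.
move=> t tkl; have -> : w t = (t \in g) by rewrite mem_filter mem_iota leq0n add0n tkl !andbT.
apply/mapP/idP => [[j _ ->]|tg].
  by rewrite nuE mem_nth // sg.
have il : index t g < l by rewrite -sg index_mem.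
by exists (Ordinal il); rewrite ?mem_enum // nuE nth_index.
Qed.
End ShuffleWords.

(** * The Alexander-Whitney map *)

Section OuterFaces.
Variable K : comNzRingType.
Variable A : simplicial_module K.
Local Open Scope nat_scope.
Implicit Types (i j k l m n : nat).

(* h^(m - k) and t^(m - l) on A_m; only meaningful for k, l <= m. *)
Definition front m k : {linear A m -> A k} := last_faces A (m - k) k \o recast A m (m - k + k).
Definition back m l : {linear A m -> A l} := first_faces A (m - l) l \o recast A m (m - l + l).

Lemma last_faces_recast l l' m k x : l = l' ->
  last_faces A l k (recast A m (l + k) x) = last_faces A l' k (recast A m (l' + k) x).
Proof. by move->. Qed.

Lemma frontE m k l x : m = l + k -> front m k x = last_faces A l k (recast A m (l + k) x).
Proof. by move=> e; apply: last_faces_recast; rewrite e addnK. Qed.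

Lemma backE m k l x : m = k + l -> back m l x = first_faces A k l (recast A m (k + l) x).
Proof. by move=> e; rewrite /back /=; have -> : m - l = k by rewrite e addnK. Qed.

Lemma front_id k x : front k k x = x.
Proof. by rewrite (@frontE k k 0) // recast_id. Qed.

Lemma back_id k x : back k k x = x.
Proof. by rewrite (@backE k 0 k) // recast_id. Qed.

Lemma frontS m k x : k <= m -> front m.+1 k x = front m k (face A m m.+1 x).
Proof.
move=> km; have [l lE] : exists l, m = l + k by exists (m - k); rewrite subnK.
by subst m; rewrite !(@frontE _ _ _ _ (erefl _)) (@frontE (l + k).+1 k l.+1) // !recast_id.
Qed.

Lemma backS m l x : l <= m -> back m.+1 l x = back m l (face A m 0 x).
Proof.
move=> lm; have [k kE] : exists k, m = k + l by exists (m - l); rewrite subnK.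
by subst m; rewrite !(@backE _ _ _ _ (erefl _)) (@backE (k + l).+1 k.+1 l) // !recast_id.
Qed.

Lemma front_face_le m k i x : i <= k <= m ->
  front m k (face A m i x) = face A k i (front m.+1 k.+1 x).
Proof.
elim: m x => [|m IH] x ikm.
  have -> : k = 0 by lia.
  by rewrite !front_id.
have [->|km] := eqVneq k m.+1; first by rewrite !front_id.
have ikm' : i <= k <= m by lia.
rewrite frontS; last lia.
by rewrite -face_face ?IH // -?frontS //; lia.
Qed.

Lemma front_face_gt m k i x : k < i <= m.+1 ->
  front m k (face A m i x) = front m.+1 k x.
Proof.
elim: m x i => [|m IH] x i kim.
  have -> : k = 0 by lia.
  have -> : i = 1 by lia.
  by rewrite frontS.
have [->|im] := eqVneq i m.+2; first by rewrite [RHS]frontS //; lia.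
rewrite [LHS]frontS; last lia.
by rewrite -face_face ?IH -?frontS //; lia.
Qed.

Lemma front_face_eq m k x : k < m -> face A k k.+1 (front m k.+1 x) = front m k x.
Proof.
elim: m x => [//|m IH] x km; rewrite [RHS]frontS //.
have [e|ne] := eqVneq k m; first by case: m / e x {IH km} => x; rewrite !front_id.
by rewrite frontS ?IH //; lia.
Qed.

Lemma back_face_le m l i x : l <= m -> i <= m - l ->
  back m l (face A m i x) = back m.+1 l x.
Proof.
elim: m x i => [|m IH] x i lm il.
  have -> : i = 0 by lia.
  by rewrite backS.
case: i il => [|i] il; first by rewrite [RHS]backS.
rewrite [LHS]backS; last by lia.
by rewrite face_face ?IH -?backS //; lia.
Qed.

Lemma back_face_gt m l i x : l <= m -> m - l < i <= m.+1 ->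
  back m l (face A m i x) = face A l (i - (m - l)) (back m.+1 l.+1 x).
Proof.
elim: m x i => [|m IH] x i lm il.
  have -> : l = 0 by lia.
  by rewrite !back_id !subn0.
have [->|ne] := eqVneq l m.+1; first by rewrite !back_id subnn subn0.
case: i il => [|i] il; first by lia.
rewrite [LHS]backS; last by lia.
rewrite face_face ?IH -?backS //; try lia.
by congr (face _ _ _ _); lia.
Qed.

Lemma back_face_eq m l x : l < m -> face A l 0 (back m l.+1 x) = back m l x.
Proof.
elim: m x => [//|m IH] x lm; rewrite [RHS]backS //.
have [e|ne] := eqVneq l m; first by case: m / e x {IH lm} => x; rewrite !back_id.
by rewrite backS ?IH //; lia.
Qed.
End OuterFaces.

Section AlexanderWhitney.
Variable K : comNzRingType.
Variables A A' : simplicial_module K.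

Lemma AW_componentE n k l z : (k + l)%N = n ->
  AW_component A A' n k l z = tmap (front A n k) (back A' n l) z.
Proof.
by move=> e; apply: eq_tmap => x /=; rewrite -?(@frontE _ A n k l) -?(@backE _ A' n k l) // addnC.
Qed.

Lemma alt_faceE (B : simplicial_module K) n (x : B n.+1) :
  alt_face B n x = \sum_(i < n.+2) (-1) ^+ i *: face B n i x.
Proof. by []. Qed.

(** Faces d_i with i <= k act on the front part and those with i > k on the back part. The last face
    of the front and the first face of the back, absent on the left, are the same tensor with
    opposite signs. *)
Lemma AW_component_bd n k l (X : tens (A n.+1) (A' n.+1)) : (k + l)%N = n ->
  AW_component A A' n k l (alt_face (tens_simplicial A A') n X) =
  tmap (alt_face A k) idfun (AW_component A A' n.+1 k.+1 l X) +
  (-1) ^+ k *: tmap idfun (alt_face A' l) (AW_component A A' n.+1 k l.+1 X).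
Proof.
move=> e; elim/tens_ind: X => [a a'|c u v hu hv]; last first.
  by rewrite !linearP hu hv scalerDr addrACA.
rewrite !AW_componentE ?addSn ?addnS ?e // !tmapE.
pose G i := (-1) ^+ i *: tpure (front A n k (face A n i a)) (back A' n l (face A' n i a')).
transitivity (\sum_(i < n.+2) G i).
  have -> : alt_face (tens_simplicial A A') n (tpure a a') =
      \sum_(i < n.+2) (-1) ^+ i *: tpure (face A n i a) (face A' n i a').
    by apply: eq_bigr => i _; congr (_ *: _); apply: tmapE.
  by rewrite linear_sum; apply: eq_bigr => i _; rewrite linearZ_LR tmapE.
have nk : (n - l)%N = k by rewrite -e addnK.
have -> : \sum_(i < n.+2) G i = \sum_(i < k.+1) G i + \sum_(j < l.+1) G (k.+1 + j)%N.
  by rewrite (_ : n.+2 = (k.+1 + l.+1)%N) ?big_split_ord // -e addSn addnS.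
have -> : tpure (alt_face A k (front A n.+1 k.+1 a)) (back A' n.+1 l a') =
    \sum_(i < k.+1) G i + (-1) ^+ k.+1 *: tpure (front A n.+1 k a) (back A' n.+1 l a').
  rewrite -[LHS]/(tpurel _ _ _) alt_faceE linear_sum.
  rewrite big_ord_recr /=; congr (_ + _).
    apply: eq_bigr => i _; rewrite /G front_face_le; last by have := ltn_ord i; lia.
    rewrite back_face_le; [|lia|by have := ltn_ord i; lia].
    exact: tpureZl.
  by rewrite [LHS]tpureZl front_face_eq //; lia.
have -> : (-1) ^+ k *: tpure (front A n.+1 k a) (alt_face A' l (back A' n.+1 l.+1 a')) =
    (-1) ^+ k *: tpure (front A n.+1 k a) (back A' n.+1 l a') +
    \sum_(j < l.+1) G (k.+1 + j)%N.
  rewrite -[tpure _ (alt_face _ _ _)]/(tpurer _ _ _) alt_faceE linear_sum.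
  rewrite scaler_sumr big_ord_recl /=; congr (_ + _).
    by rewrite expr0 scale1r /tpurer_fun back_face_eq //; lia.
  apply: eq_bigr => j _; rewrite -![bump 0 j]/(j.+1) /G.
  rewrite front_face_gt; last by have := ltn_ord j; lia.
  rewrite back_face_gt; [|lia|by have := ltn_ord j; lia].
  rewrite nk addSn -addnS addKn [tpurer_fun _ _]tpureZr scalerA -exprD.
  by [].
by rewrite exprS mulN1r scaleNr -addrA [- _ + _]addrA addNr add0r.
Qed.

(** In the boundary of s_j y the faces j and j + 1 both give y, with opposite signs; every other
    face of s_j y is degenerate. *)
Lemma alt_face_degenerate (B : simplicial_module K) n (x : B n.+1) :
  x \in degenerate B n.+1 -> alt_face B n x \in degenerate B n.
Proof.
move=> /(in_submod_of (sumsub_prop _ _)) [f fP ->]; rewrite linear_sum.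
apply: rpred_sum => j _; have /(in_submod_of (rangesub_prop _)) [y ->] := fP j isT.
move: (nat_of_ord j) (ltn_ord j) => {fP}j; rewrite ltnS => jn.
have jn1 : (j < n.+2)%N by rewrite ltnS ltnW.
rewrite alt_faceE (bigD1 (Ordinal jn1)) // (bigD1 (Ordinal (jn : j.+1 < n.+2)%N)) /=; last first.
  by rewrite -val_eqE /= gtn_eqF.
rewrite face_degen_eq // face_degen_eqS // addrA exprS mulN1r scaleNr addrN add0r.
apply: rpred_sum => i /andP[]; rewrite -!val_eqE /= => ij iSj; apply: rpredZ.
move: (nat_of_ord i) (ltn_ord i) ij iSj => {}i iln ij iSj; clear jn1 f x.
case: n y jn iln => [|n] y jn iln; first by exfalso; clear -ij iSj jn iln; lia.
have [ij'|ji] := ltnP i j.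
  case: j ij iSj jn ij' => // j ij iSj jn ij'.
  by rewrite face_degen_lt ?degen_degenerate //; clear -jn ij'; lia.
case: i ij iSj iln ji => [|i] ij iSj iln ji; first by exfalso; clear -ij ji; lia.
by rewrite face_degen_gt ?degen_degenerate //; clear -ij iSj iln ji jn; lia.
Qed.

Lemma rho_alt_face (B : simplicial_module K) n (x : B n.+1) :
  rho B n (alt_face B n x) = bd (moore B) n (rho B n.+1 x).
Proof.
apply: rho_fun_uniq; change (alt_face B n x - alt_face B n (val (rho B n.+1 x)) \in degenerate B n).
by rewrite -linearB; apply: alt_face_degenerate; apply: rho_funP.
Qed.

Lemma AW_chain_map : chain_map (AW A A').
Proof.
move=> n x; apply: dsumP => k l; rewrite tens_bdE.
have [e|ne] := eqVneq (k + l)%N n; last first.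
  rewrite !component_off ?linear0 ?scaler0 ?addr0 // ?addSn ?addnS ?eqSS //.
rewrite -[LHS]/(tmap (rho A k) (rho A' l) (AW_component A A' n k l
  (alt_face (tens_simplicial A A') n (val x)))).
rewrite AW_component_bd // linearD linearZ_LR.
rewrite -[component k.+1 l _]/(tmap (rho A k.+1) (rho A' l)
  (AW_component A A' n.+1 k.+1 l (val x))).
rewrite -[component k l.+1 _]/(tmap (rho A k) (rho A' l.+1)
  (AW_component A A' n.+1 k l.+1 (val x))).
rewrite !tmap_comp; congr (_ + _ *: _); apply: eq_tmap => // y /=; exact: rho_alt_face.
Qed.
End AlexanderWhitney.

(** * Complementary degeneracies in a tensor product *)

Section WordPairs.
Variable K : comNzRingType.
Variables A A' : simplicial_module K.
Local Notation T := (tens_simplicial A A').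
Implicit Types (w S : pred nat).

Definition wneg w : pred nat := fun t => ~~ w t.

(** Every edge is collapsed in exactly one factor; for the word of a shuffle (mu, nu) this is s_nu
    (x) s_mu. *)
Definition wpair w k l n : {linear tens (A k) (A' l) -> T n} :=
  tmap (wdegens A w n k n) (wdegens A' (wneg w) n l n).

Lemma wcount_neg w n : (wcount w n + wcount (wneg w) n)%N = n.
Proof. by have := count_predC w (iota 0 n); rewrite size_iota. Qed.

Lemma shuffle_degensE n k (p : 'S_(k + (n - k))) z : (k <= n)%N -> shuffle p ->
  tmap (degens A (shuffle_nu p) k n) (degens A' (shuffle_mu p) (n - k) n) z =
  wpair (sword p) k (n - k) n z.
Proof.
move=> kn sp; apply: eq_tmap => x; rewrite /wdegens.
  by rewrite shuffle_nu_filter // subnKC.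
by rewrite shuffle_mu_filter // subnKC.
Qed.

Lemma tens_degen_degenerate n t (x : A n) (y : A' n) : (t <= n)%N ->
  tpure (degen A n t x) (degen A' n t y) \in degenerate T n.+1.
Proof.
move=> tn; rewrite -[tpure _ _](tmapE (degen A n t) (degen A' n t)).
exact: (@degen_degenerate _ T).
Qed.

Lemma degenerate_ind (B : simplicial_module K) n (P : B n.+1 -> Prop) :
  P 0 -> (forall x y, P x -> P y -> P (x + y)) ->
  (forall t y, (t <= n)%N -> P (degen B n t y)) ->
  forall x, x \in degenerate B n.+1 -> P x.
Proof.
move=> P0 PD Pd x /(in_submod_of (sumsub_prop _ _)) [f fP ->].
apply: big_ind => // i _; have /(in_submod_of (rangesub_prop _)) [y ->] := fP i isT.
by apply: Pd; rewrite -ltnS.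
Qed.

(* A degeneracy of the first factor is, after the degeneracies of w, a
   degeneracy at an edge outside w, hence shared with the second factor. *)
Lemma wpair_degl w k l n x (y : A' l) : x \in degenerate A k -> (k + wcount w n)%N = n ->
  wpair w k l n (tpure x y) \in degenerate T n.
Proof.
case: k x => [|k] x.
  by move=> /(in_submod_of (@zerosub_prop _ _)) -> _; rewrite tpure0l linear0 rpred0.
move=> xd nE; move: x xd; apply: degenerate_ind => [|u v hu hv|t z tk].
- by rewrite tpure0l linear0 rpred0.
- by rewrite -[tpure _ _]/(tpurel _ _ _) !linearD rpredD.
case: n nE => [|n] nE; first by exfalso; lia.
rewrite /wpair tmapE.
have nE' : n = (k + wcount w n.+1)%N by lia.
have [u [a [un wu ->]]] := @wdegens_degen _ A w n.+1 k n t z tk (leqnn _) nE'.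
have [|b ->] := @wdegens_range _ A' (wneg w) n.+1 l n u y _ (wu un); first by rewrite ltnS un leqnn.
exact: tens_degen_degenerate.
Qed.

Lemma wpair_degr w k l n (x : A k) y : y \in degenerate A' l -> (l + wcount (wneg w) n)%N = n ->
  wpair w k l n (tpure x y) \in degenerate T n.
Proof.
case: l y => [|l] y.
  by move=> /(in_submod_of (@zerosub_prop _ _)) -> _; rewrite tpure0r linear0 rpred0.
move=> yd nE; move: y yd; apply: degenerate_ind => [|u v hu hv|t z tl].
- by rewrite tpure0r linear0 rpred0.
- by rewrite -[tpure _ _]/(tpurer _ _ _) !linearD rpredD.
case: n nE => [|n] nE; first by exfalso; lia.
rewrite /wpair tmapE.
have nE' : n = (l + wcount (wneg w) n.+1)%N by lia.
have [u [a [un wu ->]]] := @wdegens_degen _ A' (wneg w) n.+1 l n t z tl (leqnn _) nE'.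
have /negPn wu' := wu un.
have [|b ->] := @wdegens_range _ A w n.+1 k n u x _ wu'; first by rewrite ltnS un leqnn.
exact: tens_degen_degenerate.
Qed.

Local Notation inclT k l := (tmap (moore_incl A k) (moore_incl A' l)).
Local Notation rhoT k l := (tmap (rho A k) (rho A' l)).

Lemma rhoT_inclT k l z : rhoT k l (inclT k l z) = z.
Proof. by rewrite tmap_comp; apply: tmap_idE => x; apply: rho_moore. Qed.

(** A degenerate part in either factor becomes degenerate in the product, so coefficients may be
    normalised factor by factor. *)
Lemma wpair_rho w k l n u : (k + wcount w n)%N = n -> (l + wcount (wneg w) n)%N = n ->
  wpair w k l n u - wpair w k l n (inclT k l (rhoT k l u)) \in degenerate T n.
Proof.
move=> kE lE; elim/tens_ind: u => [x y|a u v hu hv].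
  rewrite -(linearB (wpair w k l n)) [rhoT k l _]tmapE [inclT k l _]tmapE.
  have xd : x - moore_incl A k (rho A k x) \in degenerate A k by apply: rho_funP.
  have yd : y - moore_incl A' l (rho A' l y) \in degenerate A' l by apply: rho_funP.
  move: (moore_incl A k _) (moore_incl A' l _) xd yd => x' y' xd yd.
  have -> : tpure x y - tpure x' y' = tpure (x - x') y + tpure x' (y - y').
    by rewrite tpureBl tpureBr addrA subrK.
  by rewrite (linearD (wpair w k l n)); apply: rpredD; [apply: wpair_degl | apply: wpair_degr].
by rewrite !linearP addrACA -scalerDr; apply: submodL.
Qed.

Lemma strip_degenerate S S' n k l x : (forall t, (t < n)%N -> ~~ (S t && S' t)) ->
  x \in degenerate T n ->
  tmap (strip A S n n k) (strip A' S' n n l) x = 0.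
Proof.
case: n x => [|n] x h; first by move=> /(in_submod_of (@zerosub_prop _ _)) ->; rewrite linear0.
move: x; apply: degenerate_ind => [|u v hu hv|t y tn]; first exact: linear0.
  by rewrite linearD hu hv addr0.
rewrite -[degen T n t y]/(tmap _ _ _) tmap_comp.
have := h t; rewrite ltnS tn negb_and => /(_ isT)/orP[St|St].
  by apply: tmap_0l => z; apply: strip_degen; rewrite // ltnS tn leqnn.
by apply: tmap_0r => z; apply: strip_degen; rewrite // ltnS tn leqnn.
Qed.

Lemma rho_front_wdegens w n m k x t : (k <= n)%N -> (t < k)%N -> w t ->
  rho A k (front A n k (wdegens A w n m n x)) = 0.
Proof.
move=> kn tk wt; apply: rho_degenerate; rewrite (@frontE _ A n k (n - k)) ?subnK //.
have -> : recast A n (n - k + k) (wdegens A w n m n x) =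
    wdegens A w (n - k + k) m (n - k + k) x by rewrite subnK ?recast_id.
have [m' [y ->]] := @last_faces_wdegens_ex _ A w (n - k) k m x.
exact: wdegens_degenerate tk wt.
Qed.

Lemma rho_back_wdegens w n m l (x : A' m) t : (l <= n)%N -> (n - l <= t < n)%N -> w t ->
  rho A' l (back A' n l (wdegens A' w n m n x)) = 0.
Proof.
move=> ln tln wt; apply: rho_degenerate; rewrite (@backE _ A' n (n - l) l) ?subnK //.
have -> : recast A' n (n - l + l) (wdegens A' w n m n x) =
    wdegens A' w (n - l + l) m (n - l + l) x by rewrite subnK ?recast_id.
have [m' [y ->]] := @first_faces_wdegens_ex _ A' w (n - l) l m x.
apply: (@wdegens_degenerate _ _ _ _ _ _ (t - (n - l))); first lia.
by rewrite subnKC //; case/andP: tln.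
Qed.

Lemma front_threshold n k x : (k <= n)%N -> front A n k (wdegens A (leq k) n k n x) = x.
Proof.
move=> kn; rewrite (@frontE _ A n k (n - k)) ?subnK //.
have -> : recast A n (n - k + k) (wdegens A (leq k) n k n x) =
    wdegens A (leq k) (n - k + k) k (n - k + k) x by rewrite subnK ?recast_id.
rewrite last_faces_wdegens => [|t /andP[]//].
by apply: wdegens_none => t tk; rewrite -ltnNge.
Qed.

Lemma back_threshold n l (x : A' l) : (l <= n)%N ->
  back A' n l (wdegens A' (wneg (leq (n - l))) n l n x) = x.
Proof.
move=> ln; set w := wneg _; rewrite (@backE _ A' n (n - l) l) ?subnK //.
have -> : recast A' n (n - l + l) (wdegens A' w n l n x) =
    wdegens A' w (n - l + l) l (n - l + l) x by rewrite subnK ?recast_id.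
rewrite first_faces_wdegens => [|t tk]; last by rewrite /w /wneg -ltnNge.
by apply: wdegens_none => t tl; rewrite /w /wneg leq_addr.
Qed.

Lemma AW_degenerate n k l x : (k + l)%N = n -> x \in degenerate T n ->
  rhoT k l (AW_component A A' n k l x) = 0.
Proof.
move=> e; case: n e x => [|n] e x.
  by move=> /(in_submod_of (@zerosub_prop _ _)) ->; rewrite !linear0.
move: x; apply: degenerate_ind => [|u v hu hv|t y tn]; first by rewrite !linear0.
  by rewrite !linearD hu hv addr0.
rewrite AW_componentE // -[degen T n t y]/(tmap _ _ _) !tmap_comp.
(* A single degeneracy is read as a word with one letter; it survives in the front of the first
   factor if t < k and in the back of the second factor otherwise. *)
have wE (B : simplicial_module K) z : degen B n t z = wdegens B (pred1 t) n.+1 n n.+1 z.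
  have tE : [seq u <- iota 0 n.+1 | pred1 t u] = [:: t].
    by apply: filter_pred1_uniq; rewrite ?iota_uniq // mem_iota add0n ltnS.
  by rewrite /wdegens tE /= recast_id.
have [tk|kt] := ltnP t k.
  apply: tmap_0l => z /=; rewrite wE; apply: (@rho_front_wdegens _ _ _ _ _ t) => //=; lia.
apply: tmap_0r => z /=; rewrite wE; apply: (@rho_back_wdegens _ _ _ _ _ t) => //=; lia.
Qed.

Lemma AW_wpair0 w n a b k l u : (a + b)%N = n ->
  (exists2 t, (t < n)%N & w t != (a <= t)%N) ->
  rhoT a b (AW_component A A' n a b (wpair w k l n u)) = 0.
Proof.
move=> e [t tn]; rewrite AW_componentE // /wpair !tmap_comp.
have [ta|at_] := leqP a t => wt.
  apply: tmap_0r => z /=; apply: (@rho_back_wdegens _ _ _ _ _ t); [lia | lia |].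
  by move: wt; rewrite /wneg; case: (w t).
apply: tmap_0l => z /=; apply: (@rho_front_wdegens _ _ _ _ _ t) => //; first lia.
by move: wt; case: (w t).
Qed.

Lemma AW_wpair1 w n k l u : (k + l)%N = n -> (forall t, (t < n)%N -> w t = (k <= t)%N) ->
  rhoT k l (AW_component A A' n k l (wpair w k l n u)) = rhoT k l u.
Proof.
move=> e wE; congr (tmap _ _ _); rewrite AW_componentE // /wpair tmap_comp.
have nl : (n - l)%N = k by rewrite -e addnK.
apply: tmap_idE => z /=.
  rewrite (@eq_wdegens _ A w (leq k)) //; apply: front_threshold; lia.
rewrite (@eq_wdegens _ A' _ (wneg (leq (n - l)))); first by apply: back_threshold; lia.
by move=> t tn; rewrite /wneg wE // nl.
Qed.
End WordPairs.

(** * Boundaries of sums of shuffles *)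

Section DeletedWords.
Local Open Scope nat_scope.
Implicit Types (w : pred nat).

Lemma eq_wcount w w' j : (forall t, t < j -> w t = w' t) -> wcount w j = wcount w' j.
Proof.
by move=> h; apply: eq_in_count => t; rewrite mem_iota add0n; apply: h.
Qed.

Lemma wcount_leq w i j : i <= j -> wcount w i <= wcount w j.
Proof.
elim: j => [|j IH]; first by rewrite leqn0 => /eqP->.
by rewrite leq_eqVlt => /predU1P[->//|/IH h]; rewrite wcountS (leq_trans h) // leq_addl.
Qed.

Lemma wcount_wdel w i j : i <= j -> wmerge i j w -> (wcount (wdel i w) j.-1).+1 = wcount w j.
Proof.
elim: j => [|j IH] ij mij /=; first by move: mij ij; rewrite /wmerge; case: i.
have [ij'|ij'] := ltnP i j.
  have mij' : wmerge i j w by move: mij; rewrite /wmerge ij' (ltn_trans ij').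
  rewrite [RHS]wcountS -(IH (ltnW ij') mij').
  case: j ij' {IH ij mij mij'} => // j ij'; rewrite wcountS wdel_ge //.
  by rewrite addnS.
have [ei|ne] := eqVneq i j.
  case: j ei {IH ij'} ij mij => [|j] -> ij mij.
    by move: mij; rewrite /wmerge /= wcountS /wcount /= => ->.
  rewrite !wcountS wdel_eq (@eq_wcount (wdel _ _) w); last by move=> t tj; rewrite wdel_lt.
  by move: mij; rewrite /wmerge /=  ltnSn; case: (w j); case: (w j.+1) => //=; rewrite ?addnS.
have ei : i = j.+1 by lia.
rewrite wcountS (@eq_wcount (wdel _ _) w); last by move=> t tj; rewrite wdel_lt // ei.
by move: mij; rewrite /wmerge ei /= ltnn /= orbF => ->.
Qed.

Lemma wmergeE w a j : a.+1 < j -> wmerge a.+1 j w = w a || w a.+1.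
Proof. by rewrite /wmerge => ->. Qed.

Lemma wdel_neg_disjoint i w t : ~~ (wdel i w t && wdel i (wneg w) t).
Proof.
by rewrite /wdel /wneg; case: ifP => _; [|case: ifP => _]; case: (w t); case: (w i); case: (w t.+1).
Qed.

(* Merging two edges of w leaves room, inside the words obtained from w0 by
   merging the distinct edges a and a + 1, only for w0 and its swap. *)
Lemma wdel_sub w0 w a i n : a.+1 < n.+1 -> i <= n.+1 -> w0 a -> ~~ w0 a.+1 ->
  (forall t, t < n -> wdel i w t -> wdel a.+1 w0 t) ->
  (forall t, t < n -> wdel i (wneg w) t -> wdel a.+1 (wneg w0) t) ->
  i = a.+1 /\ ((forall t, t < n.+1 -> w t = w0 t) \/
               (forall t, t < n.+1 -> w t = w0 (swapn a t))).
Proof.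
move=> an iS wa wSa h h'; rewrite ltnS in an.
(* The letters of [w0] at a and a + 1 differ, so neither merged word of [w0] contains a. For i other
   than a + 1 the position a would carry a single letter of [w], which lies in [w] or in its
   complement. *)
have ha : ~~ wdel i w a.
  by apply/negP => /(h a an); rewrite wdel_eq wa (negbTE wSa).
have ha' : ~~ wdel i (wneg w) a.
  by apply/negP => /(h' a an); rewrite wdel_eq /wneg wa.
have ei : i = a.+1.
  move: ha ha'; rewrite /wdel /wneg; case: ltngtP => // _; first by case: (w a).
  by case: (w a.+1).
subst i; split=> //.
have wlt t : t < a -> w t = w0 t.
  move=> ta; have tn : t < n by lia.
  have := h t tn; have := h' t tn; rewrite !wdel_lt // /wneg.
  by case: (w t) => /=; case: (w0 t) => // h1 h2; [have := h2 isT | have := h1 isT].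
have wgt t : a < t -> t < n -> w t.+1 = w0 t.+1.
  move=> ta tn; have := h t tn; have := h' t tn; rewrite !wdel_ge // /wneg.
  by case: (w t.+1) => /=; case: (w0 t.+1) => // h1 h2; [have := h2 isT | have := h1 isT].
move: ha ha'; rewrite !wdel_eq /wneg.
have other t : t < n.+1 -> t != a -> t != a.+1 -> w t = w0 t.
  move=> tn ta tSa; have [|at_] := ltnP t a; first exact: wlt.
  by case: t tn ta tSa at_ => [|t] tn ta tSa at_; [lia | apply: wgt; lia].
case wA: (w a); case wB: (w a.+1) => // _ _; [left|right] => t tn.
  have [->|ta] := eqVneq t a; first by rewrite wA wa.
  have [->|tSa] := eqVneq t a.+1; first by rewrite wB (negbTE wSa).
  exact: other.
rewrite /swapn; case: eqP => [->|/eqP ta]; first by rewrite wA (negbTE wSa).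
by case: eqP => [->|/eqP tSa]; [rewrite wB wa | apply: other].
Qed.
(** The merged letter is the conjunction of the two letters, hence symmetric in them. *)
Lemma wdel_swapn w0 w a n :
  (forall t, t < n.+1 -> w t = w0 t) \/ (forall t, t < n.+1 -> w t = w0 (swapn a t)) ->
  forall t, t < n -> wdel a.+1 w t = wdel a.+1 w0 t.
Proof.
have Sa : swapn a a = a.+1 by rewrite /swapn eqxx.
have SSa : swapn a a.+1 = a by rewrite /swapn gtn_eqF // eqxx.
have Sne t : t != a -> t != a.+1 -> swapn a t = t by rewrite /swapn => /negbTE-> /negbTE->.
move=> wE t tn; have tn' : t < n.+1 by rewrite ltnW.
rewrite /wdel ltnS; case: ltngtP => [ta|ta|ta].
- by case: wE => ->; rewrite // Sne //; clear -ta; lia.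
- by rewrite eqSS gtn_eqF //; case: wE => ->; rewrite // Sne //; clear -ta; lia.
have an : a < n by rewrite -ta.
by rewrite ta eqxx; case: wE => h; rewrite !h ?ltnS ?(ltnW an) // ?Sa ?SSa // andbC.
Qed.
End DeletedWords.

Section SwapRelation.
Variable K : comNzRingType.
Variables A A' : simplicial_module K.
Local Notation T := (tens_simplicial A A').
Local Notation inclT k l := (tmap (moore_incl A k) (moore_incl A' l)).
Local Notation rhoT k l := (tmap (rho A k) (rho A' l)).

Definition shuffle_sum n
    (u : forall k : 'I_n.+1, 'S_(k + (n - k)) -> tens (A k) (A' (n - k)%N)) : T n :=
  \sum_(k < n.+1) \sum_(p | shuffle p) wpair A A' (sword p) k (n - k) n (u k p).

Lemma shuffle_counts n (k : 'I_n.+1) (p : 'S_(k + (n - k))) : shuffle p ->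
  (k + wcount (sword p) n = n)%N /\ ((n - k) + wcount (wneg (sword p)) n = n)%N.
Proof.
move=> sp; have kn : (k + (n - k))%N = n by rewrite subnKC // -ltnS.
have := wcount_sword sp; have := wcount_swordC sp.
by rewrite kn -/(wneg _) => -> ->; rewrite subnK // -ltnS.
Qed.

Lemma word_count_inj n (k k0 : 'I_n.+1) (p : 'S_(k + (n - k))) (p0 : 'S_(k0 + (n - k0))) :
  shuffle p -> shuffle p0 -> (forall t, (t < n)%N -> sword p t = sword p0 t) -> k = k0.
Proof.
move=> sp sp0 h; have [h1 _] := shuffle_counts sp; have [h2 _] := shuffle_counts sp0.
by apply/val_inj => /=; move: h1 h2; rewrite (eq_wcount h); clear; lia.
Qed.

Lemma sword_inj_ord n (k : 'I_n.+1) (p q : 'S_(k + (n - k))) : shuffle p -> shuffle q ->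
  (forall t, (t < n)%N -> sword p t = sword q t) -> p = q.
Proof.
move=> sp sq h; apply: sword_inj => // t; rewrite subnKC; last by rewrite -ltnS.
exact: h.
Qed.

Lemma linear_shuffle_sum n (V : lmodType K) (Phi : {linear T n -> V})
    (u : forall k : 'I_n.+1, 'S_(k + (n - k)) -> tens (A k) (A' (n - k)%N)) (k0 : 'I_n.+1) :
  (forall k p, k != k0 -> shuffle p -> Phi (wpair A A' (sword p) k (n - k) n (u k p)) = 0) ->
  Phi (shuffle_sum u) =
  \sum_(p | shuffle p) Phi (wpair A A' (sword p) k0 (n - k0) n (u k0 p)).
Proof.
move=> h; rewrite /shuffle_sum linear_sum.
transitivity (\sum_(k < n.+1) \sum_(p | shuffle p) Phi (wpair A A' (sword p) k (n - k) n (u k p))).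
  by apply: eq_bigr => k _; rewrite linear_sum.
by rewrite (bigD1 k0) //= [X in _ + X]big1 ?addr0 // => k kk0; rewrite big1 // => p; apply: h.
Qed.

Lemma AW_shuffle_sum n (u : forall k : 'I_n.+1, 'S_(k + (n - k)) -> tens (A k) (A' (n - k)%N))
    (k0 : 'I_n.+1) :
  rhoT k0 (n - k0)%N (AW_component A A' n k0 (n - k0) (shuffle_sum u)) =
  rhoT k0 (n - k0)%N (u k0 1%g).
Proof.
have kn : (k0 + (n - k0))%N = n by rewrite subnKC // -ltnS.
pose Phi : {linear T n -> _} := rhoT k0 (n - k0)%N \o AW_component A A' n k0 (n - k0).
have sword1' t : (t < n)%N -> sword (1%g : 'S_(k0 + (n - k0))) t = (k0 <= t)%N.
  by move=> tn; rewrite sword1 // kn.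
have Phi0 (k : 'I_n.+1) (p : 'S_(k + (n - k))) :
    (exists2 t, (t < n)%N & sword p t != sword (1%g : 'S_(k0 + (n - k0))) t) ->
    Phi (wpair A A' (sword p) k (n - k) n (u k p)) = 0.
  by case=> t tn pt; apply: AW_wpair0 => //; exists t => //; rewrite -sword1'.
have diff (k : 'I_n.+1) (p : 'S_(k + (n - k))) :
    ~ (exists2 t, (t < n)%N & sword p t != sword (1%g : 'S_(k0 + (n - k0))) t) ->
    forall t, (t < n)%N -> sword p t = sword (1%g : 'S_(k0 + (n - k0))) t.
  by move=> nex t tn; apply/eqP/negPn/negP => h; apply: nex; exists t.
rewrite -[LHS]/(Phi _) (@linear_shuffle_sum _ _ Phi _ k0) => [|k p kk0 sp]; last first.
  apply: Phi0; apply: contrapT => /diff h; case/eqP: kk0.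
  exact: word_count_inj sp (shuffle1 _ _) h.
rewrite (bigD1 1%g) ?shuffle1 //= [X in _ + X]big1 ?addr0 => [|p /andP[sp p1]].
  exact: AW_wpair1.
apply: Phi0; apply: contrapT => /diff h; case/eqP: p1.
exact: sword_inj_ord sp (shuffle1 _ _) h.
Qed.

Lemma big_two (V : nmodType) (I : finType) (Q : pred I) (F : I -> V) i j :
  Q i -> Q j -> j != i -> (forall k, Q k -> k != i -> k != j -> F k = 0) ->
  \sum_(k | Q k) F k = F i + F j.
Proof.
move=> Qi Qj ji F0; rewrite (bigD1 i) // (bigD1 j) ?Qj //= big1 ?addr0 //.
by move=> k /andP[/andP[Qk ki] kj]; apply: F0.
Qed.

Lemma alternating_sum_single (V : lmodType K) (F : nat -> V) n m : (m < n)%N ->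
  (forall i, (i < n)%N -> i != m -> F i = 0) ->
  \sum_(i < n) (-1) ^+ i *: F i = 0 -> F m = 0.
Proof.
move=> mn F0; rewrite (bigD1 (Ordinal mn)) //= big1 => [|i im]; last first.
  by rewrite F0 ?scaler0.
rewrite addr0 => /(congr1 (fun z => (-1) ^+ m *: z)).
by rewrite scalerA -expr2 sqrr_sign scale1r scaler0.
Qed.

Section Strip.
Variables (n : nat) (k0 : 'I_n.+2) (p0 : 'S_(k0 + (n.+1 - k0))) (a : nat).
Hypotheses (akl : (a.+1 < k0 + (n.+1 - k0))%N).
Hypotheses (sp0 : shuffle p0) (pa : sword p0 a) (pSa : ~~ sword p0 a.+1).
Let w0 := sword p0.
Let an : (a.+1 < n.+1)%N.
Proof. by move: akl; rewrite subnKC // -ltnS. Qed.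
Let l0 := (n.+1 - k0)%N.

(** Reads off the coefficient of the face d_{a+1} of the [p0] term. In that face the merged edge a
    is collapsed in neither factor, which no shuffle allows. *)
Definition strip_swap : {linear T n -> tens (A k0) (A' l0)} :=
  tmap (strip A (wdel a.+1 w0) n n k0) (strip A' (wdel a.+1 (wneg w0)) n n l0).

Lemma strip_swap_degenerate x : x \in degenerate T n -> strip_swap x = 0.
Proof. by apply: strip_degenerate => t _; apply: wdel_neg_disjoint. Qed.

(** The edge a is collapsed in one of the two factors, and neither stripping word contains it. *)
Lemma strip_swap_wpair w k l z : strip_swap (wpair A A' w k l n z) = 0.
Proof.
rewrite /strip_swap /wpair tmap_comp; have [wa|wa] := boolP (w a).
  apply: tmap_0l => x /=; apply: (@strip_wdegens_kill _ _ _ _ _ _ _ _ a) => //.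
  by rewrite wdel_eq /w0 (negbTE pSa) andbF.
apply: tmap_0r => x /=; apply: (@strip_wdegens_kill _ _ _ _ _ _ _ _ a) => //.
by rewrite wdel_eq /wneg /w0 pa.
Qed.

(** By [wdel_sub], for any other face or word some collapsed edge falls outside the stripping word
    of its factor, and [strip] kills that factor. *)
Lemma strip_swap_face0 w i k l z : (i <= n.+1)%N ->
  ~ (i = a.+1 /\ ((forall t, t < n.+1 -> w t = w0 t)%N \/
               (forall t, t < n.+1 -> w t = w0 (swapn a t))%N)) ->
  strip_swap (face T n i (wpair A A' w k l n.+1 z)) = 0.
Proof.
move=> iS nw; have ijn : (i <= n.+1 <= n.+1)%N by rewrite iS /=.
have kill (B : simplicial_module K) (v v0 : pred nat) m m' (x : B m) :
    (exists t, [/\ (t < n)%N, wdel i v t & ~~ wdel a.+1 v0 t]) ->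
    strip B (wdel a.+1 v0) n n m' (face B n i (wdegens B v n.+1 m n.+1 x)) = 0.
  case=> t [tn vt v0t]; have [m'' [y ->]] := @face_wdegens_ex _ B v i n.+1 m n x ijn.
  exact: strip_wdegens_kill tn vt v0t.
rewrite /strip_swap -[face T n i _]/(tmap _ _ _) /wpair !tmap_comp.
have [h|h] := EM (exists t, [/\ (t < n)%N, wdel i w t & ~~ wdel a.+1 w0 t]).
  by apply: tmap_0l => x; apply: kill.
have [h'|h'] := EM (exists t, [/\ (t < n)%N, wdel i (wneg w) t & ~~ wdel a.+1 (wneg w0) t]).
  by apply: tmap_0r => x; apply: kill.
case: nw; apply: wdel_sub => // t tn wt; apply/negPn/negP => nt.
  by apply: h; exists t.
by apply: h'; exists t.
Qed.

Lemma strip_swap_face1 w z :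
  (forall t, t < n.+1 -> w t = w0 t)%N \/ (forall t, t < n.+1 -> w t = w0 (swapn a t))%N ->
  strip_swap (face T n a.+1 (wpair A A' w k0 l0 n.+1 (inclT k0 l0 z))) = inclT k0 l0 z.
Proof.
move=> wE; rewrite /strip_swap -[face T n a.+1 _]/(tmap _ _ _) /wpair !tmap_comp.
have Sa : swapn a a = a.+1 by rewrite /swapn eqxx.
have SSa : swapn a a.+1 = a by rewrite /swapn gtn_eqF // eqxx.
have aS : (a < n.+1)%N by apply: ltnW.
have wdelE := wdel_swapn wE.
have wdelE' : forall t, (t < n)%N -> wdel a.+1 (wneg w) t = wdel a.+1 (wneg w0) t.
  by apply: wdel_swapn; case: wE => h; [left|right] => t /h; rewrite /wneg => ->.
have [kE lE] := shuffle_counts sp0.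
have strip1 (B : simplicial_module K) (v v0 : pred nat) m (c : moore B m) :
    (forall t, (t < n)%N -> wdel a.+1 v t = wdel a.+1 v0 t) ->
    wmerge a.+1 n.+1 v -> wmerge a.+1 n.+1 v0 -> (m + wcount v0 n.+1)%N = n.+1 ->
    strip B (wdel a.+1 v0) n n m
      (face B n a.+1 (wdegens B v n.+1 m n.+1 (val c))) = val c.
  move=> vE vm v0m mE; rewrite face_wdegens_merge //; last by rewrite ltnW //= leqnn.
  rewrite (@eq_wdegens _ B _ (wdel a.+1 v0)) //; apply: strip_wdegens => //.
  by move: mE; rewrite -(wcount_wdel (ltnW an) v0m) /= addnS => -[].
have m0 : wmerge a.+1 n.+1 w0 by rewrite wmergeE // /w0 pa.
have m0' : wmerge a.+1 n.+1 (wneg w0) by rewrite wmergeE // /wneg /w0 pa pSa.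
have wx : w a = ~~ w a.+1.
  by case: wE => h; rewrite !h // ?Sa ?SSa /w0 pa (negbTE pSa).
apply: eq_tmap => x /=; apply: strip1 => //; rewrite wmergeE // ?/wneg wx.
  by case: (w a.+1).
by case: (w a.+1).
Qed.

(** Apply [strip_swap] to the boundary. The shuffles of [v] and the degenerate part disappear, and
    on the other side only the faces d_{a+1} of [p0] and of its swap remain, each returning its own
    coefficient; so the two coefficients add up to 0. *)
Lemma shuffle_sum_swap (u : forall k : 'I_n.+2, 'S_(k + (n.+1 - k)) ->
      tens (moore A k) (moore A' (n.+1 - k)%N))
    (v : forall k : 'I_n.+1, 'S_(k + (n - k)) -> tens (A k) (A' (n - k)%N)) :
  alt_face T n (shuffle_sum (fun k p => inclT k (n.+1 - k)%N (u k p))) - shuffle_sum v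
    \in degenerate T n ->
  u k0 (swap_shuffle p0 akl) = - u k0 p0.
Proof.
move=> /strip_swap_degenerate; rewrite linearB => /eqP; rewrite subr_eq0 => /eqP e.
have v0 : strip_swap (shuffle_sum v) = 0.
  rewrite /shuffle_sum linear_sum big1 // => k _; rewrite linear_sum big1 // => p _.
  exact: strip_swap_wpair.
pose Ss := shuffle_sum (fun k p => inclT k (n.+1 - k)%N (u k p)).
have face0 i : (i <= n.+1)%N -> i != a.+1 -> strip_swap (face T n i Ss) = 0.
  move=> iS /eqP ia; rewrite /Ss /shuffle_sum !linear_sum big1 // => k _.
  rewrite !linear_sum big1 // => p sp; apply: strip_swap_face0 => //.
  by case=> /ia.
have aS : (a.+1 < n.+2)%N by rewrite ltnW.
have face1 : strip_swap (face T n a.+1 Ss) = 0.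
  apply: (@alternating_sum_single _ (fun i => strip_swap (face T n i Ss)) n.+2) => //.
  rewrite -[RHS]v0 -[RHS]e (alt_faceE (B := T)) (linear_sum strip_swap).
  by apply: eq_bigr => i _; rewrite (linearZ_LR strip_swap).
have sp1 : shuffle (swap_shuffle p0 akl).
  by apply: shuffle_swap => //; rewrite pa (negbTE pSa).
have w1 t : sword (swap_shuffle p0 akl) t = w0 (swapn a t) by apply: sword_swap.
have p10 : swap_shuffle p0 akl != p0.
  by apply: contraTneq pa => <-; rewrite sword_swap /swapn eqxx.
pose Phi : {linear T n.+1 -> tens (A k0) (A' l0)} := strip_swap \o face T n a.+1.
have : Phi Ss = 0 by [].
rewrite (@linear_shuffle_sum _ _ Phi _ k0) => [|k p kk0 sp]; last first.
  apply: strip_swap_face0 => // -[_ [] h]; case/eqP: kk0.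
    exact: word_count_inj sp sp0 h.
  by apply: word_count_inj sp sp1 _ => t /h; rewrite w1.
rewrite (big_two sp0 sp1 p10) => [|p sp pp0 pp1].
  rewrite /Phi -[X in X + _]/(strip_swap _) -[X in _ + X]/(strip_swap _).
  rewrite !strip_swap_face1; [|by right=> t _; apply: w1|by left].
  move=> /(congr1 (rhoT k0 l0)); rewrite linearD !rhoT_inclT linear0 addrC => /eqP.
  by rewrite addr_eq0 => /eqP.
apply: strip_swap_face0 => // -[_ [] h].
  by case/eqP: pp0; apply: sword_inj_ord sp sp0 h.
by case/eqP: pp1; apply: sword_inj_ord sp sp1 _ => t /h; rewrite w1.
Qed.
End Strip.
End SwapRelation.

(** * The box product of path pairs *)

Section TensorSubmodules.
Variable K : comNzRingType.

Lemma imsub_restr (V W : lmodType K) (f : {linear V -> W}) (S : submodClosed V) x :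
  x \in S -> f x \in imsub f S.
Proof. by move=> xS; apply/(in_submod_of (imsub_prop f S)); exists x. Qed.

Lemma tsub_imsubP (V V' W W' : lmodType K) (f : {linear V -> W}) (g : {linear V' -> W'})
    (S : submodClosed V) (S' : submodClosed V') z :
  z \in tsub (imsub f S) (imsub g S') <-> exists2 y, y \in tsub S S' & z = tmap f g y.
Proof.
pose rf := restr (@imsub_restr _ _ f S); pose rg := restr (@imsub_restr _ _ g S').
have vE y : tmap (\val : {linear subm (imsub f S) -> W}) (\val : {linear subm (imsub g S') -> W'})
    (tmap rf rg y) =
    tmap f g (tmap (\val : {linear subm S -> V}) (\val : {linear subm S' -> V'}) y).
  by rewrite !tmap_comp; apply: eq_tmap.
split=> [/(in_submod_of (rangesub_prop _)) [w ->]|[y /(in_submod_of (rangesub_prop _)) [w ->] ->]].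
  have rf_surj x : exists y, rf y = x.
    have /(in_submod_of (imsub_prop _ _)) [y yS yE] := valP x.
    by exists (Subm yS); apply: val_inj.
  have rg_surj x : exists y, rg y = x.
    have /(in_submod_of (imsub_prop _ _)) [y yS yE] := valP x.
    by exists (Subm yS); apply: val_inj.
  have [y <-] := tmap_surj rf_surj rg_surj w.
  exists (tmap (\val : {linear subm S -> V}) (\val : {linear subm S' -> V'}) y); last exact: vE.
  by apply/(in_submod_of (rangesub_prop _)); exists y.
by apply/(in_submod_of (rangesub_prop _)); exists (tmap rf rg w); rewrite vE.
Qed.

Lemma sumsub_term (V : lmodType K) (I : finType) (Q : pred I) (S : I -> submodClosed V) i x :
  Q i -> x \in S i -> x \in sumsub Q S.
Proof.
move=> Qi xS; apply/(in_submod_of (sumsub_prop _ _)).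
exists (fun j => if j == i then x else 0) => [j Qj|].
  by case: eqP => [->|_] //; apply: rpred0.
rewrite (bigD1 i) //= eqxx big1 ?addr0 // => j /andP[_ /negbTE->] //.
Qed.
End TensorSubmodules.

Section Box.
Variable K : comNzRingType.
Variables P P' : module_pair K.
Local Notation A := (ambient P).
Local Notation A' := (ambient P').
Local Notation T := (tens_simplicial A A').
Local Notation inclT k l := (tmap (moore_incl A k) (moore_incl A' l)).
Local Notation rhoT k l := (tmap (rho A k) (rho A' l)).
Local Notation red_tens k l := (tsub (reduced_paths P k) (reduced_paths P' l)).

Lemma diamond_repr n (y : T n) : y \in diamond (paths P) (paths P') n ->
  exists u : forall k : 'I_n.+1, 'S_(k + (n - k)) -> tens (A k) (A' (n - k)%N),
    (forall (k : 'I_n.+1) p, rhoT k (n - k)%N (u k p) \in red_tens k (n - k)%N) /\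
    y = shuffle_sum u.
Proof.
move=> /(in_submod_of (sumsub_prop _ _)) [f fP ->].
have uex (k : 'I_n.+1) : exists u : 'S_(k + (n - k)) -> tens (A k) (A' (n - k)%N),
    (forall p, rhoT k (n - k)%N (u p) \in red_tens k (n - k)%N) /\
    f k = \sum_(p | shuffle p) wpair A A' (sword p) k (n - k) n (u p).
  have /(in_submod_of (sumsub_prop _ _)) [g gP ->] := fP k isT.
  have gex p : exists u, rhoT k (n - k)%N u \in red_tens k (n - k)%N /\
      (shuffle p -> g p = wpair A A' (sword p) k (n - k) n u).
    have [sp|nsp] := boolP (shuffle p); last by exists 0; rewrite linear0 rpred0.
    have /tsub_imsubP [u uB gE] := gP p sp.
    exists u; split; first by apply/tsub_imsubP; exists u.
    by move=> _; rewrite gE shuffle_degensE // -ltnS.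
  have /choice [u uE] := gex; exists u; split=> [p|]; first by have [] := uE p.
  by apply: eq_bigr => p sp; have [_ ->] := uE p.
exists (fun k => projT1 (cid (uex k))); split=> [k p|].
  by have [h _] := projT2 (cid (uex k)); apply: h.
by apply: eq_bigr => k _; have [_ h] := projT2 (cid (uex k)); apply: etrans h _.
Qed.

(** Modulo degenerate elements, the tensor of reduced paths may be replaced by a tensor of paths
    that normalises to it; and a word with the right number of letters comes from a shuffle. *)
Lemma rho_wpair_box w k l n z : (k + wcount w n)%N = n -> (l + wcount (wneg w) n)%N = n ->
  z \in red_tens k l ->
  rho T n (wpair A A' w k l n (inclT k l z)) \in reduced_paths (box P P') n.
Proof.
move=> kE lE; have kln : (k + l)%N = n by have := wcount_neg w n; lia.
have {kln} [kn lnk] : (k < n.+1)%N /\ l = (n - k)%N by lia.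
subst l; move=> /tsub_imsubP [u uB ->].
have kn' : (k + (n - k))%N = n by rewrite subnKC // -ltnS.
have [|p sp pw] := @shuffle_of_word k (n - k) w; first by rewrite kn'; lia.
have -> : rho T n (wpair A A' w k (n - k) n (inclT k (n - k)%N (rhoT k (n - k)%N u))) =
    rho T n (wpair A A' w k (n - k) n u).
  by apply/esym/eqP; rewrite -subr_eq0 -linearB rho_degenerate //; apply: wpair_rho.
apply: imsub_restr; apply: (@sumsub_term _ _ _ _ _ (Ordinal kn)) => //.
apply: (@sumsub_term _ _ _ _ _ p) => //=; apply/tsub_imsubP; exists u => //.
rewrite shuffle_degensE //; apply: eq_tmap => x.
  by apply: eq_wdegens => t tn; rewrite pw // kn'.
by apply: eq_wdegens => t tn; rewrite /wneg pw // kn'.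
Qed.

Lemma rho_eq (B : simplicial_module K) n (x y : B n) :
  x - y \in degenerate B n -> rho B n x = rho B n y.
Proof. by move=> h; apply/eqP; rewrite -subr_eq0 -linearB rho_degenerate. Qed.

Lemma AW_component_rho n (y : T n) k l : (k + l)%N = n ->
  component k l (AW A A' n (rho T n y)) = rhoT k l (AW_component A A' n k l y).
Proof.
move=> e; rewrite -[LHS]/(rhoT k l (AW_component A A' n k l (val (rho T n y)))).
apply/esym/eqP; rewrite -subr_eq0 -!linearB; apply/eqP.
by apply: AW_degenerate e _; apply: rho_funP.
Qed.

Definition EZ_terms n (z : tens_complex (moore A) (moore A') n) (k : 'I_n.+1)
    (p : 'S_(k + (n - k))) : tens (moore A k) (moore A' (n - k)%N) :=
  (-1) ^+ p *: component k (n - k) z.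

Lemma EZ_shuffle_sum n z :
  EZ A A' n z = rho T n (shuffle_sum (fun k p => inclT k (n - k)%N (EZ_terms z p))).
Proof.
congr (rho T n _); apply: eq_bigr => k _; apply: eq_bigr => p sp.
rewrite /EZ_terms 2!linearZ_LR; congr (_ *: _).
by rewrite -shuffle_degensE // -ltnS.
Qed.

Lemma tens_complex_eq (C C' : complex K) n (x y : tens_complex C C' n) :
  (forall k : 'I_n.+1, component k (n - k) x = component k (n - k) y) -> x = y.
Proof.
move=> h; apply: dsum_eq => k l /eqP e.
have kn : (k < n.+1)%N by lia.
have -> : l = (n - k)%N by lia.
exact: (h (Ordinal kn)).
Qed.

Lemma AW_EZ n z : AW A A' n (EZ A A' n z) = z.
Proof.
apply: tens_complex_eq => k; rewrite EZ_shuffle_sum AW_component_rho; last first.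
  by rewrite subnKC // -ltnS.
by rewrite AW_shuffle_sum rhoT_inclT /EZ_terms odd_perm1 expr0 scale1r.
Qed.

Lemma reduced_box_repr n (x : moore T n) : x \in reduced_paths (box P P') n ->
  exists u : forall k : 'I_n.+1, 'S_(k + (n - k)) -> tens (moore A k) (moore A' (n - k)%N),
    (forall (k : 'I_n.+1) p, u k p \in red_tens k (n - k)%N) /\
    val x - shuffle_sum (fun k p => inclT k (n - k)%N (u k p)) \in degenerate T n.
Proof.
move=> /(in_submod_of (imsub_prop _ _)) [y /diamond_repr [u [uB ->]] ->].
exists (fun (k : 'I_n.+1) p => rhoT k (n - k)%N (u k p)); split=> //.
rewrite -[X in X - _](subrK (shuffle_sum u)) -addrA rpredD //.
  by rewrite -opprB submodN // rho_funP.
rewrite /shuffle_sum -sumrB rpred_sum // => k _; rewrite -sumrB rpred_sum // => p sp.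
by have [h1 h2] := shuffle_counts sp; apply: wpair_rho.
Qed.

(** Alpha reads off the coefficient of the trivial shuffle, and the representing coefficients are
    made of reduced paths. *)
Lemma AW_reduced n (x : moore T n) k l : x \in reduced_paths (box P P') n ->
  component k l (AW A A' n x) \in red_tens k l.
Proof.
move=> /reduced_box_repr [u [uB xu]].
have [e|ne] := eqVneq (k + l)%N n; last by rewrite component_off // rpred0.
have kn : (k < n.+1)%N by lia.
have lE : l = (n - k)%N by lia.
subst l; rewrite -(rho_moore x) (rho_eq xu) AW_component_rho //.
have := AW_shuffle_sum (fun (k : 'I_n.+1) p => inclT k (n - k)%N (u k p)) (Ordinal kn).
by rewrite rhoT_inclT => E; rewrite [X in X \in _]E; apply: (uB (Ordinal kn)).
Qed.

Lemma EZ_AW n (x : moore T n) : x \in omega_sub (reduced_paths (box P P')) n ->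
  EZ A A' n (AW A A' n x) = x.
Proof.
move=> /(in_submod_of (omega_prop _ _)) [/reduced_box_repr [u [uB xu]] dx].
have uswap (k : 'I_n.+1) p : shuffle p -> u k p = (-1) ^+ p *: u k 1%g.
  apply: alternating_shuffle => {}p a akl sp pa pSa.
  case: n x u uB xu dx k p akl sp pa pSa => [|n] x u uB xu dx k p akl sp pa pSa.
    by exfalso; move: akl; rewrite (ord1 k).
  have /reduced_box_repr [v [_ xv]] := dx.
  apply: (@shuffle_sum_swap _ _ _ n k p a akl sp pa pSa u
    (fun (k : 'I_n.+1) p => inclT k (n - k)%N (v k p))).
  rewrite -[X in X - _](addrNK (alt_face T n (val x))) -addrA rpredD //.
  by rewrite -linearB -opprB linearN submodN // alt_face_degenerate.
have xE : x = rho T n (shuffle_sum (fun k p => inclT k (n - k)%N (u k p))).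
  by rewrite -(rho_eq xu) rho_moore.
rewrite [RHS]xE EZ_shuffle_sum; congr (rho T n _).
apply: eq_bigr => k _; apply: eq_bigr => p sp; congr (wpair _ _ _ _ _ _ (tmap _ _ _)).
rewrite uswap // /EZ_terms; congr (_ *: _).
rewrite xE AW_component_rho; last by rewrite subnKC // -ltnS.
by rewrite AW_shuffle_sum rhoT_inclT.
Qed.

Lemma reduced_box_sum n (I : finType) (Q : pred I) (F : I -> T n) :
  (forall i, Q i -> rho T n (F i) \in reduced_paths (box P P') n) ->
  rho T n (\sum_(i | Q i) F i) \in reduced_paths (box P P') n.
Proof. by move=> h; rewrite linear_sum rpred_sum. Qed.

Lemma reduced_box0 n (x : T n) : x = 0 -> rho T n x \in reduced_paths (box P P') n.
Proof. by move->; rewrite linear0 rpred0. Qed.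

Lemma EZ_reduced n z :
  (forall k l, component k l z \in red_tens k l) ->
  EZ A A' n z \in reduced_paths (box P P') n.
Proof.
move=> zB; rewrite EZ_shuffle_sum; apply: reduced_box_sum => k _.
apply: reduced_box_sum => p sp; have [kE lE] := shuffle_counts sp.
apply: rho_wpair_box kE lE _; rewrite /EZ_terms; apply: rpredZ; apply: zB.
Qed.

(** In one of the factors no edge at the vertex i is collapsed. There d_i reaches the Moore element,
    with positive index because the edge before i survives, and vanishes. *)
Lemma face_moore_wpair w k l n i (x : moore A k) (y : moore A' l) :
  (k + wcount w n.+1)%N = n.+1 -> (l + wcount (wneg w) n.+1)%N = n.+1 ->
  (0 < i <= n.+1)%N -> (i = n.+1 \/ w i.-1 = w i) ->
  face T n i (wpair A A' w k l n.+1 (tpure (val x) (val y))) = 0.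
Proof.
have kill (B : simplicial_module K) v m (c : moore B m) :
    (m + wcount v n.+1)%N = n.+1 -> (0 < i <= n.+1)%N -> ~~ v i.-1 -> ~~ wmerge i n.+1 v ->
    face B n i (wdegens B v n.+1 m n.+1 (val c)) = 0.
  move=> mE iS vi vm; case: m c mE => [|m] c mE.
    exfalso; have : (wcount v n.+1 < n.+1)%N.
      by apply: (@wcount_lt _ _ i.-1) vi; clear -iS; lia.
    by clear -mE; lia.
  rewrite face_wdegens_nomerge //; [|by clear -iS; lia|by clear -mE; lia].
  rewrite moore_face ?linear0 //.
  have h : (wcount v i < i)%N by apply: (@wcount_lt _ _ i.-1) vi; clear -iS; lia.
  have h' : (i - wcount v i <= m.+1)%N.
    have : (i <= n.+1)%N by clear -iS; lia.
    move/(wcount_leq (wneg v)); have := wcount_neg v i; have := wcount_neg v n.+1.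
    by clear -mE; lia.
  by clear -h h' ; lia.
move=> kE lE iS wi; rewrite -[face T n i _]/(tmap _ _ _) /wpair !tmapE.
have nm v : ~~ v i.-1 -> i = n.+1 \/ v i.-1 = v i -> ~~ wmerge i n.+1 v.
  move=> vi h; rewrite /wmerge (negbTE vi) andbF /=; case: h => [->|<-].
    by rewrite ltnn.
  by rewrite (negbTE vi) andbF.
have [wi1|wi1] := boolP (w i.-1).
  rewrite [X in tpure _ X]kill ?tpure0r //; first by rewrite /wneg wi1.
  apply: nm; first by rewrite /wneg wi1.
  by case: wi => [|wi]; [left | right; rewrite /wneg wi].
by rewrite [X in tpure X _]kill ?tpure0l //; apply: nm.
Qed.

Lemma face_inclT_wpair w k l n i z :
  (k + wcount w n.+1)%N = n.+1 -> (l + wcount (wneg w) n.+1)%N = n.+1 ->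
  (0 < i <= n.+1)%N -> (i = n.+1 \/ w i.-1 = w i) ->
  face T n i (wpair A A' w k l n.+1 (inclT k l z)) = 0.
Proof.
move=> kE lE iS wi; elim/tens_ind: z => [x y|a u v hu hv].
  by rewrite [inclT k l _]tmapE; apply: face_moore_wpair.
by rewrite !linearP hu hv scaler0 addr0.
Qed.

(** The vertex 0 has a single edge, collapsed in exactly one factor. In that factor d_0 cancels the
    degeneracy; in the other it reaches the Moore element, on which it is the differential. *)
Lemma rho_face0_wpair w k l n z :
  (k + wcount w n.+1)%N = n.+1 -> (l + wcount (wneg w) n.+1)%N = n.+1 ->
  tmap (bd_out (moore A) k) idfun z \in red_tens k.-1 l ->
  tmap idfun (bd_out (moore A') l) z \in red_tens k l.-1 ->
  rho T n (face T n 0 (wpair A A' w k l n.+1 (inclT k l z))) \in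
    reduced_paths (box P P') n.
Proof.
move=> kE lE dzl dzr; rewrite -[face T n 0 _]/(tmap _ _ _) /wpair tmap_comp.
have ijn : (0 <= n.+1 <= n.+1)%N by rewrite leqnn.
have [w0|w0] := boolP (w 0).
  have m1 : wmerge 0 n.+1 w by rewrite /wmerge w0.
  have m2 : ~~ wmerge 0 n.+1 (wneg w) by rewrite /wmerge /wneg w0.
  have c1 : (wcount (wdel 0 w) n).+1 = wcount w n.+1 := wcount_wdel (leq0n n.+1) m1.
  have c2 := wcount_neg (wdel 0 w) n.
  case: l lE z dzl dzr => [|l] lE z dzl dzr.
    by exfalso; have := wcount_neg w n.+1; clear -lE c1; lia.
  have -> : tmap (face A n 0 \o wdegens A w n.+1 k n.+1)
      (face A' n 0 \o wdegens A' (wneg w) n.+1 l.+1 n.+1) (inclT k l.+1 z) =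
      wpair A A' (wdel 0 w) k l n (inclT k l (tmap idfun (bd (moore A') l) z)).
    rewrite /wpair !tmap_comp; apply: eq_tmap => x /=.
      exact: face_wdegens_merge.
    rewrite face_wdegens_nomerge //; last by clear -lE; lia.
    by rewrite sub0n; congr (wdegens _ _ _ _ _ _); apply/esym/moore_faceE/valP.
  apply: rho_wpair_box dzr; have := wcount_neg w n.+1; clear -kE lE c1 c2; lia.
have m1 : ~~ wmerge 0 n.+1 w by rewrite /wmerge w0.
have m2 : wmerge 0 n.+1 (wneg w) by rewrite /wmerge /wneg w0.
have c1 : (wcount (wneg (wdel 0 w)) n).+1 = wcount (wneg w) n.+1.
  exact: wcount_wdel (leq0n n.+1) m2.
have c2 := wcount_neg (wdel 0 w) n.
case: k kE z dzl dzr => [|k] kE z dzl dzr.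
  by exfalso; have := wcount_neg w n.+1; clear -kE c1; lia.
have -> : tmap (face A n 0 \o wdegens A w n.+1 k.+1 n.+1)
    (face A' n 0 \o wdegens A' (wneg w) n.+1 l n.+1) (inclT k.+1 l z) =
    wpair A A' (wdel 0 w) k l n (inclT k l (tmap (bd (moore A) k) idfun z)).
  rewrite /wpair !tmap_comp; apply: eq_tmap => x /=; last exact: face_wdegens_merge.
  rewrite face_wdegens_nomerge //; last by clear -kE; lia.
  by rewrite sub0n; congr (wdegens _ _ _ _ _ _); apply/esym/moore_faceE/valP.
apply: rho_wpair_box dzl; have := wcount_neg w n.+1; clear -kE lE c1 c2; lia.
Qed.

Lemma big_sub0 (V : nmodType) (I : finType) (Q D : pred I) (F : I -> V) :
  \sum_(x | D x) F x = 0 -> (forall x, D x -> Q x) ->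
  (forall x, Q x -> ~~ D x -> F x = 0) -> \sum_(x | Q x) F x = 0.
Proof.
move=> D0 DQ F0; rewrite (bigID D) /= [X in _ + X]big1 => [|x /andP[/F0]//].
rewrite addr0 (eq_bigl D) // => x.
by apply/andP/idP => [[]//|Dx]; split=> //; apply: DQ.
Qed.

Lemma big_sign_reversing (V : zmodType) (I : finType) (s : I -> I) (Q D : pred I)
    (F : I -> V) : involutive s -> (forall x, Q x -> Q (s x)) ->
  (forall x, Q x -> D (s x) = ~~ D x) -> (forall x, Q x -> F (s x) = - F x) ->
  \sum_(x | Q x) F x = 0.
Proof.
move=> sK Qs Ds Fs; rewrite (bigID D) /= [X in _ + X](reindex_inj (inv_inj sK)) /=.
rewrite [X in _ + X](eq_bigl (fun x => Q x && D x)) => [|x].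
  by rewrite -big_split big1 // => x /andP[Qx _]; rewrite Fs //; apply: subrr.
have [Qx|nQx] := boolP (Q x); first by rewrite Qs // Ds // negbK.
by rewrite (_ : Q (s x) = false) //; apply: contraNF nQx => /Qs; rewrite sK.
Qed.

(** Exchanging a and a + 1 keeps both merged words, hence the face d_{a+1}, and reverses the sign of
    the shuffle. *)
Lemma face_swap_cancel n k l (a : nat) (akl : (a.+1 < k + l)%N)
    (z : tens (moore A k) (moore A' l)) :
  (k + l)%N = n.+1 ->
  \sum_(p : 'S_(k + l) | shuffle p && (sword p a != sword p a.+1))
    face T n a.+1 (wpair A A' (sword p) k l n.+1 (inclT k l ((-1) ^+ p *: z))) = 0.
Proof.
move=> kln; have an : (a.+1 < n.+1)%N by rewrite -kln.
pose F (p : 'S_(k + l)) :=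
  face T n a.+1 (wpair A A' (sword p) k l n.+1 (inclT k l ((-1) ^+ p *: z))).
have Sa : swapn a a = a.+1 by rewrite /swapn eqxx.
have SSa : swapn a a.+1 = a by rewrite /swapn gtn_eqF // eqxx.
have Fswap p : sword p a != sword p a.+1 -> F (swap_shuffle p akl) = - F p.
  move=> pa; rewrite /F odd_swap signrN scaleNr !linearN; congr (- _).
  rewrite -[face T n a.+1 _]/(tmap _ _ _) -[face T n a.+1 _ in RHS]/(tmap _ _ _) /wpair !tmap_comp.
  have wE : forall t, (t < n.+1)%N -> sword (swap_shuffle p akl) t = sword p (swapn a t).
    by move=> t _; apply: sword_swap.
  have m1 : wmerge a.+1 n.+1 (sword p).
    by rewrite wmergeE //; move: pa; do 2!case: sword.
  have m2 : wmerge a.+1 n.+1 (wneg (sword p)).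
    by rewrite wmergeE // /wneg; move: pa; do 2!case: sword.
  have m1' : wmerge a.+1 n.+1 (sword (swap_shuffle p akl)).
    by rewrite wmergeE // !sword_swap Sa SSa orbC -(wmergeE _ an).
  have m2' : wmerge a.+1 n.+1 (wneg (sword (swap_shuffle p akl))).
    by rewrite wmergeE // /wneg !sword_swap Sa SSa orbC -(wmergeE (wneg (sword p)) an).
  have ijn : (a.+1 <= n.+1 <= n.+1)%N by rewrite ltnW //= leqnn.
  apply: eq_tmap => x /=; rewrite !face_wdegens_merge //; apply: eq_wdegens.
    by apply: wdel_swapn; right.
  by apply: wdel_swapn; right=> t /wE; rewrite /wneg => ->.
have swapK : involutive (fun p : 'S_(k + l) => swap_shuffle p akl).
  by move=> p; rewrite /swap_shuffle -mulgA tperm2 mulg1.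
apply: (big_sign_reversing (F := F) (D := fun p => sword p a) swapK).
- by move=> p /andP[sp pa]; rewrite shuffle_swap // !sword_swap Sa SSa eq_sym.
- by move=> p /andP[_]; rewrite sword_swap Sa; do 2!case: sword.
by move=> p /andP[_]; apply: Fswap.
Qed.

(** The face d_0 yields reduced paths by the two hypotheses on differentiated factors, and the last
    face vanishes on Moore elements. An inner face d_{a+1} vanishes on shuffles with a and a + 1 in
    the same part and cancels in pairs on the others. *)
Lemma EZ_bd_reduced n z :
  (forall k l, component k l z \in red_tens k l) ->
  (forall k l, tmap (bd_out (moore A) k) idfun (component k l z) \in red_tens k.-1 l) ->
  (forall k l, tmap idfun (bd_out (moore A') l) (component k l z) \in red_tens k l.-1) ->
  EZ A A' n z \in omega_sub (reduced_paths (box P P')) n.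
Proof.
move=> zB zl zr; apply/(in_submod_of (omega_prop _ _)); split; first exact: EZ_reduced.
case: n z zB zl zr => [|n] z zB zl zr; first exact: rpred0.
pose Y := shuffle_sum (fun k p => inclT k (n.+1 - k)%N (EZ_terms z p)).
have -> : bd_out (moore T) n.+1 (EZ A A' n.+1 z) = rho T n (alt_face T n Y).
  by rewrite rho_alt_face EZ_shuffle_sum.
rewrite alt_faceE; apply: reduced_box_sum => i _.
rewrite linearZ_LR; apply: rpredZ; rewrite /Y /shuffle_sum linear_sum.
apply: reduced_box_sum => k _; rewrite linear_sum.
have kn : (k + (n.+1 - k))%N = n.+1 by rewrite subnKC // -ltnS.
case: (posnP i) => [->|i0].
  apply: reduced_box_sum => p sp; have [kE lE] := shuffle_counts sp.
  apply: (rho_face0_wpair kE lE); rewrite /EZ_terms linearZ_LR; apply: rpredZ.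
    exact: zl.
  exact: zr.
have iS : (0 < i <= n.+1)%N by rewrite i0 -ltnS ltn_ord.
have [ein|nin] := eqVneq (i : nat) n.+1.
  apply: reduced_box0; apply: big1 => p sp; have [kE lE] := shuffle_counts sp.
  by apply: face_inclT_wpair => //; left.
case: (nat_of_ord i) i0 iS nin => // a _ iS nin.
have akl : (a.+1 < k + (n.+1 - k))%N by rewrite kn ltn_neqAle nin; case/andP: iS.
apply: reduced_box0.
apply: (big_sub0 (face_swap_cancel akl (component k (n.+1 - k) z) kn)) => [p /andP[]//|p sp].
rewrite sp /= => /negPn/eqP pa; have [kE lE] := shuffle_counts sp.
by apply: face_inclT_wpair => //; right.
Qed.
End Box.

(** * Kernels inside a tensor product of submodules *)

Section Summands.
Variable K : comNzRingType.

Lemma summand_retraction (V : lmodType K) (S : submodClosed V) : direct_summand S ->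
  exists r : {linear V -> subm S}, forall s, r (val s) = s.
Proof.
case=> T [disj dec]; have dec' x : exists s : subm S, x - val s \in T.
  by have [s [t [sS tT ->]]] := dec x; exists (Subm sS); rewrite /= addrC addKr.
pose r x := projT1 (cid (dec' x)).
have rT x : x - val (r x) \in T by apply: projT2 (cid (dec' x)).
have r_uniq x (s : subm S) : x - val s \in T -> r x = s.
  move=> sT; apply/val_inj/eqP; rewrite -subr_eq0; apply/eqP/disj.
    by apply: submodB; apply: valP.
  by have := submodB sT (rT x); rewrite opprB addrC addrA addrNK addrC.
have r_lin : linear r.
  move=> a x y; apply: r_uniq.
  have -> : val (a *: r x + r y) = a *: val (r x) + val (r y) by [].
  rewrite opprD addrACA -scalerBr.
  by apply: submodL; apply: rT.
pose rl : {linear V -> subm S} := HB.pack r (GRing.isLinear.Build K V (subm S) *:%R r r_lin).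
by exists rl => s; apply: r_uniq; rewrite subrr rpred0.
Qed.

Lemma summand_quotient_iso (V : lmodType K) (S : submodClosed V) : direct_summand S ->
  exists T : submodClosed V, lin_iso (subm T) (quotm S).
Proof.
case=> T [disj dec]; exists T, (qproj S \o (\val : {linear subm T -> V})).
apply: inj_surj_bij => [t /= e|q].
  apply: val_inj; apply: disj (valP t).
  by move: e; rewrite -(linear0 (qproj S)) => /qproj_eq; rewrite subr0.
have [x <-] := qproj_surj q; have [s [t [sS tT ->]]] := dec x.
exists (Subm tT); apply/qproj_eq => /=.
by rewrite opprD addrCA subrr addr0 submodN.
Qed.

Lemma tsub_tmap (V V' W W' : lmodType K) (f : {linear V -> W}) (g : {linear V' -> W'})
    (S : submodClosed V) (S' : submodClosed V') (U : submodClosed W) (U' : submodClosed W') z :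
  (forall x, x \in S -> f x \in U) -> (forall x, x \in S' -> g x \in U') ->
  z \in tsub S S' -> tmap f g z \in tsub U U'.
Proof.
move=> fU gU /(in_submod_of (rangesub_prop _)) [w ->].
apply/(in_submod_of (rangesub_prop _)); exists (tmap (restr fU) (restr gU) w).
by rewrite !tmap_comp; apply: eq_tmap.
Qed.

Lemma tsub_kill_l (V V' W W' : lmodType K) (f : {linear V -> W}) (g : {linear V' -> W'})
    (S : submodClosed V) (S' : submodClosed V') z :
  (forall x, x \in S -> f x = 0) -> z \in tsub S S' -> tmap f g z = 0.
Proof.
move=> f0 /(in_submod_of (rangesub_prop _)) [w ->]; rewrite tmap_comp.
by apply: tmap_0l => x; apply: f0; apply: valP.
Qed.

Lemma tsub_kill_r (V V' W W' : lmodType K) (f : {linear V -> W}) (g : {linear V' -> W'})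
    (S : submodClosed V) (S' : submodClosed V') z :
  (forall x, x \in S' -> g x = 0) -> z \in tsub S S' -> tmap f g z = 0.
Proof.
move=> g0 /(in_submod_of (rangesub_prop _)) [w ->]; rewrite tmap_comp.
by apply: tmap_0r => x; apply: g0; apply: valP.
Qed.

(** The factors are cut down one at a time. Flatness of S' moves the element into Om (x) S'.
    Flatness of W' makes Om (x) W' -> V (x) W' injective, so the second condition can be tested over
    Om, and flatness of Om moves the element into Om (x) Om'. *)
Lemma tsub_kernel (V V' W W' : lmodType K) (f : {linear V -> W}) (f' : {linear V' -> W'})
    (S Om : submodClosed V) (S' Om' : submodClosed V') z :
  (forall x, x \in Om <-> x \in S /\ f x = 0) ->
  (forall x, x \in Om' <-> x \in S' /\ f' x = 0) ->
  direct_summand S' -> free_module (subm S') -> free_module (subm Om) -> free_module W' ->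
  z \in tsub S S' -> tmap f idfun z = 0 -> tmap idfun f' z = 0 -> z \in tsub Om Om'.
Proof.
move=> OmE Om'E S'_summand S'_free Om_free W'_free.
move=> /(in_submod_of (rangesub_prop _)) [w ->] fz f'z.
pose vS := (\val : {linear subm S -> V}); pose vS' := (\val : {linear subm S' -> V'}).
pose vO := (\val : {linear subm Om -> V}); pose vO' := (\val : {linear subm Om' -> V'}).
have OmS x : x \in Om -> idfun x \in S by case/OmE.
have Om'S x : x \in Om' -> idfun x \in S' by case/Om'E.
pose j := restr OmS; pose j' := restr Om'S.
have [r rE] := summand_retraction S'_summand.
(* The retraction onto S' carries the vanishing from W (x) V' to W (x) S'. *)
have fw : tmap (f \o vS) (@idfun (subm S')) w = 0.
  transitivity (tmap (@idfun W) r (tmap f (@idfun V') (tmap vS vS' w))).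
    by rewrite !tmap_comp; apply: eq_tmap => // x; rewrite /= rE.
  by rewrite fz linear0.
have [|w1 w1E] := flat_exactl (j := j) S'_free _ fw.
  move=> x fx; have xO : val x \in Om by apply/OmE; split; [apply: valP | ].
  by exists (Subm xO); apply: val_inj.
have fw1 : tmap (@idfun (subm Om)) (f' \o vS') w1 = 0.
  apply: (@flat_injl _ _ _ _ vO W'_free); first exact: val_inj.
  rewrite linear0 -[RHS]f'z -w1E !tmap_comp; exact: eq_tmap.
have [|w2 w2E] := flat_exactr (j := j') Om_free _ fw1.
  move=> x fx; have xO : val x \in Om' by apply/Om'E; split; [apply: valP | ].
  by exists (Subm xO); apply: val_inj.
apply/(in_submod_of (rangesub_prop _)); exists w2.
by rewrite -w1E -w2E !tmap_comp; apply: eq_tmap.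
Qed.
End Summands.

Lemma homology_iso (K : comNzRingType) (C D : complex K)
    (f : forall n, {linear C n -> D n}) (g : forall n, {linear D n -> C n}) :
  chain_map f -> chain_map g -> (forall n, cancel (f n) (g n)) -> (forall n, cancel (g n) (f n)) ->
  forall n, lin_iso (homology C n) (homology D n).
Proof.
move=> fc gc fK gK n.
have f_out x : bd_out C n x = 0 -> bd_out D n (f n x) = 0.
  by case: n x => [//|n] x /= e; rewrite -fc e linear0.
have g_out x : bd_out D n x = 0 -> bd_out C n (g n x) = 0.
  by case: n x {f_out} => [//|n] x /= e; rewrite -gc e linear0.
have fz x : x \in kersub (bd_out C n) -> f n x \in kersub (bd_out D n).
  by move=> /(in_submod_of (kersub_prop _)) h; apply/(in_submod_of (kersub_prop _)); apply: f_out.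
apply: (quotient_iso (f := cycle_class D n \o restr fz)) => [z|h].
  split=> [/(in_submod_of (presub_prop _ _))/(in_submod_of (rangesub_prop _)) [x xE]|].
    by apply/cycle_class0; exists (f n.+1 x); rewrite -fc -[bd C n x]xE.
  move=> /cycle_class0 [x xE].
  apply/(in_submod_of (presub_prop _ _))/(in_submod_of (rangesub_prop _)).
  exists (g n.+1 x); rewrite -gc xE /=; exact: esym (fK n _).
have [z <-] := cycle_class_surj h.
have [y yE] := kersub_lift (g_out _ (kersub_val z)).
exists y; rewrite /=; congr (qproj _ _); apply: val_inj.
by rewrite /= -[subm_val y]/(val y) yE gK.
Qed.

Lemma short_exact_iso (K : comNzRingType) (U V V' W : lmodType K)
    (f : {linear U -> V}) (g : {linear V -> W}) : short_exact f g -> lin_iso V V' ->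
  exists (f' : {linear U -> V'}) (g' : {linear V' -> W}), short_exact f' g'.
Proof.
move=> [finj ex gsurj] [h /linear_bij_inv [h' [hK h'K]]].
exists (h \o f), (g \o h'); split=> [x y /= /(can_inj hK)/finj//|v|w].
  rewrite /= ex; split=> [[u uE]|[u ->]]; exists u; last by rewrite hK.
  by rewrite -uE h'K.
by have [v ->] := gsurj w; exists (h v); rewrite /= hK.
Qed.

(** * The maps between the path complexes *)

Section OmegaOfBox.
Variable K : idomainType.
Hypothesis K_pid : principal_ideal_domain K.
Variables P P' : module_pair K.
Hypothesis A_free : forall n, free_module (ambient P n).
Hypothesis A'_free : forall n, free_module (ambient P' n).
Hypothesis B'_summand : forall n, direct_summand (reduced_paths P' n).
Local Notation A := (ambient P).
Local Notation A' := (ambient P').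
Local Notation red_tens k l := (tsub (reduced_paths P k) (reduced_paths P' l)).
Local Notation Om k := (omega_sub (reduced_paths P) k).
Local Notation Om' l := (omega_sub (reduced_paths P') l).

(** The boundary modulo reduced paths. It presents [omega_sub] as a kernel on the reduced paths, the
    form to which flatness applies. *)
Definition omega_defect (R : module_pair K) k :
    {linear moore (ambient R) k -> quotm (reduced_paths R k.-1)} :=
  qproj (reduced_paths R k.-1) \o bd_out (moore (ambient R)) k.

Lemma omega_defectP (R : module_pair K) k x :
  x \in omega_sub (reduced_paths R) k <-> x \in reduced_paths R k /\ omega_defect R k x = 0.
Proof.
rewrite -[omega_defect R k x]/(qproj _ (bd_out (moore (ambient R)) k x)).
rewrite -(linear0 (qproj (reduced_paths R k.-1))).
split=> [/(in_submod_of (omega_prop _ _)) [xB dx]|[xB /qproj_eq]].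
  by split=> //; apply/qproj_eq; rewrite subr0.
by rewrite subr0 => dx; apply/(in_submod_of (omega_prop _ _)).
Qed.

Lemma moore_free (B : simplicial_module K) k : free_module (B k) -> free_module (moore B k).
Proof. exact: submodule_free. Qed.

Lemma quotient_free (V : lmodType K) (S : submodClosed V) :
  free_module V -> direct_summand S -> free_module (quotm S).
Proof.
move=> fV /summand_quotient_iso [T [f bf]].
by apply: (free_iso bf); apply: submodule_free.
Qed.

Lemma Omega_free (R : module_pair K) n : free_module (ambient R n) -> free_module (Omega R n).
Proof. by move=> Rf; apply: submodule_free => //; apply: submodule_free. Qed.

(** The inclusion is split into one factor at a time, over the free modules Omega P' and N A in
    turn. *)
Lemma tens_incl_inj n : injective (tens_maps (Omega_incl P) (Omega_incl P') n).
Proof.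
apply: inj_of_ker0 => z z0; apply: dsumP => k l; rewrite [RHS]linear0.
have e : tmap (Omega_incl P k) (Omega_incl P' l) (component k l z) = 0.
  by have := congr1 (component k l) z0; rewrite [RHS]linear0.
apply: (@flat_injl _ _ _ _ (Omega_incl P k)); first exact: Omega_free (A'_free l).
  exact: val_inj.
apply: (@flat_injr _ _ _ _ (Omega_incl P' l)); first exact: moore_free (A_free k).
  exact: val_inj.
by rewrite !linear0 -[RHS]e tmap_comp; apply: eq_tmap.
Qed.

Lemma omega_tens n (z : tens_complex (moore A) (moore A') n) :
  (forall k l, component k l z \in red_tens k l) ->
  (forall k l, tmap (omega_defect P k) idfun (component k l z) = 0) ->
  (forall k l, tmap idfun (omega_defect P' l) (component k l z) = 0) ->
  exists w, tens_maps (Omega_incl P) (Omega_incl P') n w = z.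
Proof.
move=> zB zl zr.
have zO k l : component k l z \in tsub (Om k) (Om' l).
  apply: (tsub_kernel (f := omega_defect P k) (f' := omega_defect P' l)
    (S := reduced_paths P k) (S' := reduced_paths P' l)) => //.
  - exact: omega_defectP.
  - exact: omega_defectP.
  - by apply: submodule_free => //; apply: moore_free.
  - exact: Omega_free.
  - by apply: quotient_free => //; apply: moore_free.
  - exact: zB.
have [|w wE'] := @dsum_choice _ (fun k l => tens (Omega P k) (Omega P' l))
  (fun k l => k + l == n)%N
  (fun k l y => tmap (Omega_incl P k) (Omega_incl P' l) y = component k l z).
  by move=> k l _; have /(in_submod_of (rangesub_prop _)) [y ->] := zO k l; exists y.
by exists w; apply: dsum_eq => k l /wE'.
Qed.

(** Let z = alpha x, so that dz = alpha dx is made of reduced paths. Modulo reduced paths in the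
    first factor, the terms of dz differentiating the second factor vanish, since z itself is made
    of reduced paths; so the first-factor defect of z is 0. The second factor is symmetric, up to
    the sign (-1)^k. *)
Lemma AW_omega n (x : Omega (box P P') n) :
  exists w, tens_maps (Omega_incl P) (Omega_incl P') n w =
    AW A A' n (Omega_incl (box P P') n x).
Proof.
have /(in_submod_of (omega_prop _ _)) [xB dx] := valP x.
set y := Omega_incl (box P P') n x; rewrite -[val x]/y in xB dx.
have zB k l : component k l (AW A A' n y) \in red_tens k l by exact: AW_reduced.
apply: omega_tens => // k l.
  case: k => [|k]; first by apply: tmap_0l => v; apply: linear0.
  have [e|ne] := eqVneq (k.+1 + l)%N n; last by rewrite component_off // linear0.
  case: n e {x} y xB dx zB => // n e y xB dx zB.
  have dB := AW_reduced k l dx; rewrite -[bd_out _ _ _]/(bd _ n y) AW_chain_map tens_bdE in dB.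
  have kill v : v \in reduced_paths P k -> qproj (reduced_paths P k) v = 0.
    by move=> vB; rewrite -(linear0 (qproj (reduced_paths P k))); apply/qproj_eq; rewrite subr0.
  have := @tsub_kill_l _ _ _ _ _ (qproj (reduced_paths P k)) (@idfun (moore A' l)) _ _ _ kill dB.
  have z2 : tmap (qproj (reduced_paths P k)) (@idfun (moore A' l)) (tmap idfun (bd (moore A') l)
      (component k l.+1 (AW A A' n.+1 y))) = 0.
    rewrite tmap_comp; exact: (tsub_kill_l _ kill (zB k l.+1)).
  rewrite linearD linearZ_LR z2 scaler0 addr0 tmap_comp => h.
  by rewrite -[RHS]h; apply: eq_tmap.
case: l => [|l]; first by apply: tmap_0r => v; apply: linear0.
have [e|ne] := eqVneq (k + l.+1)%N n; last by rewrite component_off // linear0.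
case: n e {x} y xB dx zB => [|n]; first by rewrite addnS.
move=> e y xB dx zB.
have dB := AW_reduced k l dx; rewrite -[bd_out _ _ _]/(bd _ n y) AW_chain_map tens_bdE in dB.
have kill v : v \in reduced_paths P' l -> qproj (reduced_paths P' l) v = 0.
  by move=> vB; rewrite -(linear0 (qproj (reduced_paths P' l))); apply/qproj_eq; rewrite subr0.
have := @tsub_kill_r _ _ _ _ _ (@idfun (moore A k)) (qproj (reduced_paths P' l)) _ _ _ kill dB.
have z2 : tmap (@idfun (moore A k)) (qproj (reduced_paths P' l)) (tmap (bd (moore A) k) idfun
    (component k.+1 l (AW A A' n.+1 y))) = 0.
  rewrite tmap_comp; exact: (tsub_kill_r _ kill (zB k.+1 l)).
rewrite linearD linearZ_LR z2 add0r tmap_comp => /(congr1 (fun v => (-1) ^+ k *: v)).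
rewrite scalerA -expr2 sqrr_sign scale1r scaler0 => h.
by rewrite -[RHS]h; apply: eq_tmap.
Qed.

Lemma EZ_omega n (z : tens_complex (Omega P) (Omega P') n) :
  exists x, Omega_incl (box P P') n x =
    EZ A A' n (tens_maps (Omega_incl P) (Omega_incl P') n z).
Proof.
set y := tens_maps _ _ _ _.
have yE k l : component k l y = tmap (Omega_incl P k) (Omega_incl P' l) (component k l z) by [].
have yO k l : component k l y \in tsub (Om k) (Om' l).
  by rewrite yE; apply/(in_submod_of (rangesub_prop _)); exists (component k l z).
have omB (R : module_pair K) k x :
    x \in omega_sub (reduced_paths R) k -> idfun x \in reduced_paths R k.
  by move=> /(in_submod_of (omega_prop _ _)) [].
have omD (R : module_pair K) k x : x \in omega_sub (reduced_paths R) k ->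
    bd_out (moore (ambient R)) k x \in reduced_paths R k.-1.
  by move=> /(in_submod_of (omega_prop _ _)) [].
have yP : EZ A A' n y \in omega_sub (reduced_paths (box P P')) n.
  apply: EZ_bd_reduced => k l.
  - by rewrite -[component k l y]tmap_id; apply: tsub_tmap (yO k l); apply: omB.
  - by apply: tsub_tmap (yO k l); [apply: omD | apply: omB].
  by apply: tsub_tmap (yO k l); [apply: omB | apply: omD].
by exists (Subm yP).
Qed.
End OmegaOfBox.

Theorem theorem8p6 (K : idomainType) (P P' : module_pair K)
  (K_pid : principal_ideal_domain K)
  (P_path : path_pair P) (P'_path : path_pair P')
  (A_free : forall n, free_module (ambient P n))
  (A'_free : forall n, free_module (ambient P' n))
  (B_summand : forall n, direct_summand (reduced_paths P n))
  (B'_summand : forall n, direct_summand (reduced_paths P' n)) :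
  (exists (f : forall n,
             {linear tens_complex (Omega P) (Omega P') n -> Omega (box P P') n})
          (g : forall n,
             {linear Omega (box P P') n -> tens_complex (Omega P) (Omega P') n}),
    [/\ chain_map f, chain_map g,
        (forall n, cancel (f n) (g n)) /\ (forall n, cancel (g n) (f n)),
        (forall n x, Omega_incl (box P P') n (f n x) =
           EZ (ambient P) (ambient P') n
              (tens_maps (Omega_incl P) (Omega_incl P') n x))
      & (forall n y, tens_maps (Omega_incl P) (Omega_incl P') n (g n y) =
           AW (ambient P) (ambient P') n (Omega_incl (box P P') n y))])
  /\
  (forall n : nat,
    exists (f : {linear
                   dsum (fun i j => tens (path_homology P i) (path_homology P' j))
                        (fun i j => i + j == n)%N
                   -> path_homology (box P P') n})
           (g : {linear
                   path_homology (box P P') n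
                   -> dsum (fun i j => Tor1 (path_homology P i) (path_homology P' j))
                           (fun i j => (i + j).+1 == n)%N}),
      short_exact f g).
Proof.
pose A := ambient P; pose A' := ambient P'.
pose incl n := tens_maps (Omega_incl P) (Omega_incl P') n.
have incl_inj n : injective (incl n) by exact: tens_incl_inj.
have box_inj n : injective (Omega_incl (box P P') n) by exact: val_inj.
have fex n : exists f : {linear tens_complex (Omega P) (Omega P') n -> Omega (box P P') n},
    forall x, Omega_incl (box P P') n (f x) = EZ A A' n (incl n x).
  have lin : linear (EZ A A' n \o incl n) by exact: linearP.
  exact: linear_choice lin (box_inj n) (@EZ_omega _ P P' n).
have gex n : exists g : {linear Omega (box P P') n -> tens_complex (Omega P) (Omega P') n},
    forall y, incl n (g y) = AW A A' n (Omega_incl (box P P') n y).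
  have lin : linear (AW A A' n \o Omega_incl (box P P') n) by exact: linearP.
  have ex (x : Omega (box P P') n) := AW_omega K_pid A_free A'_free B'_summand x.
  exact: linear_choice lin (incl_inj n) ex.
have [f fE] : exists f : forall n,
    {linear tens_complex (Omega P) (Omega P') n -> Omega (box P P') n},
    forall n x, Omega_incl (box P P') n (f n x) = EZ A A' n (incl n x).
  by exists (fun n => projT1 (cid (fex n))) => n; apply: projT2 (cid (fex n)).
have [g gE] : exists g : forall n,
    {linear Omega (box P P') n -> tens_complex (Omega P) (Omega P') n},
    forall n y, incl n (g n y) = AW A A' n (Omega_incl (box P P') n y).
  by exists (fun n => projT1 (cid (gex n))) => n; apply: projT2 (cid (gex n)).
have fK n : cancel (f n) (g n).
  by move=> x; apply: incl_inj; rewrite gE fE AW_EZ.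
have gK n : cancel (g n) (f n).
  by move=> x; apply: box_inj; rewrite fE gE; apply: (@EZ_AW _ P P'); apply: valP.
have incl_chain n x : incl n (bd _ n x) = bd _ n (incl n.+1 x).
  apply: dsumP => k l; rewrite tens_bdE -[component k.+1 l _]/(tmap _ _ _).
  rewrite -[component k l.+1 _]/(tmap _ _ _) -[LHS]/(tmap _ _ (component k l (bd _ n x))).
  by rewrite tens_bdE linearD linearZ_LR !tmap_comp; congr (_ + _ *: _); apply: eq_tmap.
have g_chain : chain_map g.
  move=> n x; apply: incl_inj; rewrite gE incl_chain gE -AW_chain_map.
  by [].
(* Epsilon inherits compatibility with the differentials from its inverse. *)
have f_chain : chain_map f.
  by move=> n x; apply: (can_inj (gK n)); rewrite fK g_chain fK.
split; first by exists f, g; split.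
have C_free n : free_module (Omega P n) by apply: Omega_free.
have C'_free n : free_module (Omega P' n) by apply: Omega_free.
have [s _] := splitting_exists K_pid C_free.
have [s' _] := splitting_exists K_pid C'_free.
(* The Kuenneth sequence of Omega P (x) Omega P' is transported along the isomorphism induced on
   homology. *)
move=> n; have [kf [kg ex]] := kunneth K_pid C_free s s' n.
exact: short_exact_iso ex (homology_iso f_chain g_chain fK gK n).
Qed.
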